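(* Let $(X,\Omega)$ be a holomorphically symplectic manifold, let $\pi: X\to B$ be a holomorphic Lagrangian fibration, and let $\eta$ be a closed complex-valued 2-form of Hodge type $(2,0)+(1,1)$ on the base $B$. Then for every $t\in\mathbb{C}$ the form $\Omega_t=\Omega+t\pi^*\eta$ on $X$ is c-symplectic, and the resulting deformation $(X,I_{\Omega_t},\Omega_t)$ preserves the Lagrangian fibration and the base: $\pi: (X,I_{\Omega_t})\to B$ is holomorphic for the original complex structure on $B$, the fibers of $\pi$ are Lagrangian with respect to $\Omega_t$, and the complex structure induced by $I_{\Omega_t}$ on the fibers of $\pi$ is the same as the original one.
   Context: A holomorphically symplectic manifold $(X,\Omega)$ is a complex manifold of complex dimension $2n$ with a closed holomorphic $(2,0)$-form $\Omega$ that is everywhere non-degenerate. A holomorphic Lagrangian fibration on it is a surjective holomorphic map $\pi: X\to B$ to a complex manifold $B$, with connected fibers, whose fibers are Lagrangian with respect to $\Omega$ (each fiber has dimension $n$ and $\Omega$ vanishes on its smooth locus). A c-symplectic form on a smooth manifold of real dimension $4n$ is a closed complex-valued 2-form $\Psi$ with $\Psi^{n+1}=0$ and $(\Psi\wedge\overline\Psi)^n$ nowhere zero. The complex structure $I_\Psi$ induced by $\Psi$ is the unique almost complex structure for which $\Psi$ is a non-degenerate form of Hodge type $(2,0)$; equivalently its $(0,1)$-tangent bundle is $\{v\in TX\otimes\mathbb{C} : \iota_v\Psi=0\}$. It is integrable because $\Psi$ is closed. ''The complex structure on the fibers is the same'' means that $I_{\Omega_t}$ and the original complex structure preserve, and agree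 on, the tangent spaces to the smooth loci of the fibers of $\pi$. *)

(* Defs.v *)
From mathcomp Require Import all_boot all_order all_algebra all_fingroup.
From mathcomp Require Import complex.
From mathcomp Require Import all_classical all_reals all_analysis.

Set Implicit Arguments.
Unset Strict Implicit.
Unset Printing Implicit Defensive.

Import Order.TTheory GRing.Theory Num.Theory.
Import numFieldNormedType.Exports.

Local Open Scope classical_set_scope.
Local Open Scope complex_scope.
Local Open Scope ring_scope.

(* On finite-dimensional spaces and for open U, this is the usual notion of a
   map of class C^k on U. *)
Fixpoint class_C (R : realType) (V W : normedModType R) (k : nat)
    (U : set V) (f : V -> W) : Prop :=
  match k with
  | 0%N => forall x, U x -> {for x, continuous f}
  | k'.+1 => (forall x, U x -> differentiable f x) /\
             (forall v, class_C k' U (fun x => 'D_v f x))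
  end.

Definition smooth_on (R : realType) (V W : normedModType R)
    (U : set V) (f : V -> W) : Prop := forall k, class_C k U f.

Definition csmooth_on (R : realType) (V : normedModType R)
    (U : set V) (f : V -> R[i]) : Prop :=
  smooth_on U (fun x => complex.Re (f x) : R^o) /\
  smooth_on U (fun x => complex.Im (f x) : R^o).

Definition cderive (R : realType) (V : normedModType R)
    (f : V -> R[i]) (v : V) (x : V) : R[i] :=
  ('D_v (fun y => complex.Re (f y) : R^o) x) +i*
  ('D_v (fun y => complex.Im (f y) : R^o) x).

(* C^N is modelled on row vectors (x | y) of size N + N, standing for x + i y;
   multiplication by i is (x | y) |-> (- y | x). *)
Definition stdJ (R : realType) (N : nat) : 'M[R]_(N + N) :=
  block_mx 0 1%:M (- 1%:M) 0.

Definition holomorphic_on (R : realType) (N N' : nat)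
    (U : set 'rV[R]_(N + N)) (f : 'rV[R]_(N + N) -> 'rV[R]_(N' + N')) : Prop :=
  smooth_on U f /\
  forall z u, U z -> 'd f z (u *m stdJ R N) = 'd f z u *m stdJ R N'.

Record chart (R : realType) (d : nat) (X : topologicalType) := Chart {
  cdom : set X;
  cmap : X -> 'rV[R]_d;
  cinv : 'rV[R]_d -> X }.

Definition cimg (R : realType) (d : nat) (X : topologicalType)
    (c : chart R d X) : set 'rV[R]_d := cmap c @` cdom c.

Definition chart_axiom (R : realType) (d : nat) (X : topologicalType)
    (c : chart R d X) : Prop :=
  [/\ open (cdom c),
      open (cimg c),
      (forall x, cdom c x -> cinv c (cmap c x) = x),
      (forall x, cdom c x -> {for x, continuous (cmap c)}) &
      (forall z, cimg c z -> {for z, continuous (cinv c)})].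

Definition overlap (R : realType) (d : nat) (X : topologicalType)
    (c c' : chart R d X) : set 'rV[R]_d := cmap c @` (cdom c `&` cdom c').

Definition transition (R : realType) (d : nat) (X : topologicalType)
    (c c' : chart R d X) : 'rV[R]_d -> 'rV[R]_d := cmap c' \o cinv c.

(* Every point x has a preferred chart [chart_at x] of the atlas.  The tangent
   space at x is 'rV[R]_d, a tangent vector at x being given by its coordinates
   in [chart_at x]. *)
Record smoothManifold (R : realType) (d : nat) := SmoothManifold {
  carrier :> topologicalType;
  carrier_hausdorff : hausdorff_space carrier;
  carrier_second_countable : @second_countable carrier;
  atlas : set (chart R d carrier);
  chart_at : carrier -> chart R d carrier;
  atlas_chart : forall c, atlas c -> chart_axiom c;
  chart_at_atlas : forall x, atlas (chart_at x);
  chart_at_dom : forall x, cdom (chart_at x) x;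
  atlas_smooth : forall c c', atlas c -> atlas c' ->
    smooth_on (overlap c c') (transition c c') }.

Arguments atlas {R d} s _.
Arguments chart_at {R d s} _.

Record complexManifold (R : realType) (N : nat) := ComplexManifold {
  underlying :> smoothManifold R (N + N);
  atlas_holomorphic : forall c c', atlas underlying c -> atlas underlying c' ->
    holomorphic_on (overlap c c') (transition c c') }.

(* The tangent map of the chart c at x, from the tangent space at x (that is,
   coordinates in [chart_at x]) to coordinates in c, and its inverse. *)
Definition to_chart (R : realType) (d : nat) (M : smoothManifold R d)
    (c : chart R d M) (x : M) (u : 'rV[R]_d) : 'rV[R]_d :=
  'd (transition (chart_at x) c) (cmap (chart_at x) x) u.

Definition of_chart (R : realType) (d : nat) (M : smoothManifold R d)
    (c : chart R d M) (x : M) (u : 'rV[R]_d) : 'rV[R]_d :=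
  'd (transition c (chart_at x)) (cmap c x) u.

Definition smooth_map (R : realType) (d d' : nat) (M : smoothManifold R d)
    (M' : smoothManifold R d') (f : M -> M') : Prop :=
  continuous f /\
  forall c c', atlas M c -> atlas M' c' ->
    smooth_on (cmap c @` (cdom c `&` f @^-1` cdom c'))
              (cmap c' \o f \o cinv c).

Definition mdiff (R : realType) (d d' : nat) (M : smoothManifold R d)
    (M' : smoothManifold R d') (f : M -> M') (x : M) (u : 'rV[R]_d) :
    'rV[R]_d' :=
  'd (cmap (chart_at (f x)) \o f \o cinv (chart_at x)) (cmap (chart_at x) x) u.

Definition form (R : realType) (d k : nat) := ('I_k -> 'rV[R]_d) -> R[i].

Definition wedge (R : realType) (d k l : nat) (a : form R d k)
    (b : form R d l) : form R d (k + l) := fun v =>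
  ((k`! * l`!)%:R)^-1 *
  \sum_(s : 'S_(k + l)) (-1) ^+ s * a (fun i => v (s (lshift l i)))
                                  * b (fun j => v (s (rshift k j))).

Fixpoint wedge_pow (R : realType) (d k : nat) (a : form R d k) (p : nat) :
    form R d (p * k) :=
  match p with
  | 0%N => fun _ => 1
  | p'.+1 => wedge a (@wedge_pow R d k a p')
  end.

Arguments wedge_pow {R d k} a p _.

Definition two_tensor (R : realType) (d : nat) :=
  'rV[R]_d -> 'rV[R]_d -> R[i].

Definition form_of (R : realType) (d : nat) (a : two_tensor R d) :
    form R d 2 := fun v => a (v ord0) (v ord_max).

Definition alternating2 (R : realType) (d : nat) (a : two_tensor R d) : Prop :=
  [/\ (forall (r : R) u u' v, a (r *: u + u') v = r%:C * a u v + a u' v),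
      (forall (r : R) u v v', a u (r *: v + v') = r%:C * a u v + a u v') &
      (forall u, a u u = 0)].

Definition nondegenerate (R : realType) (d : nat) (a : two_tensor R d) : Prop :=
  forall u, (forall v, a u v = 0) -> u = 0.

(* Hodge types with respect to a complex structure J on 'rV[R]_d (acting on the
   right).  An alternating form is of type (2,0) iff it is complex bilinear, and
   of type (1,1) iff it is J-invariant. *)
Definition hodge20 (R : realType) (d : nat) (J : 'M[R]_d)
    (a : two_tensor R d) : Prop :=
  forall u v, a (u *m J) v = 'i%C * a u v /\ a u (v *m J) = 'i%C * a u v.

Definition hodge11 (R : realType) (d : nat) (J : 'M[R]_d)
    (a : two_tensor R d) : Prop :=
  forall u v, a (u *m J) (v *m J) = a u v.

Definition hodge20_11 (R : realType) (d : nat) (J : 'M[R]_d)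
    (a : two_tensor R d) : Prop :=
  exists a20 a11 : two_tensor R d,
    [/\ alternating2 a20 /\ hodge20 J a20,
        alternating2 a11 /\ hodge11 J a11 &
        forall u v, a u v = a20 u v + a11 u v].

Definition tensor_field (R : realType) (d : nat) (M : smoothManifold R d) :=
  M -> two_tensor R d.

Definition in_chart (R : realType) (d : nat) (M : smoothManifold R d)
    (Psi : tensor_field M) (c : chart R d M) (u v z : 'rV[R]_d) : R[i] :=
  Psi (cinv c z) (of_chart c (cinv c z) u) (of_chart c (cinv c z) v).

Definition two_form (R : realType) (d : nat) (M : smoothManifold R d)
    (Psi : tensor_field M) : Prop :=
  (forall x, alternating2 (Psi x)) /\
  (forall c u v, atlas M c -> csmooth_on (cimg c) (in_chart Psi c u v)).

(* The exterior derivative, evaluated on constant vector fields of a chart. *)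
Definition closed_form (R : realType) (d : nat) (M : smoothManifold R d)
    (Psi : tensor_field M) : Prop :=
  forall c z u v w, atlas M c -> cimg c z ->
    cderive (in_chart Psi c v w) u z - cderive (in_chart Psi c u w) v z
    + cderive (in_chart Psi c u v) w z = 0.

Definition pullback (R : realType) (d d' : nat) (M : smoothManifold R d)
    (M' : smoothManifold R d') (f : M -> M') (Psi : tensor_field M') :
    tensor_field M := fun x u v => Psi (f x) (mdiff f x u) (mdiff f x v).

Definition c_symplectic (R : realType) (n d : nat) (M : smoothManifold R d)
    (Psi : tensor_field M) : Prop :=
  let psi x := form_of (Psi x) in
  let psibar x := form_of (fun u v => ((Psi x u v)^*)%C) in
  [/\ d = (4 * n)%N,
      two_form Psi,
      closed_form Psi,
      (forall x v, wedge_pow (psi x) n.+1 v = 0) &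
      (forall x, exists v, wedge_pow (wedge (psi x) (psibar x)) n v != 0)].

(* An endomorphism field, I x acting on the right of tangent row vectors. *)
Definition endo_field (R : realType) (d : nat) (M : smoothManifold R d) :=
  M -> 'M[R]_d.

Definition almost_complex (R : realType) (d : nat) (M : smoothManifold R d)
    (I : endo_field M) : Prop :=
  (forall x, I x *m I x = - 1%:M) /\
  (forall c u, atlas M c ->
     smooth_on (cimg c) (fun z =>
       to_chart c (cinv c z) (of_chart c (cinv c z) u *m I (cinv c z)))).

Definition std_complex (R : realType) (N : nat) (X : complexManifold R N) :
    endo_field X := fun _ => stdJ R N.

Arguments std_complex {R N} X _.

Definition induced_complex_structure (R : realType) (d : nat)
    (M : smoothManifold R d) (Psi : tensor_field M) (I : endo_field M) : Prop :=
  almost_complex I /\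
  forall x, hodge20 (I x) (Psi x) /\ nondegenerate (Psi x).

Definition holomorphic_map (R : realType) (d d' : nat) (M : smoothManifold R d)
    (I : endo_field M) (M' : smoothManifold R d') (I' : endo_field M')
    (f : M -> M') : Prop :=
  smooth_map f /\
  forall x u, mdiff f x (u *m I x) = mdiff f x u *m I' (f x).

Definition holomorphically_symplectic (R : realType) (N : nat)
    (X : complexManifold R N) (Omega : tensor_field X) : Prop :=
  [/\ two_form Omega,
      closed_form Omega,
      (forall x, hodge20 (std_complex X x) (Omega x)),
      (forall c z u v w, atlas X c -> cimg c z ->
         cderive (in_chart Omega c u v) (w *m stdJ R N) z =
         'i%C * cderive (in_chart Omega c u v) w z) &
      (forall x, nondegenerate (Omega x))].

(* A chart of the maximal holomorphic atlas of X. *)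
Definition holomorphic_chart (R : realType) (N : nat) (X : complexManifold R N)
    (c : chart R (N + N) X) : Prop :=
  chart_axiom c /\
  forall c', atlas X c' ->
    holomorphic_on (overlap c c') (transition c c') /\
    holomorphic_on (overlap c' c) (transition c' c).

(* C^k inside C^N: the complex coordinates of index >= k vanish. *)
Definition slice (R : realType) (N k : nat) : set 'rV[R]_(N + N) :=
  [set z | forall j : 'I_N, (k <= j)%N ->
     z ord0 (lshift N j) = 0 /\ z ord0 (rshift N j) = 0].

Arguments slice {R} N k _.

Definition adapted_chart (R : realType) (N : nat) (X : complexManifold R N)
    (F : set X) (k : nat) (x : X) (c : chart R (N + N) X) : Prop :=
  [/\ holomorphic_chart c, cdom c x, (k <= N)%N &
      forall y, cdom c y -> (F y <-> slice N k (cmap c y))].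

Definition smooth_point (R : realType) (N : nat) (X : complexManifold R N)
    (F : set X) (k : nat) (x : X) : Prop :=
  F x /\ exists c, adapted_chart F k x c.

(* u is tangent at x to the smooth locus of F (in particular x belongs to it). *)
Definition tangent (R : realType) (N : nat) (X : complexManifold R N)
    (F : set X) (x : X) (u : 'rV[R]_(N + N)) : Prop :=
  F x /\ exists k c, adapted_chart F k x c /\ slice N k (to_chart c x u).

(* F is pure-dimensional of dimension k: its smooth locus is nonempty and has
   complex dimension k at every point. *)
Definition has_dimension (R : realType) (N : nat) (X : complexManifold R N)
    (F : set X) (k : nat) : Prop :=
  (exists x, smooth_point F k x) /\
  (forall x l, smooth_point F l x -> l = k).

(* The smooth locus is that of F in the complex manifold X, also when Psi is not
   of type (2,0) on X. *)
Definition lagrangian (R : realType) (n : nat)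
    (X : complexManifold R (2 * n)%N) (Psi : tensor_field X) (F : set X) : Prop :=
  has_dimension F n /\
  forall x u v, tangent F x u -> tangent F x v -> Psi x u v = 0.

Definition fiber (R : realType) (N m : nat) (X : complexManifold R N)
    (B : complexManifold R m) (pi : X -> B) (b : B) : set X := pi @^-1` [set b].

Definition lagrangian_fibration (R : realType) (n m : nat)
    (X : complexManifold R (2 * n)%N) (Omega : tensor_field X)
    (B : complexManifold R m) (pi : X -> B) : Prop :=
  [/\ holomorphic_map (std_complex X) (std_complex B) pi,
      (forall b, exists x, pi x = b),
      (forall b, connected (fiber pi b)) &
      (forall b, lagrangian Omega (fiber pi b))].

Definition twisted (R : realType) (N m : nat) (X : complexManifold R N)
    (Omega : tensor_field X) (B : complexManifold R m) (pi : X -> B)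
    (eta : tensor_field B) (t : R[i]) : tensor_field X :=
  fun x u v => Omega x u v + t * pullback pi eta x u v.

(* Main.v *)
(* Write J for the complex structure of X and put sigma = t pi^* eta.  Since
   Omega is nondegenerate, there is an endomorphism N of TX with
   Omega (N u, w) = i sigma (u, w) - sigma (J u, w).  As eta has type
   (2,0)+(1,1), so has sigma, whence Omega (N u, w) is complex linear in w and
   I = J + N satisfies Omega_t (I u, w) = i Omega_t (u, w).  The kernel K of
   d pi lies in ker N; the image of N lies in the orthogonal of K, hence in K
   when K is coisotropic.  Then N^2 = 0 and N anticommutes with J, so that
   I^2 = -1, I is conjugate to J by 1 + J N / 2, and I induces J on K and on the
   base.  In particular Omega_t is a nondegenerate complex bilinear form on a
   2n-dimensional complex space, so Omega_t^{n+1} = 0, and a Darboux frame shows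
   that (Omega_t /\ conj Omega_t)^n does not vanish.  Taking real and imaginary
   parts, I = - Im Omega_t (Re Omega_t)^-1, which gives smoothness and
   uniqueness of I.

   The hypothesis on the fibres only concerns their smooth loci, so that K is
   coisotropic is proved first at points where d pi has locally maximal rank:
   by the constant rank theorem these are smooth points of their fibre, with
   tangent space K.  Such points are dense, and coisotropy is a closed
   condition. *)

Require Import Defs.
From mathcomp Require Import all_boot all_order all_algebra all_fingroup.
From mathcomp Require Import complex.
From mathcomp Require Import all_classical all_reals all_analysis.
From mathcomp Require Import ring lra zify.

Set Implicit Arguments.
Unset Strict Implicit.
Unset Printing Implicit Defensive.

Import Order.TTheory GRing.Theory Num.Theory.
Import numFieldNormedType.Exports.

Local Open Scope classical_set_scope.
Local Open Scope complex_scope.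
Local Open Scope ring_scope.

(** In i sigma (u, w) - sigma (J u, w) the (2,0) part of sigma cancels, so only the (1,1) part moves
    the complex structure. A (0,2) part would survive and be antilinear in w, and no N could
    represent it.

    The kernel of d pi may jump in dimension, so a condition on it does not pass to limits.
    Coisotropy is therefore the matrix equation [P^T *m invmx W *m P = 0], with [P] the matrix of d
    pi and [W] that of Re Omega. It is closed, and it is the form in which the twist consumes it.
    The real part is enough because it determines a form of type (2,0).

    The top power is evaluated on real vectors, whereas a Darboux frame suited to both Omega_t and
    its conjugate is made of complex ones. The forms are extended to C^{2n} x C^{2n}, where the real
    vectors are the pairs (z, conj z): a complex multilinear map that vanishes on these vanishes. On
    the frame each term of the alternating sum is 0 or 1, because the sign of the permutation
    cancels against the signs of the form, so the sum is a positive integer. *)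

Lemma row_free_eq0 (F : fieldType) d (M : 'M[F]_d) : (forall v : 'rV[F]_d, v *m M = 0 -> v = 0) -> M \in unitmx.
Proof.
move=> H; rewrite -row_free_unit -kermx_eq0; apply/rowV0P => v /sub_kermxP.
exact: H.
Qed.

Lemma bilin_mxE (F : comNzRingType) d e (M : 'M[F]_(d, e)) (u : 'rV[F]_d) (v : 'rV[F]_e) :
  (u *m M *m v^T) 0 0 = \sum_(i < d) \sum_(j < e) u 0 i * v 0 j * M i j.
Proof.
rewrite mxE exchange_big /=; apply: eq_bigr => j _.
rewrite !mxE mulr_suml; apply: eq_bigr => i _; ring.
Qed.

(** * Calculus of maps of class C^k *)

Section ClassC.
Context {R : realType} {V : normedModType R}.
Implicit Types (W : normedModType R) (U : set V) (k : nat).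

Lemma differentiable_near_eq W (f g : V -> W) x :
  (\near x, f x = g x) -> differentiable f x -> differentiable g x.
Proof.
move=> fg df; have [dfc dfl] := (diff_locallyP _ _).1 df.
have fgx : f x = g x by exact: nbhs_singleton fg.
suff H : g \o shift x = cst (g x) + 'd f x +o_ (0 : V) id.
  have := diff_unique dfc H => dE; apply/diff_locallyP; split.
    by rewrite dE.
  by rewrite dE.
rewrite -fgx; apply/eqaddoP => e e0.
have /eqaddoP/(_ e e0) := dfl.
have := fg; rewrite (near_shift (0 : V)) /=.
apply: filterS2 => y /=; rewrite subr0 => fgy.
by rewrite !fctE /= fgy.
Qed.

Lemma diff_near_eq W (f g : V -> W) x v :
  (\near x, f x = g x) -> differentiable f x -> 'd g x v = 'd f x v.
Proof.
move=> fg df; have dg := differentiable_near_eq fg df.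
by rewrite -!deriveE//; apply/esym/near_eq_derive.
Qed.

Lemma class_C_sub W k U U' (f : V -> W) :
  U' `<=` U -> class_C k U f -> class_C k U' f.
Proof.
move=> sU; elim: k f => [|k IH] f /=; first by move=> H x /sU; exact: H.
by move=> [df H]; split=> [x /sU/df//|v]; exact: IH.
Qed.

(** [class_C] differentiates the total function [f] at the points of the set and never restricts
    [f]. It is thus a condition at each point, and a cover by arbitrary sets is enough. *)
Lemma class_C_local W k U (f : V -> W) :
  (forall x, U x -> exists2 U', U' x & class_C k U' f) -> class_C k U f.
Proof.
elim: k f => [|k IH] f /= H; first by move=> x Ux; have [U' U'x /(_ x U'x)] := H x Ux.
split=> [x Ux|v]; first by have [U' U'x [/(_ x U'x)]] := H x Ux.
by apply: IH => x Ux; have [U' U'x [_ Cv]] := H x Ux; exists U'.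
Qed.

Lemma class_C_differentiable W k U (f : V -> W) x :
  class_C k.+1 U f -> U x -> differentiable f x.
Proof. by case=> H _; exact: H. Qed.

Lemma class_CW W k U (f : V -> W) : class_C k.+1 U f -> class_C k U f.
Proof.
elim: k f => [|k IH] f [df Cv]; first by move=> x /df; exact: differentiable_continuous.
by split=> // v; apply: IH; exact: Cv.
Qed.

Lemma class_C_ext W k U (f g : V -> W) : open U ->
  (forall x, U x -> f x = g x) -> class_C k U f -> class_C k U g.
Proof.
move=> oU; have nU x : U x -> nbhs x U by move=> Ux; exact: open_nbhs_nbhs.
elim: k f g => [|k IH] f g fg.
  move=> Cf x Ux; have fgx : \near x, f x = g x by apply: filterS (nU _ Ux).
  suff : g y @[y --> x] --> g x by [].
  by rewrite -(fg _ Ux); apply: cvg_trans (Cf x Ux); exact: near_eq_cvg.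
have fgx x : U x -> \near x, f x = g x by move=> /nU; apply: filterS.
move=> [df Cf]; split=> [x Ux|v].
  exact: differentiable_near_eq (fgx _ Ux) (df _ Ux).
by apply: IH (Cf v) => x /fgx; exact: near_eq_derive.
Qed.

Lemma class_C_cst W k U (a : W) : class_C k U (fun=> a).
Proof.
elim: k a => [|k IH] a /=; first by move=> x _; exact: cst_continuous.
split=> [x _|v]; first exact: differentiable_cst.
have -> : 'D_v (fun=> a : W) = (fun=> 0 : W) by apply: boolp.funext => x; exact: derive_cst.
exact: IH.
Qed.

Lemma class_C_linear W k U (f : {linear V -> W}) :
  continuous f -> class_C k U f.
Proof.
case: k => [|k] fc; first by move=> x _; exact: fc.
split=> [x _|v]; first exact: linear_differentiable.
have -> : 'D_v f = fun=> f v; last exact: class_C_cst.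
by apply/funext => x; rewrite deriveE ?diff_lin//; exact: linear_differentiable.
Qed.

Lemma class_C_add W k U (f g : V -> W) : open U ->
  class_C k U f -> class_C k U g -> class_C k U (f + g).
Proof.
move=> oU; elim: k f g => [|k IH] f g.
  by move=> Cf Cg x Ux; apply: continuousD; [exact: Cf|exact: Cg].
move=> [df Cf] [dg Cg]; split=> [x Ux|v].
  by apply: differentiableD; [exact: df|exact: dg].
apply: class_C_ext oU _ (IH _ _ (Cf v) (Cg v)) => x Ux /=.
by rewrite deriveD//; [exact/diff_derivable/df|exact/diff_derivable/dg].
Qed.

Lemma class_C_mul k U (f g : V -> R^o) : open U ->
  class_C k U f -> class_C k U g -> class_C k U (fun x => f x * g x : R^o).
Proof.
move=> oU; elim: k f g => [|k IH] f g.
  by move=> Cf Cg x Ux; apply: continuousM; [exact: Cf|exact: Cg].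
move=> Cf Cg; split=> [x Ux|v].
  by apply: differentiableM; [exact: (class_C_differentiable Cf)|exact: (class_C_differentiable Cg)].
have := class_C_add oU (IH _ _ (class_CW Cf) (Cg.2 v)) (IH _ _ (class_CW Cg) (Cf.2 v)).
apply: class_C_ext => // x Ux /=.
rewrite deriveM//; [exact/diff_derivable/Cf.1|exact/diff_derivable/Cg.1].
Qed.

Lemma class_C_scale k U (a : R) (f : V -> R^o) : open U ->
  class_C k U f -> class_C k U (fun x => a * f x : R^o).
Proof. by move=> oU; apply: class_C_mul => //; exact: class_C_cst. Qed.

Lemma class_C_sum k U I (r : seq I) (P : pred I) (F : I -> V -> R^o) : open U ->
  (forall i, P i -> class_C k U (F i)) ->
  class_C k U (fun x => \sum_(i <- r | P i) F i x : R^o).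
Proof.
move=> oU CF; elim: r => [|i r IH].
  by under eq_fun do rewrite big_nil; exact: class_C_cst.
under eq_fun do rewrite big_cons; case: (boolP (P i)) => // Pi.
exact: class_C_add (CF _ Pi) IH.
Qed.

Lemma class_C_prod k U I (r : seq I) (P : pred I) (F : I -> V -> R^o) : open U ->
  (forall i, P i -> class_C k U (F i)) ->
  class_C k U (fun x => \prod_(i <- r | P i) F i x : R^o).
Proof.
move=> oU CF; elim: r => [|i r IH].
  by under eq_fun do rewrite big_nil; exact: class_C_cst.
under eq_fun do rewrite big_cons; case: (boolP (P i)) => // Pi.
exact: class_C_mul (CF _ Pi) IH.
Qed.

Lemma class_C_inv k U (f : V -> R^o) : open U ->
  (forall x, U x -> f x != 0) ->
  class_C k U f -> class_C k U (fun x => (f x)^-1 : R^o).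
Proof.
move=> oU f0; elim: k f f0 => [|k IH] f f0.
  by move=> Cf x Ux; apply: continuousV; [exact: f0|exact: Cf].
move=> Cf; split=> [x Ux|v].
  by apply: differentiableV; [exact: Cf.1|exact: f0].
have Ci := IH _ f0 (class_CW Cf).
have := class_C_scale (-1) oU (class_C_mul oU (class_C_mul oU Ci Ci) (Cf.2 v)).
apply: class_C_ext => // x Ux /=.
rewrite (@deriveV _ _ f)//; [|exact: f0|exact/diff_derivable/Cf.1].
by rewrite mulN1r scaleNr /GRing.scale /= -expr2 exprVn.
Qed.

End ClassC.

Section ClassCMatrix.
Context {R : realType} {V : normedModType R}.
Implicit Types (U : set V) (k : nat).

Lemma differentiable_mxP m n (f : V -> 'M[R]_(m, n)) x :
  differentiable f x <-> forall i j, differentiable (fun y => f y i j : R^o) x.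
Proof.
split=> [df i j|df].
  by apply: (@differentiable_comp _ _ _ _ f (fun M => M i j : R^o)) => //; exact: differentiable_coord.
have -> : f = \sum_(i < m) \sum_(j < n) (fun y => (f y i j : R^o) *: delta_mx i j).
  apply/funext => y; rewrite [LHS]matrix_sum_delta fct_sumE.
  by apply: eq_bigr => i _; rewrite fct_sumE.
do 2!apply: differentiable_sum => ?.
by apply: differentiableZl; exact: df.
Qed.

Lemma derive_mx_coord m n (f : V -> 'M[R]_(m, n)) x v i j :
  differentiable f x -> ('D_v f x) i j = 'D_v (fun y => f y i j : R^o) x.
Proof. by move=> df; rewrite derive_mx ?mxE//; exact: diff_derivable. Qed.

Lemma class_C_mxP m n k U (f : V -> 'M[R]_(m, n)) : open U ->
  class_C k U f <-> forall i j, class_C k U (fun y => f y i j : R^o).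
Proof.
move=> oU; elim: k f => [|k IH] f.
  split=> [Cf i j x Ux|Cf x Ux].
    apply: (@continuous_comp _ _ _ f (fun M : 'M[R]_(m, n) => M i j)); first exact: Cf.
    exact: coord_continuous.
  move=> A [P nP sP]; have H i j := Cf i j x Ux _ (nP i j).
  have : \forall y \near x, forall ij : 'I_m * 'I_n, P ij.1 ij.2 (f y ij.1 ij.2).
    by apply: filter_forall => ij; exact: (H ij.1 ij.2).
  by apply: filterS => y Py; apply: sP => i j; exact: (Py (i, j)).
split=> [[df Cf] i j|Cf].
  split=> [x /df/differentiable_mxP//|v].
  have /(_ i j) := (IH _).1 (Cf v); apply: class_C_ext => // x Ux.
  by rewrite derive_mx_coord//; exact: df.
have df x : U x -> differentiable f x.
  by move=> Ux; apply/differentiable_mxP => i j; exact: (Cf i j).1.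
split=> // v; apply/IH => i j.
by have := (Cf i j).2 v; apply: class_C_ext => // x Ux; rewrite derive_mx_coord//; exact: df.
Qed.

Lemma class_C_mulmx m n p k U (f : V -> 'M[R]_(m, n)) (g : V -> 'M[R]_(n, p)) :
  open U -> class_C k U f -> class_C k U g -> class_C k U (fun x => f x *m g x).
Proof.
move=> oU /(class_C_mxP _ _ oU) Cf /(class_C_mxP _ _ oU) Cg.
apply/class_C_mxP => // i j; under eq_fun do rewrite mxE.
by apply: class_C_sum => // l _; exact: class_C_mul.
Qed.

Lemma class_C_det n k U (f : V -> 'M[R]_n) :
  open U -> class_C k U f -> class_C k U (fun x => \det (f x) : R^o).
Proof.
move=> oU /(class_C_mxP _ _ oU) Cf; apply: class_C_sum => // s _.
by apply: class_C_scale => //; apply: class_C_prod.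
Qed.

(** Cramer's rule: the entries of [\adj (f x)] are polynomial in those of [f x], and the determinant
    does not vanish on [U]. *)
Lemma class_C_invmx n k U (f : V -> 'M[R]_n) : open U ->
  (forall x, U x -> f x \in unitmx) ->
  class_C k U f -> class_C k U (fun x => invmx (f x)).
Proof.
move=> oU uf Cf.
have Ci : class_C k U (fun x => (\det (f x))^-1 : R^o).
  apply: class_C_inv => //; last exact: class_C_det.
  by move=> x /uf; rewrite unitmxE unitfE.
suff : class_C k U (fun x => (\det (f x))^-1 *: \adj (f x)).
  by apply: class_C_ext => // x /uf ufx; rewrite /invmx ufx.
apply/class_C_mxP => // i j; under eq_fun do rewrite mxE.
apply: class_C_mul => //; under eq_fun do rewrite mxE.
apply: class_C_scale => //; apply: class_C_det => //.
apply/class_C_mxP => // i' j'; under eq_fun do rewrite !mxE.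
by move/(class_C_mxP _ _ oU): Cf => Cf; exact: Cf.
Qed.

End ClassCMatrix.

Section ClassCComp.
Context {R : realType} {V : normedModType R}.
Implicit Types (U : set V) (k : nat).

Lemma diff_row_sum d (W : normedModType R) (f : 'rV[R]_d -> W) x u :
  differentiable f x -> 'd f x u = \sum_(i < d) u ord0 i *: 'D_(delta_mx 0 i) f x.
Proof.
move=> df; rewrite [u in LHS]row_sum_delta linear_sum; apply: eq_bigr => i _.
by rewrite linearZ deriveE.
Qed.

(** In coordinates, the chain rule for ['D_v (g \o f)] only involves partial derivatives of [g]
    composed with [f], to which the induction hypothesis applies. Taking [g] scalar makes every term
    a product covered by [class_C_mul]. *)
Lemma class_C_comp d k U (U' : set 'rV[R]_d) (f : V -> 'rV[R]_d) (g : 'rV[R]_d -> R^o) :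
  open U -> open U' -> (forall x, U x -> U' (f x)) ->
  class_C k U f -> class_C k U' g -> class_C k U (g \o f).
Proof.
move=> oU oU' sU; elim: k f g sU => [|k IH] f g sU.
  by move=> Cf Cg x Ux; apply: continuous_comp; [exact: Cf|exact/Cg/sU].
move=> Cf Cg; split=> [x Ux|v].
  by apply: differentiable_comp; [exact: Cf.1|exact/Cg.1/sU].
suff : class_C k U (fun x => \sum_(i < d) ('D_v f x) 0 i * 'D_(delta_mx 0 i) g (f x) : R^o).
  apply: class_C_ext => // x Ux.
  have df : differentiable f x by exact: Cf.1.
  have dg : differentiable g (f x) by exact/Cg.1/sU.
  rewrite [RHS]deriveE; last exact: differentiable_comp.
  rewrite diff_comp //= diff_row_sum //.
  by apply: eq_bigr => i _; rewrite deriveE.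
apply: class_C_sum => // i _; apply: class_C_mul => //.
  by have /(class_C_mxP _ _ oU) := Cf.2 v; exact.
by apply: IH (Cg.2 _) => //; exact: class_CW.
Qed.

Lemma class_C_comp_mx d m n k U (U' : set 'rV[R]_d) (f : V -> 'rV[R]_d) (g : 'rV[R]_d -> 'M[R]_(m, n)) :
  open U -> open U' -> (forall x, U x -> U' (f x)) ->
  class_C k U f -> class_C k U' g -> class_C k U (g \o f).
Proof.
move=> oU oU' sU Cf /(class_C_mxP _ _ oU') Cg; apply/class_C_mxP => // i j.
exact: class_C_comp oU oU' sU Cf (Cg i j).
Qed.

End ClassCComp.

(** * Mean value theorem and symmetry of second derivatives *)

Section MeanValue.
Context {R : realType} {V : normedModType R}.

Lemma mean_value (f : V -> R^o) x v :
  (forall t : R, 0 <= t <= 1 -> differentiable f (x + t *: v)) ->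
  exists2 t : R, 0 <= t <= 1 & f (x + v) - f x = 'd f (x + t *: v) v.
Proof.
move=> df; pose l (t : R^o) : V := x + t *: v.
have dl t : is_diff t l ( *:%R ^~ v).
  by rewrite /l; apply: is_diff_eq; rewrite add0r.
have dfl (t : R^o) : 0 <= t <= 1 -> is_diff t (f \o l) ('d f (l t) \o ( *:%R ^~ v)).
  by move=> /df dft; apply: is_diff_comp; exact: differentiableP.
have [t|t|t tI /=] := @MVT_segment R (f \o l) (fun t => 'd f (l t) v) 0 1 ler01.
- rewrite in_itv /= => /andP[t0 t1].
  have tI : 0 <= t <= 1 by rewrite !ltW.
  have [dt Et] := dfl _ tI; apply: DeriveDef; first exact: diff_derivable.
  by rewrite deriveE// Et /= scale1r.
- apply: continuous_in_subspaceT t => t; rewrite inE /= in_itv /= => /dfl[dt _].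
  exact: differentiable_continuous.
- rewrite subr0 mulr1 /l scale1r scale0r addr0 => ->; by exists t.
Qed.

Lemma ball_segment (x0 x y : V) (r t : R) :
  ball x0 r x -> ball x0 r y -> 0 <= t <= 1 -> ball x0 r (x + t *: (y - x)).
Proof.
rewrite -!ball_normE /= => xr yr /andP[t0 t1].
have -> : x0 - (x + t *: (y - x)) = (1 - t) *: (x0 - x) + t *: (x0 - y).
  have -> : y - x = (x0 - x) - (x0 - y) by rewrite opprB [RHS]addrC subrKA.
  by rewrite opprD addrA scalerBr opprB scalerBl scale1r -[RHS]addrA [_ + t *: (x0 - y)]addrC.
rewrite (le_lt_trans (ler_normD _ _))// !normrZ (ger0_norm t0) ger0_norm ?subr_ge0//.
have [->|tn0] := eqVneq t 0; first by rewrite subr0 mul1r mul0r addr0.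
have tp : 0 < t by rewrite lt_def tn0.
rewrite (@lt_le_trans _ _ ((1 - t) * r + t * r))//; last by rewrite -mulrDl subrK mul1r.
by rewrite ler_ltD// ?ltr_pM2l// ler_wpM2l// ?subr_ge0// ltW.
Qed.

(** The mean value theorem is applied to [f (z + v) - f z] along [u], then to ['D_u f] along [v].
    The second difference is symmetric in [u] and [v] while the mixed derivative is not visibly so;
    this is the source of [derive_comm]. *)
Lemma second_difference (U : set V) (f : V -> R^o) x u v : open U ->
  class_C 2 U f ->
  (forall s t : R, 0 <= s <= 1 -> 0 <= t <= 1 -> U (x + s *: u + t *: v)) ->
  exists s t : R, [/\ 0 <= s <= 1, 0 <= t <= 1 &
    f (x + u + v) - f (x + u) - (f (x + v) - f x) =
    'D_v ('D_u f) (x + s *: u + t *: v)].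
Proof.
move=> oU Cf sU.
have dsh (g : V -> R^o) w y : differentiable g (y + w) ->
    differentiable (fun z => g (z + w)) y /\ 'd (fun z => g (z + w)) y =1 'd g (y + w).
  move=> dg; have H : is_diff y (g \o (+%R^~ w)) ('d g (y + w) \o id).
    apply: is_diff_comp; last exact: differentiableP.
    have := @is_diffD _ _ _ id (cst w) _ _ y (is_diff_id y) (is_diff_cst w y).
    by move=> HH; apply: is_diff_eq; rewrite addr0.
  by case: H => H1 H2; split => // z; rewrite H2.
have df s t : 0 <= s <= 1 -> 0 <= t <= 1 -> differentiable f (x + s *: u + t *: v).
  by move=> s1 t1; exact/Cf.1/sU.
have I0 : 0 <= (0 : R) <= 1 by rewrite lexx ler01.
have I1 : 0 <= (1 : R) <= 1 by rewrite lexx ler01.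
have d1 s : 0 <= s <= 1 -> differentiable f (x + s *: u + v).
  by move=> sI; have := df s 1 sI I1; rewrite scale1r.
have d0 s : 0 <= s <= 1 -> differentiable f (x + s *: u).
  by move=> sI; have := df s 0 sI I0; rewrite scale0r addr0.
have [t|s sI] := @mean_value (fun z => f (z + v) - f z) x u.
  by move=> tI; apply: differentiableB; [exact/(dsh _ _ _ _).1/d1|exact: d0].
have ds := (dsh f v (x + s *: u) (d1 s sI)).1.
rewrite (_ : (fun z => _) = (fun z => f (z + v)) - f)// diffB//; last exact: d0.
rewrite /= (dsh f v (x + s *: u) (d1 s sI)).2 -!deriveE; [|exact: d0|exact: d1].
move=> E; rewrite addrAC in E.
have [t tI|t tI E'] := @mean_value ('D_u f) (x + s *: u) v.
  exact/(Cf.2 u).1/sU.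
exists s, t; split => //; rewrite [LHS](_ : _ = 'D_u f (x + s *: u + v) - 'D_u f (x + s *: u)).
  by rewrite E' deriveE//; exact/(Cf.2 u).1/sU.
by rewrite -E addrAC.
Qed.

Lemma dist_half_absurd (p q z : R) :
  `|p - z| < `|p - q| / 2 -> `|q - z| < `|p - q| / 2 -> False.
Proof. by move=> pz qz; have := ler_distD z p q; rewrite (distrC z q); lra. Qed.

Lemma derive_comm (U : set V) (f : V -> R^o) x u v : open U -> U x ->
  class_C 2 U f -> 'D_u ('D_v f) x = 'D_v ('D_u f) x.
Proof.
move=> oU Ux Cf; apply/eqP; apply: contraT => neq.
set a := 'D_u _ x in neq *; set b := 'D_v _ x in neq *.
have e0 : 0 < `|a - b| / 2 by rewrite divr_gt0// normr_gt0 subr_eq0.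
have Ca : {for x, continuous ('D_u ('D_v f))} by exact: ((Cf.2 v).2 u).
have Cb : {for x, continuous ('D_v ('D_u f))} by exact: ((Cf.2 u).2 v).
have [r /= r0 rP] : nbhs_ball x [set y | U y /\
    `|a - 'D_u ('D_v f) y| < `|a - b| / 2 /\ `|b - 'D_v ('D_u f) y| < `|a - b| / 2].
  apply/nbhs_ballP; apply: filterI; first exact: open_nbhs_nbhs.
  by apply: filterI; [move/cvgrPdist_lt : Ca; exact|move/cvgrPdist_lt : Cb; exact].
(* With this scale the parallelogram spanned by [h *: u] and [h *: v] stays within distance r / 2 of
   [x]. The summand 1 keeps the denominator positive when [u] and [v] vanish. *)
have [h Eh] : exists h, h = r / (2 * (`|u| + `|v| + 1)) by eexists.
have N0 : 0 < `|u| + `|v| + 1 by rewrite ltr_wpDl// addr_ge0.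
have h0 : 0 < h by rewrite Eh divr_gt0// mulr_gt0.
have inB (s t : R) : 0 <= s <= 1 -> 0 <= t <= 1 -> ball x r (x + s *: (h *: u) + t *: (h *: v)).
  move=> /andP[s0 s1] /andP[t0 t1]; rewrite -ball_normE /=.
  rewrite -addrA opprD addNKr normrN (le_lt_trans (ler_normD _ _))// !normrZ.
  rewrite (ger0_norm s0) (ger0_norm t0) (gtr0_norm h0).
  apply: (@le_lt_trans _ _ (h * (`|u| + `|v| + 1))); last first.
    rewrite Eh invfM mulrA divfK ?gt_eqF//.
    by rewrite ltr_pdivrMr// ltr_pMr// ltr1n.
  rewrite !mulrDr mulr1 -[leLHS]addr0 lerD ?(ltW h0)//.
  by rewrite lerD// ler_piMl// mulr_ge0// ltW.
have [s [t [sI tI E]]] := second_difference oU Cf (fun s t sI tI => (rP _ (inB s t sI tI)).1).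
have inB' (p q : R) : 0 <= p <= 1 -> 0 <= q <= 1 -> ball x r (x + p *: (h *: v) + q *: (h *: u)).
  by move=> s1 t1; rewrite addrAC; exact: inB.
have [s' [t' [sI' tI' E']]] := second_difference oU Cf (fun s t sI tI => (rP _ (inB' s t sI tI)).1).
have sc (g : V -> R^o) w y : differentiable g y -> 'D_(h *: w) g y = h * 'D_w g y.
  by move=> dg; rewrite !deriveE// linearZ.
have sc2 p w1 w2 : U p -> 'D_(h *: w1) ('D_(h *: w2) f) p = h * (h * 'D_w1 ('D_w2 f) p).
  move=> Up; rewrite sc; last exact: (Cf.2 _).1.
  have E2 : \near p, 'D_(h *: w2) f p = (h *: ('D_w2 f : V -> R^o)) p.
    have : nbhs p U by exact: open_nbhs_nbhs.
    by apply: filterS => q Uq; rewrite sc//; exact: Cf.1.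
  congr (_ * _); apply: (eq_trans (near_eq_derive w1 E2)).
  by apply: deriveZ; apply: diff_derivable; exact: (Cf.2 w2).1.
have [Up [pa pb]] := rP _ (inB s t sI tI).
have [Uq [qa qb]] := rP _ (inB' s' t' sI' tI').
(* Both sides are the same second difference divided by h^2. This common value lies at less than
   half of [|a - b|] from [a] and from [b], which is absurd. *)
have pq : 'D_v ('D_u f) (x + s *: (h *: u) + t *: (h *: v)) =
          'D_u ('D_v f) (x + s' *: (h *: v) + t' *: (h *: u)).
  rewrite (sc2 _ v u Up) in E; rewrite (sc2 _ u v Uq) in E'.
  have cancel (p q : R) : h * (h * p) = h * (h * q) -> p = q.
    by move=> /(mulfI (lt0r_neq0 h0)) /(mulfI (lt0r_neq0 h0)).
  apply: cancel; apply: eq_trans (esym E) (eq_trans _ E').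
  have swap (k l p q : R) : k - l - (p - q) = k - p - (l - q) by ring.
  by rewrite [x + _ + _]addrAC; exact: swap.
move: qa pb; rewrite -pq; set c := 'D_v _ _ => ac bc.
by case: (dist_half_absurd ac bc).
Qed.

End MeanValue.

(** * Inverse function theorem *)

Lemma subr_swap (V : zmodType) (a b c d : V) : a - b - (c - d) = a - c - (b - d).
Proof. by rewrite !opprB [LHS]addrACA [RHS]addrACA [- b - c]addrC. Qed.

Lemma subr_shift (V : zmodType) (a b p q : V) : p + q - a = p - (a - b) + (q - b).
Proof. by rewrite opprB [RHS]addrACA [b - a - b]addrAC subrr sub0r. Qed.

Section InverseFunction.
Context {R : realType}.

Lemma is_diff_eps (V W : normedModType R) (f : V -> W) x (L : {linear V -> W}) :
  continuous L ->
  (forall e, 0 < e -> \forall y \near x, `|f y - f x - L (y - x)| <= e * `|y - x|) ->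
  is_diff x f L.
Proof.
move=> Lc H.
have E : f \o shift x = cst (f x) + L +o_ (0 : V) id.
  apply/eqaddoP => e e0; have := H e e0; rewrite (near_shift (0 : V)) /=.
  apply: filterS => y /=; rewrite subr0 addrK !fctE /=.
  by rewrite opprD addrA.
have dE := diff_unique Lc E.
by apply: DiffDef => //; apply/diff_locallyP; rewrite dE.
Qed.

Lemma rV_norm_le d (v : 'rV[R]_d) (e : R) :
  0 <= e -> (forall i, `|v 0 i| <= e) -> `|v| <= e.
Proof.
move=> e0 H; rewrite [leLHS]/Num.Def.normr /= mx_normrE; apply: bigmax_le => // -[i j] _ /=.
by rewrite ord1.
Qed.

Lemma rV_coord_le d (v : 'rV[R]_d) i : `|v 0 i| <= `|v|.
Proof.
rewrite [leRHS]/Num.Def.normr /= mx_normrE.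
exact: (@le_bigmax _ _ _ _ (fun ij : 'I_1 * 'I_d => `|v ij.1 ij.2|) (0, i)).
Qed.

Lemma jacobianE d e (f : 'rV[R]_d -> 'rV[R]_e) x i j :
  differentiable f x -> 'J f x i j = ('D_(delta_mx 0 i) f x) 0 j.
Proof. by move=> df; rewrite deriveE// /jacobian mxE. Qed.

Lemma diffEjacobian d e (f : 'rV[R]_d -> 'rV[R]_e) x u : 'd f x u = u *m 'J f x.
Proof. by rewrite /jacobian mul_rV_lin1. Qed.

Lemma class_C_jacobian d e k (U : set 'rV[R]_d) (f : 'rV[R]_d -> 'rV[R]_e) :
  open U -> class_C k.+1 U f -> class_C k U (fun x => 'J f x).
Proof.
move=> oU Cf; apply/class_C_mxP => // i j.
have /class_C_mxP := Cf.2 (delta_mx 0 i) => /(_ oU 0 j).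
by apply: class_C_ext => // x Ux; rewrite jacobianE//; exact: Cf.1.
Qed.

Lemma continuous_lin_rV d (W : normedModType R) (f : {linear 'rV[R]_d -> W}) : continuous f.
Proof.
have -> : (f : _ -> _) = \sum_(i < d) (fun u : 'rV[R]_d => u 0 i *: f (delta_mx 0 i)).
  by apply: boolp.funext => u; rewrite {1}[u]row_sum_delta linear_sum fct_sumE; apply: eq_bigr => i _; rewrite linearZ.
move=> x; apply: differentiable_continuous; apply: differentiable_sum => i.
apply: differentiableZl; exact: differentiable_coord.
Qed.

Arguments continuous_lin_rV {d W} f.

Lemma continuous_mulmxr d e (A : 'M[R]_(d, e)) : continuous (fun u : 'rV[R]_d => u *m A).
Proof. exact: (@continuous_lin_rV _ _ (mulmxr A)). Qed.

Lemma is_diff_mulmxr d e (A : 'M[R]_(d, e)) x : is_diff x (fun u : 'rV[R]_d => u *m A) (fun u : 'rV[R]_d => u *m A).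
Proof.
have c := @continuous_lin_rV _ _ (mulmxr A).
apply: DiffDef; first exact: (@linear_differentiable _ _ _ (mulmxr A) x c).
exact: (@diff_lin _ _ _ (mulmxr A) x c).
Qed.

Lemma class_C_mulmxr d e k U (A : 'M[R]_(d, e)) : class_C k U (fun u : 'rV[R]_d => u *m A).
Proof.
have c := @continuous_lin_rV _ _ (mulmxr A).
by have := @class_C_linear _ _ _ k U (mulmxr A) c; apply.
Qed.

(** The norm of a row vector is the maximum of its coordinates, so the mean value theorem is used
    coordinate by coordinate. The factor [d] counts the terms of a row vector times a column of the
    Jacobian. *)
Lemma lipschitz_jacobian d e (h : 'rV[R]_d -> 'rV[R]_e) x0 r c x y : 0 <= c ->
  (forall z, ball x0 r z -> differentiable h z /\ forall i j, `|'J h z i j| <= c) ->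
  ball x0 r x -> ball x0 r y -> `|h y - h x| <= c *+ d * `|y - x|.
Proof.
move=> c0 H xr yr; apply: rV_norm_le => [|j]; first by rewrite mulr_ge0// mulrn_wge0.
have inB t : 0 <= t <= 1 -> ball x0 r (x + t *: (y - x)) by exact: ball_segment.
have [t /inB tI|t /inB tI] := @mean_value R _ (fun z => h z 0 j : R^o) x (y - x).
  by have /differentiable_mxP := (H _ tI).1; exact.
have [dh Jh] := H _ tI.
have -> : x + (y - x) = y by rewrite addrC subrK.
move=> E; rewrite !mxE E.
rewrite -deriveE; last by have /differentiable_mxP := dh; exact.
rewrite -derive_mx_coord// deriveE// diffEjacobian mxE.
rewrite (le_trans (ler_norm_sum _ _ _))//.
apply: (@le_trans _ _ (\sum_(i < d) c * `|y - x|)); last by rewrite sumr_const card_ord mulrnAl.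
apply: ler_sum => i _; rewrite normrM mulrC ler_pM//; exact: rV_coord_le.
Qed.

(* A contraction of a compact set attains the minimum of [|x - F x|] at its
   fixed point. *)
Lemma contraction_fixpoint d (F : 'rV[R]_d -> 'rV[R]_d) a (rho : R) : 0 <= rho ->
  (forall x, `|x - a| <= rho -> `|F x - a| <= rho) ->
  (forall x y, `|x - a| <= rho -> `|y - a| <= rho -> `|F x - F y| <= `|x - y| / 2) ->
  exists2 x, `|x - a| <= rho & F x = x.
Proof.
move=> rho0 sF cF; pose A := [set x : 'rV[R]_d | `|x - a| <= rho].
have Aa : A a by rewrite /A /= subrr normr0.
have cA : compact A.
  apply: bounded_closed_compact.
    apply/ex_bound; first by exact: globally_properfilter Aa.
    exists (rho + `|a|) => x /= Ax.
    by rewrite -[x](subrK a) (le_trans (ler_normD _ _))// lerD2r.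
  rewrite (_ : A = closed_ball_ Num.norm a rho); last first.
    by apply/seteqP; split => x; rewrite /A /closed_ball_ /= distrC.
  exact: closed_closed_ball_.
have lF x y : A x -> A y -> `|F x - F y| <= `|x - y|.
  by move=> Ax Ay; rewrite (le_trans (cF _ _ Ax Ay))// ler_pdivrMr// ler_peMr// ler1n.
have Fc : {within A, continuous (fun x => `|F x - x|)}.
  apply/subspace_continuousP => x Ax; apply/cvgrPdist_le => e e0; apply/nbhs_ballP.
  exists (e / 2) => [|y]; first by rewrite /= divr_gt0.
  rewrite -ball_normE /= => xy Ay; rewrite (le_trans (ler_dist_dist _ _))//.
  have -> : F x - x - (F y - y) = (F x - F y) + (y - x) by rewrite -[y - x]opprB subr_swap.
  rewrite (le_trans (ler_normD _ _))//.
  rewrite [e]splitr lerD//; last by rewrite ltW// distrC.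
  by rewrite (le_trans (lF _ _ Ax Ay))// ltW.
have [p] := EVT_min_rV (ex_intro _ a Aa) cA Fc.
rewrite inE => Ap minp; exists p => //.
(* At the minimum, |F p - p| is at most |F (F p) - F p|, which is at most half of |F p - p|; hence
   it is zero. *)
have /minp : F p \in A by rewrite inE; exact: sF.
move=> /le_trans /(_ (cF _ _ (sF _ Ap) Ap)).
rewrite ler_pdivlMr// mulr_natr mulr2n gerDl normr_le0 => /eqP.
by move/subr0_eq.
Qed.

Lemma diff_eps (V W : normedModType R) (f : V -> W) x : differentiable f x ->
  forall e, 0 < e -> \forall y \near x, `|f y - f x - 'd f x (y - x)| <= e * `|y - x|.
Proof.
move=> /diff_locallyP[dc /eqaddoP H] e e0; have := H e e0.
rewrite [X in _ -> X](near_shift (0 : V)) /=.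
by apply: filterS => y /=; rewrite subr0 addrK !fctE /= opprD addrA.
Qed.

Lemma mulmxr_bounded d e (M : 'M[R]_(d, e)) :
  exists2 k : R, 0 < k & forall v : 'rV[R]_d, `|v *m M| <= k * `|v|.
Proof.
have c := @continuous_lin_rV _ _ (mulmxr M).
by have [k k0 kP] := @linear_lipschitz _ _ _ (mulmxr M) c; exists k.
Qed.

Lemma mulmx_invB d (J : 'M[R]_d) (w z : 'rV[R]_d) : J \in unitmx ->
  w *m invmx J - z = (w - z *m J) *m invmx J.
Proof. by move=> uJ; rewrite mulmxBl mulmxK. Qed.

(* After composing with the inverse of the differential at [x0], [f] differs
   from the identity by a 1/2-Lipschitz map near [x0]. *)
Theorem inverse_function d (U : set 'rV[R]_d) (f : 'rV[R]_d -> 'rV[R]_d) x0 :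
  open U -> U x0 -> smooth_on U f -> 'J f x0 \in unitmx ->
  exists (A : set 'rV[R]_d) (g : 'rV[R]_d -> 'rV[R]_d),
    [/\ open A /\ A x0, A `<=` U, open (f @` A) & forall x, A x -> g (f x) = x] /\
    (smooth_on (f @` A) g /\ forall x, A x -> 'J f x \in unitmx /\ 'J g (f x) = invmx ('J f x)).
Proof.
move=> oU Ux0 Cf uJ; have [L JL] : exists L, 'J f x0 *m L = 1%:M by exists (invmx ('J f x0)); exact: mulmxV.
(* [c] bounds the entries of the Jacobian of [h], so that the Lipschitz constant [c *+ d] is at most
   1/2. Using [d.+1] avoids dividing by zero in dimension 0. *)
have [c Ec] : exists c : R, c = (2 * d.+1%:R)^-1 by eexists.
have c0 : 0 < c by rewrite Ec invr_gt0 mulr_gt0.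
have cd : c *+ d <= 2^-1.
  rewrite -[c *+ d]mulr_natr Ec invfM -[leLHS]mulrA ler_piMr// ?invr_ge0//.
  by rewrite ler_pdivrMl// mulr1 ler_nat.
have df x : U x -> differentiable f x by exact: (Cf 1%N).1.
pose phi x := f x *m L; pose h x := x - phi x.
have dh x : U x -> is_diff x h (fun v => v - 'd f x v *m L).
  move=> /df/differentiableP dfx.
  have := is_diff_comp dfx (is_diff_mulmxr L (f x)) => dphi.
  have := is_diffB (is_diff_id x) dphi; exact.
have Jh x : U x -> 'J h x = 1%:M - 'J f x *m L.
  move=> Ux; apply/row_matrixP => i.
  rewrite !rowE -diffEjacobian (@diff_val _ _ _ _ _ _ _ (dh x Ux)).
  by rewrite mulmxBr mulmx1 mulmxA diffEjacobian.
have [M EM] : exists M : 'rV[R]_d -> 'M[R]_d, forall x, M x = 1%:M - 'J f x *m L by eexists.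
have JhM x : U x -> 'J h x = M x by move=> Ux; rewrite Jh// EM.
have M0 i j : M x0 i j = 0 by rewrite EM JL subrr mxE.
have CM : class_C 0 U M.
  have := class_C_mulmx oU (class_C_jacobian oU (Cf 1%N)) (@class_C_cst _ _ _ 0 U L).
  move=> /(class_C_mulmx oU (@class_C_cst _ _ _ 0 U (-1)%:M)) /(class_C_add oU (@class_C_cst _ _ _ 0 U 1%:M)).
  apply: class_C_ext => // x Ux; rewrite !fctE EM.
  by rewrite mul_scalar_mx scaleN1r.
have [r /= r0 rP] : nbhs_ball x0 [set x | U x /\ forall ij : 'I_d * 'I_d, `|'J h x ij.1 ij.2| <= c].
  apply/nbhs_ballP; apply: filterI; first exact: open_nbhs_nbhs.
  have FF : Filter (nbhs x0) by exact: nbhs_filter.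
  apply: (@filter_forall _ _ (fun (ij : 'I_d * 'I_d) x => `|'J h x ij.1 ij.2| <= c) (nbhs x0) FF) => -[i j] /=.
  have /class_C_mxP /(_ i j x0 Ux0) := CM => /(_ oU) /cvgrPdist_le /(_ c c0).
  have : nbhs x0 U by exact: open_nbhs_nbhs.
  by apply: filterS2 => x Ux; rewrite JhM// M0 sub0r normrN.
pose A := ball x0 r.
have AU : A `<=` U by move=> x /rP[].
have Lh x y : A x -> A y -> `|h y - h x| <= `|y - x| / 2.
  move=> Ax Ay; rewrite mulrC.
  apply: le_trans (ler_wpM2r _ cd) => //.
  apply: lipschitz_jacobian Ax Ay => [|z /rP[Uz Jz]]; first exact: ltW.
  split; first by have [] := dh z Uz.
  by move=> i j; exact: (Jz (i, j)).
have Lphi x y : A x -> A y -> `|y - x| <= 2 * `|phi y - phi x|.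
  move=> Ax Ay; have := Lh x y Ax Ay.
  have -> : h y - h x = (y - x) - (phi y - phi x).
    exact: subr_swap.
  move=> /(le_trans (lerB_dist _ _)); rewrite lerBlDr -lerBlDl.
  rewrite [X in X - _]splitr addrK ler_pdivrMr//.
  by rewrite mulrC.
have uL : L \in unitmx by case: (mulmx1_unit JL).
have finj x y : A x -> A y -> f x = f y -> x = y.
  move=> Ax Ay fxy; have := Lphi x y Ax Ay; rewrite /phi fxy subrr normr0 mulr0.
  by rewrite normr_le0 => /eqP/subr0_eq.
pose g y := xget x0 [set x | A x /\ f x = y].
have gP x : A x -> g (f x) = x.
  move=> Ax; have [Ag fg] : [set z | A z /\ f z = f x] (g (f x)).
    by apply: (@xgetPex _ x0 [set z | A z /\ f z = f x]); exists x.
  exact: finj.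
(* A row vector killed by ['J f x] is fixed by ['J h x], which at least halves norms on [A]; so it
   is zero. *)
have uJf x : A x -> 'J f x \in unitmx.
  move=> Ax; apply: row_free_eq0 => v vJ.
  have [Ux Jx] := rP _ Ax.
  have vE : v = v *m 'J h x by rewrite Jh// mulmxBr mulmx1 mulmxA vJ mul0mx subr0.
  have : `|v| <= c *+ d * `|v|.
    apply: rV_norm_le => [|j]; first by rewrite mulr_ge0// mulrn_wge0// ltW.
    rewrite {1}vE mxE (le_trans (ler_norm_sum _ _ _))//.
    apply: (@le_trans _ _ (\sum_(i < d) c * `|v|)); last by rewrite sumr_const card_ord mulrnAl.
    apply: ler_sum => i _; rewrite normrM mulrC ler_pM//; last exact: rV_coord_le.
    exact: (Jx (i, j)).
  move=> /le_trans /(_ (ler_wpM2r (normr_ge0 v) cd)) vle.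
  by apply/eqP; rewrite -normr_le0; have := normr_ge0 v; lra.
have oA : open A by exact: ball_open.
have Ax0 : A x0 by exact: ballxx.
have oB : open (f @` A).
  rewrite openE => _ [a Aa <-].
  (* Half of the distance from [a] to the boundary of the ball [A], so that the closed ball of
     radius [rho] about [a] lies in [A]. *)
  pose rho := (r - `|x0 - a|) / 2.
  have ar : `|x0 - a| < r by move: Aa; rewrite /A -ball_normE.
  have rho0 : 0 < rho by rewrite divr_gt0// subr_gt0.
  have inA x : `|x - a| <= rho -> A x.
    move=> xa; rewrite /A -ball_normE /=.
    by have := ler_distD a x0 x; rewrite (distrC a x); move: xa rho0 ar; rewrite /rho; lra.
  have cL : {for f a, continuous (fun y : 'rV[R]_d => y *m L)} by exact: continuous_mulmxr.
  have rho20 : 0 < rho / 2 by rewrite divr_gt0.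
  move/cvgrPdist_lt : cL => /(_ _ rho20).
  apply: filterS => y; rewrite distrC => yL.
  (* The equation [f x = y] says that [x] is a fixed point of [h x + y *m L]. This map is a
     contraction, and it preserves the [rho]-ball as soon as [y *m L] is within [rho / 2] of
     [f a *m L]. *)
  have HF x : h x + y *m L - a = h x - h a + (y *m L - f a *m L).
    exact: subr_shift.
  have H1 x : `|x - a| <= rho -> `|h x + y *m L - a| <= rho.
    move=> xa; rewrite HF (le_trans (ler_normD _ _))// [rho in leRHS]splitr lerD//; last exact: ltW.
    by apply: (le_trans (Lh a x Aa (inA _ xa))); rewrite ler_pM2r.
  have H2 x z : `|x - a| <= rho -> `|z - a| <= rho ->
      `|h x + y *m L - (h z + y *m L)| <= `|x - z| / 2.
    move=> xa za; rewrite opprD addrACA subrr addr0.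
    exact: Lh (inA _ za) (inA _ xa).
  have [x xa Fx] := contraction_fixpoint (ltW rho0) H1 H2.
  exists x; first exact: inA.
  move: Fx; rewrite /h -addrA => /(congr1 (+%R (- x))); rewrite addKr addNr => /eqP.
  rewrite addrC subr_eq0 => /eqP E.
  by rewrite -[RHS](mulmxK uL) E mulmxK.
have dg x : A x -> is_diff (f x) g (fun v => v *m invmx ('J f x)).
  move=> Ax; have c1 := @continuous_lin_rV _ _ (mulmxr (invmx ('J f x))).
  apply: (is_diff_eps c1) => e e0 /=.
  have [k1 k10 k1P] := mulmxr_bounded (invmx ('J f x)).
  have [k2 k20 k2P] := mulmxr_bounded L.
  have gL y : A y -> `|y - x| <= 2 * k2 * `|f y - f x|.
    move=> Ay; rewrite (le_trans (Lphi x y Ax Ay))// -mulrA ler_pM2l// /phi.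
    by rewrite -mulmxBl.
  (* The linearization error of [f] is proportional to |y - x|. Applying [invmx ('J f x)] costs a
     factor [k1], and bounding |y - x| by |f y - f x| costs [2 * k2]. *)
  have e1 : 0 < e / (k1 * (2 * k2)) by rewrite divr_gt0// !mulr_gt0.
  have [rr /= rr0 rrP] : nbhs_ball x [set y | `|f y - f x - 'd f x (y - x)| <= e / (k1 * (2 * k2)) * `|y - x|].
    by apply/nbhs_ballP; have := diff_eps (df _ (AU _ Ax)) e1.
  have nB : nbhs (f x) (f @` A) by apply: open_nbhs_nbhs; split => //; exists x.
  have nb : \forall y \near f x, `|y - f x| < rr / (2 * k2).
    apply/nbhs_ballP; exists (rr / (2 * k2)); first by rewrite /= divr_gt0// mulr_gt0.
    by move=> y; rewrite -ball_normE /= distrC.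
  apply: filterS2 nB nb => _ [y Ay <-] yr.
  rewrite !gP//.
  have yx : `|y - x| < rr.
    by rewrite (le_lt_trans (gL _ Ay))// mulrC -ltr_pdivlMr// mulr_gt0.
  have {rrP} := rrP y; rewrite -ball_normE /= distrC => /(_ yx) Hd.
  rewrite -normrN opprB (_ : _ - _ = (f y - f x - 'd f x (y - x)) *m invmx ('J f x)); last first.
    by rewrite diffEjacobian; exact: mulmx_invB (uJf _ Ax).
  rewrite (le_trans (k1P _))//.
  apply: (@le_trans _ _ (k1 * (e / (k1 * (2 * k2)) * (2 * k2 * `|f y - f x|)))).
    rewrite ler_pM2l//; apply: (le_trans Hd); rewrite ler_pM2l//; exact: gL.
  by rewrite le_eqVlt; apply/orP; left; apply/eqP; field; rewrite !gt_eqF.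
(* Bootstrap: the differential of [g] is [invmx ('J f _)] composed with [g], hence as regular as
   [g], which gains one derivative at each step. *)
have Cg k : class_C k (f @` A) g.
  elim: k => [|k IH] /=.
    move=> _ [x Ax <-]; have [dgx _] := dg x Ax; exact: differentiable_continuous.
  split=> [_ [x Ax <-]|v]; first by have [] := dg x Ax.
  have CJ : class_C k A (fun x => invmx ('J f x)).
    have CfA : class_C k.+1 A f by exact: class_C_sub AU (Cf k.+1).
    exact: (@class_C_invmx _ _ _ k A (fun x => 'J f x) oA uJf (class_C_jacobian oA CfA)).
  have gB y : (f @` A) y -> A (g y) by case=> x Ax <-; rewrite gP.
  have := class_C_mulmx oB (@class_C_cst _ _ _ k _ v) (class_C_comp_mx oB oA gB IH CJ).
  apply: class_C_ext => // _ [x Ax <-] /=.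
  have [dgx dgE] := dg x Ax.
  by rewrite [RHS]deriveE// dgE gP.
exists A, g; split; first by split.
split; first exact: Cg.
move=> x Ax; split; first exact: uJf.
apply/row_matrixP => i; rewrite !rowE -diffEjacobian.
by have [_ ->] := dg x Ax.
Qed.

End InverseFunction.

(** * Complex-valued alternating forms on a real vector space *)

Section ComplexParts.
Context {R : rcfType}.
Implicit Types (x y : R[i]) (r : R).

Lemma complexP x y : complex.Re x = complex.Re y -> complex.Im x = complex.Im y -> x = y.
Proof. by case: x y => [a b] [c d] /= -> ->. Qed.

Lemma ReD x y : complex.Re (x + y) = complex.Re x + complex.Re y.
Proof. by case: x y => [a b] [c d]. Qed.
Lemma ImD x y : complex.Im (x + y) = complex.Im x + complex.Im y.
Proof. by case: x y => [a b] [c d]. Qed.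
Lemma ReN x : complex.Re (- x) = - complex.Re x.
Proof. by case: x. Qed.
Lemma ImN x : complex.Im (- x) = - complex.Im x.
Proof. by case: x. Qed.
Lemma ReM x y : complex.Re (x * y) = complex.Re x * complex.Re y - complex.Im x * complex.Im y.
Proof. by case: x y => [a b] [c d]. Qed.
Lemma ImM x y : complex.Im (x * y) = complex.Re x * complex.Im y + complex.Im x * complex.Re y.
Proof. by case: x y => [a b] [c d]. Qed.
Lemma Re_sum I (s : seq I) P (F : I -> R[i]) :
  complex.Re (\sum_(k <- s | P k) F k) = \sum_(k <- s | P k) complex.Re (F k).
Proof. by elim/big_rec2: _ => // k a b _ <-; rewrite ReD. Qed.
Lemma Im_sum I (s : seq I) P (F : I -> R[i]) :
  complex.Im (\sum_(k <- s | P k) F k) = \sum_(k <- s | P k) complex.Im (F k).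
Proof. by elim/big_rec2: _ => // k a b _ <-; rewrite ImD. Qed.

Definition ReImE := (ReD, ImD, ReN, ImN, ReM, ImM).

Lemma mulii : 'i%C * 'i%C = -1 :> R[i].
Proof. by apply: complexP; rewrite !ReImE /= ?mul0r ?mulr0 ?mulr1 ?sub0r ?addr0// oppr0. Qed.

End ComplexParts.

Section TwoTensor.
Context {R : realType}.
Implicit Types (d : nat).

Lemma alt_sum_l d (a : two_tensor R d) I (s : seq I) (P : pred I) (c : I -> R) (u : I -> 'rV[R]_d) v :
  alternating2 a -> a (\sum_(k <- s | P k) c k *: u k) v = \sum_(k <- s | P k) (c k)%:C * a (u k) v.
Proof.
case=> al _ _; elim/big_rec2: _ => [|k x y _ <-]; last exact: al.
by have := al (-1) 0 0 v; rewrite scaler0 addr0 => E; rewrite E rmorphN1 mulN1r addNr.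
Qed.

Lemma alt_sum_r d (a : two_tensor R d) I (s : seq I) (P : pred I) (c : I -> R) u (v : I -> 'rV[R]_d) :
  alternating2 a -> a u (\sum_(k <- s | P k) c k *: v k) = \sum_(k <- s | P k) (c k)%:C * a u (v k).
Proof.
case=> _ ar _; elim/big_rec2: _ => [|k x y _ <-]; last exact: ar.
by have := ar (-1) u 0 0; rewrite scaler0 addr0 => E; rewrite E rmorphN1 mulN1r addNr.
Qed.

Lemma alt_expand d (a : two_tensor R d) u v : alternating2 a ->
  a u v = \sum_(i < d) \sum_(j < d) (u 0 i * v 0 j)%:C * a (delta_mx 0 i) (delta_mx 0 j).
Proof.
move=> alt; rewrite [u in LHS]row_sum_delta alt_sum_l//; apply: eq_bigr => i _.
rewrite [v in LHS]row_sum_delta alt_sum_r// mulr_sumr; apply: eq_bigr => j _.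
by rewrite rmorphM /= mulrA.
Qed.

Lemma alt0l d (a : two_tensor R d) v : alternating2 a -> a 0 v = 0.
Proof. by move=> alt; have := alt_sum_l [::] xpredT (fun=> 0) (fun i : nat => 0) v alt; rewrite !big_nil. Qed.
Lemma alt0r d (a : two_tensor R d) u : alternating2 a -> a u 0 = 0.
Proof. by move=> alt; have := alt_sum_r [::] xpredT (fun=> 0) u (fun i : nat => 0) alt; rewrite !big_nil. Qed.
Lemma altDl d (a : two_tensor R d) u u' v : alternating2 a -> a (u + u') v = a u v + a u' v.
Proof. by case=> al _ _; rewrite -[u]scale1r al scale1r rmorph1 mul1r. Qed.
Lemma altDr d (a : two_tensor R d) u v v' : alternating2 a -> a u (v + v') = a u v + a u v'.
Proof. by case=> _ ar _; rewrite -[v]scale1r ar scale1r rmorph1 mul1r. Qed.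
Lemma altZl d (a : two_tensor R d) (r : R) u v : alternating2 a -> a (r *: u) v = r%:C * a u v.
Proof. by move=> alt; have [al _ _] := alt; rewrite -[_ *: _]addr0 al alt0l// addr0. Qed.
Lemma altZr d (a : two_tensor R d) (r : R) u v : alternating2 a -> a u (r *: v) = r%:C * a u v.
Proof. by move=> alt; have [_ ar _] := alt; rewrite -[_ *: _]addr0 ar alt0r// addr0. Qed.
Lemma altNl d (a : two_tensor R d) u v : alternating2 a -> a (- u) v = - a u v.
Proof. by move=> alt; rewrite -scaleN1r altZl// rmorphN1 mulN1r. Qed.
Lemma alt_anti d (a : two_tensor R d) u v : alternating2 a -> a v u = - a u v.
Proof.
move=> alt; have [_ _ a0] := alt; have := a0 (u + v).
by rewrite altDl// !altDr// !a0 add0r addr0 => /eqP; rewrite addr_eq0 => /eqP ->; rewrite opprK.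
Qed.

Lemma alternating2_map d e (a : two_tensor R e) (M : 'M[R]_(d, e)) :
  alternating2 a -> alternating2 (fun u v => a (u *m M) (v *m M)).
Proof.
move=> alt; have [_ _ a0] := alt; split=> [r u u' v|r u v v'|u]; last exact: a0.
- by rewrite mulmxDl -scalemxAl altDl// altZl.
- by rewrite mulmxDl -scalemxAl altDr// altZr.
Qed.

Lemma alternating2_comb d (a b : two_tensor R d) (t : R[i]) :
  alternating2 a -> alternating2 b -> alternating2 (fun u v => a u v + t * b u v).
Proof.
move=> [al ar a0] [bl br b0]; split=> [r u u' v|r u v v'|u].
- by rewrite al bl; ring.
- by rewrite ar br; ring.
- by rewrite a0 b0 mulr0 addr0.
Qed.

Definition re_mx d (a : two_tensor R d) : 'M[R]_d :=
  \matrix_(i, j) complex.Re (a (delta_mx 0 i) (delta_mx 0 j)).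
Definition im_mx d (a : two_tensor R d) : 'M[R]_d :=
  \matrix_(i, j) complex.Im (a (delta_mx 0 i) (delta_mx 0 j)).

Lemma re_mxE d (a : two_tensor R d) u v : alternating2 a ->
  (u *m re_mx a *m v^T) 0 0 = complex.Re (a u v).
Proof.
move=> alt; rewrite bilin_mxE (alt_expand u v alt) Re_sum; apply: eq_bigr => i _.
by rewrite Re_sum; apply: eq_bigr => j _; rewrite ReM mxE /= mul0r subr0.
Qed.

Lemma im_mxE d (a : two_tensor R d) u v : alternating2 a ->
  (u *m im_mx a *m v^T) 0 0 = complex.Im (a u v).
Proof.
move=> alt; rewrite bilin_mxE (alt_expand u v alt) Im_sum; apply: eq_bigr => i _.
by rewrite Im_sum; apply: eq_bigr => j _; rewrite ImM mxE /= mul0r addr0.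
Qed.

Lemma bilin_mx_eq0 d (u : 'rV[R]_d) : (forall v : 'rV[R]_d, (u *m v^T) 0 0 = 0) -> u = 0.
Proof.
move=> H; apply/rowP => j; have := H (delta_mx 0 j).
by rewrite trmx_delta -colE !mxE.
Qed.

(** If Re a (u, w) vanishes for all w, then so does Im a (u, w): take [w = v *m I] and use a (u, I
    v) = i a (u, v). Hence [u] is in the kernel of [a]. *)
Lemma re_mx_unit d (a : two_tensor R d) (I : 'M[R]_d) :
  alternating2 a -> hodge20 I a -> Defs.nondegenerate a -> re_mx a \in unitmx.
Proof.
move=> alt h20 nd; apply: row_free_eq0 => u uW; apply: nd => v.
have Re0 w : complex.Re (a u w) = 0 by rewrite -re_mxE// uW mul0mx mxE.
apply: complexP => //; have := Re0 (v *m I); rewrite (h20 u v).2 ReM /= mul0r sub0r mul1r.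
by move/eqP; rewrite oppr_eq0 => /eqP ->.
Qed.

(** This is the real part of a (I u, v) = i a (u, v). With the real matrix invertible, it leaves a
    single candidate for [I]. *)
Lemma hodge20_mxE d (a : two_tensor R d) (I : 'M[R]_d) :
  alternating2 a -> hodge20 I a -> I *m re_mx a = - im_mx a.
Proof.
move=> alt h20; apply/row_matrixP => i; rewrite !rowE; apply/eqP; rewrite -subr_eq0.
apply/eqP/bilin_mx_eq0 => v.
rewrite mulmxBl mulmxN mulNmx opprK mulmxA mxE re_mxE// im_mxE//.
by rewrite (h20 _ v).1 ReM /= mul0r sub0r mul1r addNr.
Qed.

End TwoTensor.

(** * The twist at one point: linear algebra *)

Section Twist.
Context {R : realType}.

Lemma mx00D (A B : 'M[R]_1) : (A + B) 0 0 = A 0 0 + B 0 0. Proof. exact: mxE. Qed.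
Lemma mx00N (A : 'M[R]_1) : (- A) 0 0 = - A 0 0. Proof. exact: mxE. Qed.
Lemma mx00Z (a : R) (A : 'M[R]_1) : (a *: A) 0 0 = a * A 0 0. Proof. exact: mxE. Qed.

Lemma stdJ_sqr N : stdJ R N *m stdJ R N = - 1%:M.
Proof.
rewrite /stdJ mulmx_block !mulmx0 !mul0mx mul1mx mulmx1 add0r !addr0.
by rewrite [1%:M in RHS]scalar_mx_block opp_block_mx oppr0.
Qed.

Variables (N m : nat).
Variables (Om : two_tensor R (N + N)) (eta : two_tensor R (m + m)) (P : 'M[R]_(N + N, m + m)) (t : R[i]).
Hypotheses (altO : alternating2 Om) (h20O : hodge20 (stdJ R N) Om) (ndO : Defs.nondegenerate Om).
Hypotheses (alte : alternating2 eta) (hte : hodge20_11 (stdJ R m) eta).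
Hypotheses (PJ : stdJ R N *m P = P *m stdJ R m).
(* [ker P] contains its orthogonal for [Re Om]: the functions pulled back by a
   map with differential [P] Poisson-commute. *)
Hypothesis coiso : P^T *m invmx (re_mx Om) *m P = 0.

Let J := stdJ R N.
Let W := re_mx Om.
Let sig (u v : 'rV[R]_(N + N)) := t * eta (u *m P) (v *m P).
Let Psi : two_tensor R (N + N) := fun u v => Om u v + sig u v.
Let rho (u w : 'rV[R]_(N + N)) := 'i%C * sig u w - sig (u *m J) w.
(** [A] and [B] are the Gram matrices of the real and imaginary parts of t eta. *)
Let A := complex.Re t *: re_mx eta - complex.Im t *: im_mx eta.
Let B := complex.Re t *: im_mx eta + complex.Im t *: re_mx eta.
(** Solves Re Om (u N, w) = Re rho (u, w). The right-hand side is - Im sig (u, w) - Re sig (u J, w),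
    with matrix [- (P *m B + J *m P *m A) *m P^T], and [invmx W] removes Re Om. *)
Let Nx := - (P *m B + J *m P *m A) *m P^T *m invmx W.
Let I := J + Nx.

Let uW : W \in unitmx.
Proof. exact: re_mx_unit altO h20O ndO. Qed.

Let JJ (u : 'rV[R]_(N + N)) : u *m J *m J = - u.
Proof. by rewrite -mulmxA stdJ_sqr mulmxN mulmx1. Qed.

Let Re_sig u v : complex.Re (sig u v) = (u *m (P *m A *m P^T) *m v^T) 0 0.
Proof.
rewrite !mulmxA -(mulmxA _ P^T) -trmx_mul /A !(mulmxBr, mulmxBl) -!(scalemxAr, scalemxAl) !(mx00D, mx00N, mx00Z).
by rewrite re_mxE// im_mxE// ReM.
Qed.

Let Im_sig u v : complex.Im (sig u v) = (u *m (P *m B *m P^T) *m v^T) 0 0.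
Proof.
rewrite !mulmxA -(mulmxA _ P^T) -trmx_mul /B !(mulmxDr, mulmxDl) -!(scalemxAr, scalemxAl) !(mx00D, mx00Z).
by rewrite re_mxE// im_mxE// ImM.
Qed.

(** The (2,0) part of [eta] cancels in [rho]. The (1,1) part satisfies a11 (J x, y) = - a11 (x, J
    y), which exchanges the two terms of [rho] up to the factor i. *)
Let rhoJ u w : rho u (w *m J) = 'i%C * rho u w.
Proof.
rewrite /rho /sig -![_ *m J *m P]mulmxA PJ !mulmxA.
have [a20 [a11 [[alt20 h20] [alt11 h11] E]]] := hte.
move: (u *m P) (w *m P) => x y; rewrite !E.
rewrite !(h20 _ _).2 !(h20 _ _).1 h11.
have -> : a11 (x *m stdJ R m) y = - a11 x (y *m stdJ R m).
  by rewrite -h11 -mulmxA stdJ_sqr mulmxN mulmx1 altNl.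
have ii := @mulii R; move: 'i%C ii => i ii; ring: ii.
Qed.

Let Re_rho u w : (u *m (Nx *m W) *m w^T) 0 0 = complex.Re (rho u w).
Proof.
rewrite /Nx mulmxKV// /rho ReD ReN ReM /= mul0r mul1r sub0r Re_sig Im_sig.
rewrite mulNmx mulmxN mulNmx mx00N [(_ + _) *m P^T]mulmxDl mulmxDr mulmxDl mx00D opprD.
by rewrite !mulmxA.
Qed.

Let NP : Nx *m P = 0.
Proof. by rewrite /Nx -!mulmxA [X in _ *m X]mulmxA coiso mulmx0. Qed.

(** Only the real parts agree by construction of [Nx]. Both sides are complex linear in [w], so
    evaluating at [w *m J] gives the imaginary parts. *)
Let OmN u w : Om (u *m Nx) w = rho u w.
Proof.
have ReN v : complex.Re (Om (u *m Nx) v) = complex.Re (rho u v).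
  by rewrite -re_mxE// -Re_rho mulmxA.
apply: complexP => //.
have := ReN (w *m J); rewrite rhoJ (h20O _ _).2 !ReM /= !mul0r !sub0r !mul1r.
by move/oppr_inj.
Qed.

Let ker_sig u v : u *m P = 0 -> sig u v = 0.
Proof. by move=> uP; rewrite /sig uP alt0l// mulr0. Qed.

Let ker_N (u : 'rV[R]_(N + N)) : u *m P = 0 -> u *m Nx = 0.
Proof.
move=> uP; apply: ndO => w; rewrite OmN /rho !ker_sig ?mulr0 ?subr0//.
by rewrite -mulmxA PJ mulmxA uP mul0mx.
Qed.

Let NN : Nx *m Nx = 0.
Proof. by apply/row_matrixP => i; rewrite row_mul row0 ker_N// -row_mul NP row0. Qed.

(** Replacing [u] by [u *m J] in [rho] multiplies it by -i, whereas applying J after N multiplies Om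
    (u N, w) by i; the two contributions cancel and [Om] is nondegenerate. *)
Let JN : J *m Nx = - (Nx *m J).
Proof.
apply/row_matrixP => i; rewrite !rowE; move: (delta_mx _ _) => u.
rewrite mulmxN; apply/eqP; rewrite -subr_eq0 opprK; apply/eqP.
apply: ndO => w; rewrite altDl// 2!mulmxA (h20O _ _).1 !OmN /rho JJ /sig mulNmx altNl//.
have ii := @mulii R; move: 'i%C ii => z ii; ring: ii.
Qed.

Let alt_Psi : alternating2 Psi.
Proof. exact: alternating2_comb altO (alternating2_map P alte). Qed.

(** As [Nx *m P = 0], [sig] does not see N, so sig (u I, v) = sig (u J, v). This is exactly the term
    that [rho] subtracts. *)
Let hodge_Psi : hodge20 I Psi.
Proof.
have H u v : Psi (u *m I) v = 'i%C * Psi u v.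
  rewrite /Psi /I mulmxDr altDl// OmN (h20O _ _).1.
  rewrite [sig (_ + _) _]/sig mulmxDl -[_ *m Nx *m P]mulmxA NP mulmx0 addr0 /rho -/(sig _ v).
  by move: 'i%C => i; ring.
move=> u v; split=> //.
by rewrite (alt_anti (v *m I) u alt_Psi) H (alt_anti v u alt_Psi) mulrN.
Qed.

(** A vector in the kernel of [Psi] has the form [y *m P^T *m invmx W], so [coiso] puts it in the
    kernel of [P]. There [sig] vanishes and [Psi] agrees with [Om]. *)
Let nondeg_Psi : Defs.nondegenerate Psi.
Proof.
move=> u u0.
have E : u *m W = - (u *m (P *m A *m P^T)).
  apply/eqP; rewrite -subr_eq0 opprK; apply/eqP/bilin_mx_eq0 => v.
  by rewrite mulmxDl mxE re_mxE// -Re_sig -ReD [X in complex.Re X]u0.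
have uP : u *m P = 0.
  by rewrite -[u](mulmxK uW) E !mulNmx -!mulmxA [P^T *m _]mulmxA coiso !mulmx0 oppr0.
by apply: ndO => v; have := u0 v; rewrite /Psi ker_sig// addr0.
Qed.

Lemma twisted_structure :
  [/\ alternating2 (fun u v => Om u v + t * eta (u *m P) (v *m P)),
      Defs.nondegenerate (fun u v => Om u v + t * eta (u *m P) (v *m P)) &
      exists (I S : 'M[R]_(N + N)),
        [/\ I *m I = - 1%:M /\ hodge20 I (fun u v => Om u v + t * eta (u *m P) (v *m P)),
            S \in unitmx /\ I *m S = S *m stdJ R N,
            I *m P = P *m stdJ R m &
            forall u : 'rV_(N + N), u *m P = 0 -> u *m I = u *m stdJ R N]].
Proof.
split; [exact: alt_Psi|exact: nondeg_Psi|].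
have NJN : Nx *m J *m Nx = 0 by rewrite -mulmxA JN mulmxN mulmxA NN mul0mx oppr0.
have JJN : J *m (J *m Nx) = - Nx by rewrite mulmxA stdJ_sqr mulNmx mul1mx.
have JNJ : J *m Nx *m J = Nx by rewrite JN mulNmx -mulmxA stdJ_sqr mulmxN mulmx1 opprK.
(* Since N^2 = 0, J N J = N and N J N = 0, the square of J N is zero and the inverse is 1 - J N / 2.
   The factor 1/2 makes (J + N) S and S J both equal to J + N / 2. *)
exists I, (1%:M + 2^-1 *: (J *m Nx)); split.
- by split; [rewrite /I mulmxDl !mulmxDr NN JN stdJ_sqr addr0 subrK|exact: hodge_Psi].
- split.
    suff /mulmx1_unit[] : (1%:M + 2^-1 *: (J *m Nx)) *m (1%:M - 2^-1 *: (J *m Nx)) = 1%:M by [].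
    rewrite mulmxDl !mulmxBr !mul1mx mulmx1 -scalemxAl -scalemxAr.
    rewrite [J *m Nx *m _]mulmxA JNJ NN !scaler0 subr0.
    by rewrite subrK.
  rewrite /I mulmxDr !mulmxDl mulmx1 mul1mx -!scalemxAr -scalemxAl JNJ JJN mulmxA NJN.
  by rewrite mulmx1 scaler0 addr0 scalerN -addrA; congr (_ + _); rewrite -{1}[Nx]scale1r -scalerBl; congr (_ *: _); lra.
- by rewrite /I mulmxDl NP addr0.
- by move=> u uP; rewrite /I mulmxDr ker_N// addr0.
Qed.

End Twist.

(** * Signs of permutations and wedge products *)

Section SignLemma.

Lemma block_perm_inj k l (r : 'S_k) (q : 'S_l) :
  injective (fun i : 'I_(k + l) => match fintype.split i with inl j => lshift l (r j) | inr j => rshift k (q j) end).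
Proof.
move=> i j; rewrite -(splitK i) -(splitK j); case: (fintype.split i) => a; case: (fintype.split j) => b;
  rewrite !unsplitK.
- by move=> /lshift_inj/perm_inj ->.
- by move=> /eqP; rewrite eq_lrshift.
- by move=> /eqP; rewrite eq_rlshift.
- by move=> /rshift_inj/perm_inj ->.
Qed.

Definition block_perm k l (r : 'S_k) (q : 'S_l) : 'S_(k + l) := perm (@block_perm_inj k l r q).

Lemma block_perm_l k l (r : 'S_k) (q : 'S_l) i : block_perm r q (lshift l i) = lshift l (r i).
Proof. by rewrite permE (unsplitK (inl _ i)). Qed.

Lemma block_perm_r k l (r : 'S_k) (q : 'S_l) i : block_perm r q (rshift k i) = rshift k (q i).
Proof. by rewrite permE (unsplitK (inr _ i)). Qed.

(** The sign is the determinant of the permutation matrix, which is here block diagonal. *)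
Lemma sign_block_perm (F : comNzRingType) k l (r : 'S_k) (q : 'S_l) :
  (-1) ^+ block_perm r q = (-1) ^+ r * (-1) ^+ q :> F.
Proof.
rewrite -!det_perm.
have -> : perm_mx (block_perm r q) = block_mx (perm_mx r) 0 0 (perm_mx q) :> 'M[F]_(k + l).
  apply/matrixP => i j; rewrite -(splitK i) -(splitK j).
  case: (fintype.split i) => a; case: (fintype.split j) => b /=;
    rewrite ?block_mxEul ?block_mxEur ?block_mxEdl ?block_mxEdr !mxE ?block_perm_l ?block_perm_r.
  - by rewrite eq_lshift.
  - by rewrite eq_lrshift.
  - by rewrite eq_rlshift.
  - by rewrite eq_rshift.
by rewrite det_ublock.
Qed.

(** [A] contains one element of each pair {x, sg x}, and [s] permutes these pairs. The induction is
    on the number of elements of [A] sent outside [A]: composing with the transposition of one such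
    x and sg x removes it from the count and changes the sign. *)
Lemma sign_involution_comm (F : comNzRingType) (T : finType) (sg : T -> T) (A : {set T}) (s : {perm T}) :
  involutive sg -> (forall x, (sg x \in A) = (x \notin A)) ->
  (forall x, s (sg x) = sg (s x)) ->
  (-1) ^+ s = \prod_(x in A) (-1) ^+ (s x \notin A) :> F.
Proof.
move=> sgK sgA; move: {2}(#|_|) (leqnn #|[set x in A | s x \notin A]|) => c.
have sg_inj : injective sg := can_inj sgK.
elim: c s => [|c IH] s cs sC.
  have sA x : x \in A -> s x \in A.
    move=> xA; apply: contraTT cs => sxA; rewrite -ltnNge; apply/card_gt0P.
    by exists x; rewrite inE xA.
  have sAC x : x \notin A -> s x \notin A.
    by move=> xA; have := sA (sg x); rewrite sgA sC sgA; exact.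
  have r_inj : injective (fun x => if x \in A then s x else x).
    move=> x y; case: ifP => xA; case: ifP => yA //.
    - exact: perm_inj.
    - by move=> E; have := sA _ xA; rewrite E yA.
    - by move=> E; have := sA _ yA; rewrite -E xA.
  pose p : {perm T} := perm sg_inj; pose r := perm r_inj.
  have pV x : p^-1%g x = sg x.
    by apply: (@perm_inj _ p); rewrite permKV permE sgK.
  (* [r] is [s] on [A] and the identity elsewhere; its conjugate by [sg] is [s] on the complement.
     The two factors have the same sign, so [s] is even. *)
  have -> : s = (r * r ^ p)%g.
    apply/permP => x; rewrite permM /conjg !permM pV !permE sgA.
    by case: (boolP (x \in A)) => xA; rewrite ?sA ?xA //= ?sC sgK.
  rewrite odd_permM odd_permJ addbb expr0 big1// => x xA.
  rewrite permM /conjg !permM pV !permE sgA xA.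
  by rewrite sgA sA //= sgA sA.
case: (leqP #|[set x in A | s x \notin A]| c) => [/IH|]; first exact.
move=> cs'; have /card_gt0P[x0] : (0 < #|[set x in A | s x \notin A]|)%N by exact: leq_ltn_trans cs'.
rewrite inE => /andP[xA sxA].
have x0sg : x0 != sg x0 by apply/eqP => E; have := sgA x0; rewrite -E xA.
pose s' := (tperm x0 (sg x0) * s)%g.
have s'E x : x \in A -> x != x0 -> s' x = s x.
  move=> xA' xx0; rewrite permM tpermD// eq_sym//.
  by apply: contraTneq xA' => ->; rewrite sgA xA.
have s'x0 : s' x0 = sg (s x0) by rewrite permM tpermL sC.
have s'C x : s' (sg x) = sg (s' x).
  have [->|xx0] := eqVneq x x0; first by rewrite permM tpermR s'x0 sgK.
  have [->|xx1] := eqVneq x (sg x0).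
    by rewrite sgK s'x0 permM tpermR.
  have xa : sg x != x0 by apply: contraNneq xx1 => <-; rewrite sgK.
  have xb : sg x != sg x0 by rewrite (inj_eq sg_inj).
  by rewrite !permM !tpermD// eq_sym.
have /IH/(_ s'C) : (#|[set x in A | s' x \notin A]| <= c)%N.
  rewrite -ltnS; apply: leq_trans cs; apply: proper_card; apply/properP; split.
    apply/fintype.subsetP => x; rewrite !inE => /andP[xA']; rewrite xA'.
    have [->|xx0] := eqVneq x x0; first by rewrite s'x0 sgA negbK (negPf sxA).
    by rewrite s'E.
  by exists x0; rewrite !inE xA// s'x0 sgA negbK (negPf sxA).
rewrite odd_permM odd_tperm x0sg /= => E.
rewrite (bigD1 x0)//= sxA expr1.
have -> : \prod_(i in A | i != x0) (-1) ^+ (s i \notin A) = (-1) ^+ (~~ s) :> F.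
  rewrite E [RHS](bigD1 x0)//= s'x0 sgA negbK (negPf sxA) expr0 mul1r.
  by apply: eq_bigr => i /andP[iA ix0]; rewrite s'E.
by case: (odd_perm s); rewrite ?expr0 ?expr1 ?mulr1// mulrNN mulr1.
Qed.

End SignLemma.

Section GenericWedge.
Context {R : realType}.
Local Notation C := (R[i]).

(* [wedge] for functions of vectors of any type: the forms are evaluated on
   complex vectors below. *)
Definition gwedge (T : Type) k l (a : ('I_k -> T) -> C) (b : ('I_l -> T) -> C) : ('I_(k + l) -> T) -> C :=
  fun v => ((k`! * l`!)%:R)^-1 *
  \sum_(s : 'S_(k + l)) (-1) ^+ s * a (fun i => v (s (lshift l i)))
                                  * b (fun j => v (s (rshift k j))).

Fixpoint gwedge_pow (T : Type) k (a : ('I_k -> T) -> C) p : ('I_(p * k) -> T) -> C :=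
  match p with 0%N => fun=> 1 | p'.+1 => gwedge a (@gwedge_pow T k a p') end.

Arguments gwedge_pow {T k} a p _.

Lemma gwedge_powS (T : Type) k (a : ('I_k -> T) -> C) p :
  gwedge_pow a p.+1 = gwedge a (gwedge_pow a p).
Proof. by []. Qed.

Lemma gwedge_sum k l : exists2 c : C, c != 0 & forall (T : Type) (a : ('I_k -> T) -> C) (b : ('I_l -> T) -> C) v,
  gwedge a b v = c * \sum_(s : 'S_(k + l)) (-1) ^+ s * a (fun i => v (s (lshift l i))) * b (fun j => v (s (rshift k j))).
Proof.
exists ((k`! * l`!)%:R)^-1; last by [].
by rewrite invr_eq0 pnatr_eq0 -lt0n muln_gt0 !fact_gt0.
Qed.

Lemma wedge_powE d k (a : Defs.form R d k) p v : wedge_pow a p v = gwedge_pow a p v.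
Proof.
have -> : wedge_pow a p = @gwedge_pow _ k a p; last by [].
by elim: p {v} => //= p ->.
Qed.

Lemma gwedge_pow_map (T T' : Type) (f : T -> T') k (a : ('I_k -> T') -> C) p :
  gwedge_pow (fun v => a (f \o v)) p = (fun v => gwedge_pow a p (f \o v)).
Proof. by elim: p => //= p ->. Qed.

Definition upd (T : Type) k (v : 'I_k -> T) i x : 'I_k -> T := fun j => if j == i then x else v j.

Definition multilinear (E : lmodType C) k (a : ('I_k -> E) -> C) :=
  forall v i c x y, a (upd v i (c *: x + y)) = c * a (upd v i x) + a (upd v i y).

Lemma upd_perm (T : Type) k l (f : 'I_l -> 'I_k) (v : 'I_k -> T) j x : injective f ->
  (fun i => upd v (f j) x (f i)) = upd (fun i => v (f i)) j x.
Proof. by move=> fi; apply: boolp.funext => i; rewrite /upd (inj_eq fi). Qed.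

Lemma upd_out (T : Type) k l (f : 'I_l -> 'I_k) (v : 'I_k -> T) j x : (forall i, f i != j) ->
  (fun i => upd v j x (f i)) = (fun i => v (f i)).
Proof. by move=> fj; apply: boolp.funext => i; rewrite /upd (negPf (fj i)). Qed.

Lemma multilinear_gwedge (E : lmodType C) k l (a : ('I_k -> E) -> C) (b : ('I_l -> E) -> C) :
  multilinear a -> multilinear b -> multilinear (gwedge a b).
Proof.
move=> la lb v i c x y; rewrite /gwedge mulrCA -mulrDr; congr (_ * _).
rewrite mulr_sumr -big_split; apply: eq_bigr => s _ /=.
have linj : injective (fun j => s (lshift l j)) by move=> p q /perm_inj/lshift_inj.
have rinj : injective (fun j => s (rshift k j)) by move=> p q /perm_inj/rshift_inj.
rewrite -(permKV s i) -[(s^-1)%g i]splitK; case: (fintype.split _) => j /=.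
  have El z := upd_perm v j z linj.
  have Er z : (fun q => upd v (s (lshift l j)) z (s (rshift k q))) = (fun q => v (s (rshift k q))).
    by apply: (@upd_out _ _ _ (fun q => s (rshift k q))) => q; rewrite (inj_eq perm_inj) eq_rlshift.
  rewrite !El !Er la mulrDr mulrDl; congr (_ + _).
  by rewrite mulrCA -!mulrA.
have Er z := upd_perm v j z rinj.
have El z : (fun q => upd v (s (rshift k j)) z (s (lshift l q))) = (fun q => v (s (lshift l q))).
  by apply: (@upd_out _ _ _ (fun q => s (lshift l q))) => q; rewrite (inj_eq perm_inj) eq_lrshift.
by rewrite !El !Er lb mulrDr mulrCA.
Qed.

Lemma multilinear_pow (E : lmodType C) k (a : ('I_k -> E) -> C) p :
  multilinear a -> multilinear (gwedge_pow a p).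
Proof. by move=> la; elim: p => [v []//|p IH]; exact: multilinear_gwedge. Qed.

(** Reindexing by the transposition of [i] and [j] leaves the values of [v] unchanged and flips
    every sign, so the alternating sum is its own opposite. *)
Lemma gwedge_alt (T : Type) k l (a : ('I_k -> T) -> C) (b : ('I_l -> T) -> C) v i j :
  i != j -> v i = v j -> gwedge a b v = 0.
Proof.
move=> ij vij; rewrite /gwedge; set S := \sum_s _.
suff : S = - S by move/eqP; rewrite -addr_eq0 -mulr2n mulrn_eq0 /= => /eqP ->; rewrite mulr0.
rewrite {1}/S (reindex_inj (mulIg (tperm i j))) /= -sumrN; apply: eq_bigr => s _.
rewrite odd_permM odd_tperm ij addbT signrN !mulNr.
have E t : v (tperm i j t) = v t by case: tpermP => [->|->|].
congr (- (_ * a _ * b _)); apply: boolp.funext => q; by rewrite permM E.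
Qed.

Lemma multilinear0 (E : lmodType C) k (a : ('I_k -> E) -> C) v i : multilinear a -> a (upd v i 0) = 0.
Proof. by move=> la; have := la v i (-1) 0 0; rewrite scaler0 addr0 mulN1r addNr. Qed.

Lemma multilinearZ (E : lmodType C) k (a : ('I_k -> E) -> C) v i c x : multilinear a ->
  a (upd v i (c *: x)) = c * a (upd v i x).
Proof. by move=> la; rewrite -[_ *: _]addr0 la multilinear0// addr0. Qed.

Lemma multilinear_sum (E : lmodType C) k (a : ('I_k -> E) -> C) v i I (s : seq I) (P : pred I) (F : I -> E) :
  multilinear a -> a (upd v i (\sum_(q <- s | P q) F q)) = \sum_(q <- s | P q) a (upd v i (F q)).
Proof.
move=> la; elim/big_rec2: _ => [|q x y _ <-]; first exact: multilinear0.
by rewrite -[F q]scale1r la mul1r scale1r.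
Qed.

Lemma upd_id (T : Type) k (v : 'I_k -> T) i : upd v i (v i) = v.
Proof. by apply: boolp.funext => j; rewrite /upd; case: eqP => [->|]. Qed.

(* A linear relation between the [v i] lets one replace an argument by a
   combination of the others. *)
Lemma gwedge_dim_eq0 N k l (a : ('I_k -> 'rV[C]_N) -> C) (b : ('I_l -> 'rV[C]_N) -> C) v :
  multilinear a -> multilinear b -> (N < k + l)%N -> gwedge a b v = 0.
Proof.
move=> la lb Nkl; have lab := multilinear_gwedge la lb.
pose M := \matrix_i v i.
have /rowV0Pn[y /sub_kermxP yM y0] : kermx M != 0.
  by rewrite kermx_eq0 /row_free neq_ltn (leq_ltn_trans (rank_leq_col M)).
have /rV0Pn[i yi] := y0.
have E : \sum_j y 0 j *: v j = 0.
  by rewrite -[RHS]yM mulmx_sum_row; apply: eq_bigr => j _; rewrite rowK.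
have : gwedge a b (upd v i (\sum_j y 0 j *: v j)) = 0 by rewrite E multilinear0.
rewrite multilinear_sum// (bigD1 i)//= multilinearZ// upd_id big1 ?addr0.
  by move/eqP; rewrite mulf_eq0 (negPf yi) => /eqP.
move=> j ji; rewrite multilinearZ// (@gwedge_alt _ _ _ _ _ _ i j) ?mulr0//; first by rewrite eq_sym.
by rewrite /upd eqxx (negPf ji).
Qed.

(** Induction on the number [m] of leading arguments that are not yet required to satisfy [P]; each
    of them is split as i p + q in turn. *)
Lemma multilinear_vanish (E : lmodType C) k (a : ('I_k -> E) -> C) (P : E -> Prop) :
  multilinear a -> (forall x, exists p q, [/\ P p, P q & x = 'i%C *: p + q]) ->
  (forall v, (forall j, P (v j)) -> a v = 0) -> forall v, a v = 0.
Proof.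
move=> la gen a0 v.
suff H m : (m <= k)%N -> forall v, (forall j : 'I_k, (m <= j)%N -> P (v j)) -> a v = 0.
  by apply: (H k) => // j; rewrite leqNgt ltn_ord.
elim: m => [|m IH] mk {}v vP; first by apply: a0 => j; exact: vP.
pose i := Ordinal mk; have [p [q [Pp Pq E']]] := gen (v i).
rewrite -(upd_id v i) E' la !(IH (ltnW mk)) ?mulr0 ?addr0// => j mj; rewrite /upd; case: eqP => // ji.
  by apply: vP; rewrite ltn_neqAle mj andbT; apply/eqP => ij; apply: ji; exact: val_inj.
by apply: vP; rewrite ltn_neqAle mj andbT; apply/eqP => ij; apply: ji; exact: val_inj.
Qed.

(** Absorbing [r] into [s] through a block permutation shows that each [r] contributes the same sum.
    This lets the alternation inside a factor of a wedge product be merged with the outer one. *)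
Lemma alternation_l (T : Type) k l (f : ('I_k -> T) -> C) (g : ('I_l -> T) -> C) (v : 'I_(k + l) -> T) :
  \sum_(s : 'S_(k + l)) (-1) ^+ s *
     (\sum_(r : 'S_k) (-1) ^+ r * f (fun i => v (s (lshift l (r i))))) * g (fun j => v (s (rshift k j))) =
  k`!%:R * \sum_(s : 'S_(k + l)) (-1) ^+ s * f (fun i => v (s (lshift l i))) * g (fun j => v (s (rshift k j))).
Proof.
under eq_bigr do rewrite mulr_sumr mulr_suml.
rewrite exchange_big /=; under eq_bigr => r _.
  rewrite (reindex_inj (mulgI (block_perm r^-1 1)%g)) /=.
  under eq_bigr => s _.
    rewrite odd_permM signr_addb sign_block_perm odd_permV odd_perm1 mulr1.
    have -> : (fun i => v ((block_perm r^-1 1 * s)%g (lshift l (r i)))) = (fun i => v (s (lshift l i))).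
      by apply: boolp.funext => i; rewrite permM block_perm_l permK.
    have -> : (fun j => v ((block_perm r^-1 1 * s)%g (rshift k j))) = (fun j => v (s (rshift k j))).
      by apply: boolp.funext => i; rewrite permM block_perm_r perm1.
    rewrite [_ ^+ _ * _ ^+ _]mulrC -!mulrA [(-1) ^+ r * ((-1) ^+ r * _)]mulrA -signr_addb addbb mul1r mulrA.
    over.
  over.
by rewrite /= sumr_const card_Sn mulr_natl.
Qed.

Lemma alternation_r (T : Type) k l (f : ('I_k -> T) -> C) (g : ('I_l -> T) -> C) (v : 'I_(k + l) -> T) :
  \sum_(s : 'S_(k + l)) (-1) ^+ s * f (fun i => v (s (lshift l i))) *
     (\sum_(r : 'S_l) (-1) ^+ r * g (fun i => v (s (rshift k (r i))))) =
  l`!%:R * \sum_(s : 'S_(k + l)) (-1) ^+ s * f (fun i => v (s (lshift l i))) * g (fun j => v (s (rshift k j))).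
Proof.
under eq_bigr do rewrite mulr_sumr.
rewrite exchange_big /=; under eq_bigr => r _.
  rewrite (reindex_inj (mulgI (block_perm 1 r^-1)%g)) /=.
  under eq_bigr => s _.
    rewrite odd_permM signr_addb sign_block_perm odd_permV odd_perm1 mul1r.
    have -> : (fun i => v ((block_perm 1 r^-1 * s)%g (rshift k (r i)))) = (fun i => v (s (rshift k i))).
      by apply: boolp.funext => i; rewrite permM block_perm_r permK.
    have -> : (fun j => v ((block_perm 1 r^-1 * s)%g (lshift l j))) = (fun j => v (s (lshift l j))).
      by apply: boolp.funext => i; rewrite permM block_perm_l perm1.
    rewrite [_ ^+ _ * _ ^+ _]mulrC mulrA -!mulrA.
    rewrite [(-1) ^+ r * (_ * _)]mulrCA [(-1) ^+ r * (_ * _)]mulrCA [(-1) ^+ r * (_ * _)]mulrA.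
    rewrite -signr_addb addbb mul1r mulrA.
    over.
  over.
by rewrite /= sumr_const card_Sn mulr_natl.
Qed.

End GenericWedge.

Arguments gwedge_pow {R T k} a p _.

(** * Darboux frames and the top power evaluated on them *)

Section Darboux.
Context {F : fieldType} (N : nat) (M : 'M[F]_N).

Definition mxform (x y : 'rV[F]_N) : F := (x *m M *m y^T) 0 0.
Local Notation B := mxform.

Lemma mxformDl x y z : B (x + y) z = B x z + B y z.
Proof. by rewrite /B !mulmxDl mxE. Qed.
Lemma mxformDr x y z : B z (x + y) = B z x + B z y.
Proof. by rewrite /B linearD mulmxDr mxE. Qed.
Lemma mxformZl c x z : B (c *: x) z = c * B x z.
Proof. by rewrite /B -!scalemxAl mxE. Qed.
Lemma mxformZr c x z : B z (c *: x) = c * B z x.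
Proof. by rewrite /B linearZ -scalemxAr mxE. Qed.
Lemma mxformBl x y z : B (x - y) z = B x z - B y z.
Proof. by rewrite mxformDl -scaleN1r mxformZl mulN1r. Qed.
Lemma mxform0l z : B 0 z = 0.
Proof. by rewrite /B !mul0mx mxE. Qed.
Lemma mxform0r z : B z 0 = 0.
Proof. by rewrite /B trmx0 mulmx0 mxE. Qed.
Lemma mxform_suml I (s : seq I) P (x : I -> 'rV[F]_N) z :
  B (\sum_(k <- s | P k) x k) z = \sum_(k <- s | P k) B (x k) z.
Proof. by elim/big_rec2: _ => [|k a b _ <-]; rewrite ?mxform0l ?mxformDl. Qed.

Hypotheses (B0 : forall x, B x x = 0) (uM : M \in unitmx).

Lemma mxform_anti x y : B y x = - B x y.
Proof.
apply/eqP; rewrite -addr_eq0; apply/eqP; have := B0 (x + y).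
by rewrite mxformDl !mxformDr !B0 add0r addr0 addrC.
Qed.

Definition symplectic_family k (e f : nat -> 'rV[F]_N) :=
  forall i j, (i < k)%N -> (j < k)%N ->
    [/\ B (e i) (e j) = 0, B (f i) (f j) = 0 & B (e i) (f j) = (i == j)%:R].

(** Symplectic Gram-Schmidt: 2k < N linear conditions leave a nonzero [u] orthogonal to the family,
    nondegeneracy gives a vector pairing to 1 with [u], and the latter is then made orthogonal to
    the family. *)
Lemma symplectic_family_exists k : (k + k <= N)%N -> exists e f, symplectic_family k e f.
Proof.
elim: k => [|k IH] kN; first by exists (fun=> 0), (fun=> 0).
have [|e [f ef]] := IH; first by apply: leq_trans kN; rewrite addSn addnS ltnW// ltnW.
pose Ce : 'M[F]_(N, k) := \matrix_(i, j) (M *m (e j)^T) i 0.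
pose Cf : 'M[F]_(N, k) := \matrix_(i, j) (M *m (f j)^T) i 0.
have /rowV0Pn[u /sub_kermxP uC u0] : kermx (row_mx Ce Cf) != 0.
  rewrite kermx_eq0 /row_free neq_ltn (leq_ltn_trans (rank_leq_col _))//.
  by apply: leq_trans kN; rewrite addSn addnS ltnW.
have Bcol (g : nat -> 'rV[F]_N) (j : 'I_k) : (u *m (\matrix_(i, j) (M *m (g j)^T) i 0 : 'M[F]_(N, k))) 0 j = B u (g j).
  by rewrite /B -mulmxA !mxE; apply: eq_bigr => i _; rewrite !mxE.
move: uC; rewrite mul_mx_row -[0 in RHS](@row_mx0 _ 1 k k) => /eq_row_mx[uCe uCf].
have ue j : (j < k)%N -> B u (e j) = 0 by move=> jk; rewrite -(Bcol e (Ordinal jk)) [_ *m _]uCe mxE.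
have uf j : (j < k)%N -> B u (f j) = 0 by move=> jk; rewrite -(Bcol f (Ordinal jk)) [_ *m _]uCf mxE.
have /rV0Pn[i uMi] : u *m M != 0.
  by apply: contraNneq u0 => uM0; rewrite -[u](mulmxK uM) uM0 mul0mx.
pose w0 : 'rV[F]_N := ((u *m M) 0 i)^-1 *: delta_mx 0 i.
have uw0 : B u w0 = 1.
  by rewrite mxformZr /B trmx_delta -colE [col _ _ _ _]mxE mulVf.
(* The symplectic projection of [w0] on the family is subtracted. As [u] is orthogonal to the
   family, the pairing of [u] with [w] remains 1. *)
pose w := w0 - \sum_(j < k) (B w0 (f j) *: e j - B w0 (e j) *: f j).
have Bw0 z : B w z = B w0 z - \sum_(j < k) (B w0 (f j) * B (e j) z - B w0 (e j) * B (f j) z).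
  rewrite /w mxformBl mxform_suml; congr (_ - _); apply: eq_bigr => j _.
  by rewrite mxformBl !mxformZl.
have we j : (j < k)%N -> B w (e j) = 0.
  move=> jk; rewrite Bw0 (bigD1 (Ordinal jk))//= big1 => [|l lj].
    rewrite (mxform_anti (e j) (f j)); have [-> _ ->] := ef j j jk jk.
    by rewrite eqxx mulr0 sub0r mulrN1 opprK addr0 subrr.
  rewrite (mxform_anti (e j) (f l)); have [_ _ ->] := ef j l jk (ltn_ord l).
  have [-> _ _] := ef l j (ltn_ord l) jk.
  by move: lj; rewrite -val_eqE /= eq_sym => /negPf ->; rewrite oppr0 !mulr0 subr0.
have wf j : (j < k)%N -> B w (f j) = 0.
  move=> jk; rewrite Bw0 (bigD1 (Ordinal jk))//= big1 => [|l lj].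
    have [_ -> ->] := ef j j jk jk.
    by rewrite eqxx mulr0 subr0 mulr1 addr0 subrr.
  have [_ -> ->] := ef l j (ltn_ord l) jk.
  by move: lj; rewrite -val_eqE /= => /negPf ->; rewrite !mulr0 subr0.
have uw : B u w = 1.
  rewrite mxform_anti Bw0 big1 => [|j _]; first by rewrite subr0 -mxform_anti.
  rewrite (mxform_anti u) ue ?ltn_ord// (mxform_anti u) uf ?ltn_ord//.
  by rewrite oppr0 !mulr0 subr0.
exists (fun j => if j == k then u else e j), (fun j => if j == k then w else f j).
move=> a b; rewrite !ltnS => ak bk.
have ltk c : (c <= k)%N -> c != k -> (c < k)%N by rewrite ltn_neqAle => -> ->.
case: (eqVneq a k) => [aE|/(ltk _ ak) {}ak]; case: (eqVneq b k) => [bE|/(ltk _ bk) {}bk].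
- by rewrite !B0 uw aE bE eqxx.
- by rewrite ue// wf// uf// aE gtn_eqF.
- by rewrite mxform_anti ue// mxform_anti wf// mxform_anti we// !oppr0 bE ltn_eqF.
- exact: ef.
Qed.

End Darboux.

Section PowFormula.
Context {R : realType} (T : Type) (G1 G2 : T -> T -> R[i]).

Definition pair_form (G : T -> T -> R[i]) : ('I_2 -> T) -> R[i] := fun v => G (v ord0) (v ord_max).

Fixpoint block_prod n : ('I_(n * (2 + 2)) -> T) -> R[i] :=
  match n with
  | 0%N => fun=> 1
  | n'.+1 => fun v => pair_form G1 (fun i => v (lshift _ (lshift 2 i))) *
                      pair_form G2 (fun i => v (lshift _ (rshift 2 i))) *
                      block_prod (fun j : 'I_(n' * (2 + 2)) => v (rshift (2 + 2) j))
  end.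

(** All the nested alternations collapse into a single one, at the price of factorials. Only their
    being nonzero matters, so the constant stays existential. *)
Lemma gwedge_pow_block n : exists2 c, c != 0 & forall v,
  gwedge_pow (gwedge (pair_form G1) (pair_form G2)) n v =
  c * \sum_(s : 'S_(n * (2 + 2))) (-1) ^+ s * @block_prod n (fun i => v (s i)).
Proof.
elim: n => [|n [c c0 IH]].
  exists 1 => [|v]; first exact: oner_neq0.
  rewrite mul1r (bigD1 1%g)//= odd_perm1 mulr1 big1 ?addr0// => s /eqP[].
  by apply/permP => -[].
have [c1 c10 E1] := @gwedge_sum R (2 + 2) (n * (2 + 2)).
have [c2 c20 E2] := @gwedge_sum R 2 2.
have f0 k : k`!%:R != 0 :> R[i] by rewrite pnatr_eq0 -lt0n fact_gt0.
exists (c1 * c2 * c * (2 + 2)`!%:R * (n * (2 + 2))`!%:R) => [|v].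
  by rewrite !mulf_neq0.
pose f (u : 'I_(2 + 2) -> T) := pair_form G1 (fun i => u (lshift 2 i)) * pair_form G2 (fun i => u (rshift 2 i)).
transitivity (c1 * \sum_(s : 'S_((2 + 2) + n * (2 + 2))) (-1) ^+ s *
     (c2 * \sum_(r : 'S_(2 + 2)) (-1) ^+ r * f (fun i => v (s (lshift _ (r i))))) *
     (c * \sum_(r : 'S_(n * (2 + 2))) (-1) ^+ r * @block_prod n (fun i => v (s (rshift _ (r i)))))).
  rewrite gwedge_powS E1; congr (_ * _); apply: eq_bigr => s _; rewrite IH E2; congr (_ * _ * _).
  by congr (_ * _); apply: eq_bigr => r _; rewrite /f mulrA.
transitivity (c1 * c2 * c * \sum_(s : 'S_((2 + 2) + n * (2 + 2))) (-1) ^+ s *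
     (\sum_(r : 'S_(2 + 2)) (-1) ^+ r * f (fun i => v (s (lshift _ (r i))))) *
     (\sum_(r : 'S_(n * (2 + 2))) (-1) ^+ r * @block_prod n (fun i => v (s (rshift _ (r i)))))).
  rewrite -2!mulrA; congr (_ * _); rewrite mulrA mulr_sumr; apply: eq_bigr => s _.
  by rewrite [_ * (c2 * _)]mulrCA [_ * (c * _)]mulrCA -!mulrA [c2 * (c * _)]mulrCA.
have := @alternation_l R T (2 + 2) (n * (2 + 2)) f
    (fun u => \sum_(r : 'S_(n * (2 + 2))) (-1) ^+ r * @block_prod n (fun i => u (r i))) v.
move=> ->.
have := @alternation_r R T (2 + 2) (n * (2 + 2)) f (@block_prod n) v.
move=> ->; rewrite !mulrA; congr (_ * _).
by apply: eq_bigr => s _; rewrite [RHS]mulrA.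
Qed.

Lemma block_prodE n (f : nat -> T) :
  @block_prod n (fun i => f (val i)) =
  \prod_(q < n) (G1 (f (4 * q)%N) (f (4 * q + 1)%N) * G2 (f (4 * q + 2)%N) (f (4 * q + 3)%N)).
Proof.
elim: n f => [|n IH] f; first by rewrite big_ord0.
rewrite big_ord_recl /=; congr (_ * _).
rewrite (IH (fun k => f (4 + k)%N)); apply: eq_bigr => q _.
by congr (G1 (f _) (f _) * G2 (f _) (f _)); rewrite /bump /=; lia.
Qed.

End PowFormula.

Section StandardFrame.
Context {R : realType}.
Local Notation C := (R[i]).

Definition swap_parity k := if odd k then k.-1 else k.+1.

Lemma swap_parityK : involutive swap_parity.
Proof. by move=> k; rewrite /swap_parity; case: (boolP (odd k)) => ok; case: ifP; lia. Qed.

Lemma swap_parity_lt n k : (k < n * 4)%N -> (swap_parity k < n * 4)%N.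
Proof. by rewrite /swap_parity; case: (boolP (odd k)); lia. Qed.

(* Value on the pair of indices (i, j) of the form [x0 /\ x1 + x2 /\ x3 + ...]. *)
Definition pairing (i j : nat) : C :=
  if j == swap_parity i then (-1) ^+ odd i else 0.

Lemma prod_even n (g : nat -> C) :
  \prod_(k < n * 4 | ~~ odd k) g k = \prod_(q < n) (g (4 * q)%N * g (4 * q + 2)%N).
Proof.
rewrite -(big_mkord (fun k => ~~ odd k) g).
elim: n => [|n IH]; first by rewrite big_ord0 big_nil.
rewrite big_ord_recr /= -IH big_mkcond [in RHS]big_mkcond /=.
have -> : (n.+1 * 4)%N = (n * 4).+4 by lia.
rewrite !big_nat_recr //=.
have -> : odd (n * 4) = false by lia.
rewrite /= !mulr1 -!mulrA; congr (_ * (g _ * g _)); lia.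
Qed.

(** If no pairing vanishes, [s] maps the pairs {2q, 2q + 1} to such pairs, so it commutes with
    [swap_parity]. By [sign_involution_comm] its sign is then the product of the signs of the
    pairings, and the two cancel. [chi1] and [chi2] only contribute factors 0 or 1. *)
Lemma signed_term_bool n (s : 'S_(n * 4)) (sv : nat -> nat) (chi1 chi2 : nat -> bool) :
  (forall i : 'I_(n * 4), sv i = s i) ->
  let t := (-1) ^+ s * \prod_(q < n)
    (pairing (sv (4 * q)%N) (sv (4 * q + 1)%N) * (chi1 (sv (4 * q)%N))%:R *
    (pairing (sv (4 * q + 2)%N) (sv (4 * q + 3)%N) * (chi2 (sv (4 * q + 2)%N))%:R)) in
  t = (t != 0)%:R.
Proof.
move=> svE t.
pose K := \prod_(q < n) (pairing (sv (4 * q)%N) (sv (4 * q + 1)%N) * pairing (sv (4 * q + 2)%N) (sv (4 * q + 3)%N)).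
pose X := \prod_(q < n) ((chi1 (sv (4 * q)%N))%:R * (chi2 (sv (4 * q + 2)%N))%:R) : C.
have tE : t = (-1) ^+ s * K * X.
  rewrite /t -mulrA -big_split /=; congr (_ * _); apply: eq_bigr => q _.
  by rewrite mulrACA.
have XE : X = (X != 0)%:R.
  rewrite /X; elim/big_ind: _ => [|x y xE yE|q _].
  - by rewrite oner_neq0.
  - by rewrite mulf_eq0 negb_or {1}xE {1}yE; case: (x != 0); case: (y != 0); rewrite ?mul1r ?mul0r.
  - by case: (chi1 _); case: (chi2 _); rewrite ?mul1r ?mul0r ?oner_neq0 ?eqxx.
have [K0|K0] := eqVneq K 0; first by rewrite tE K0 mulr0 mul0r eqxx.
have pair_neq0 i j : pairing i j != 0 -> j = swap_parity i /\ pairing i j = (-1) ^+ odd i.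
  by rewrite /pairing; case: (j =P _) => [-> _|_]; [split|rewrite eqxx].
have Kq (q : 'I_n) : pairing (sv (4 * q)%N) (sv (4 * q + 1)%N) != 0 /\ pairing (sv (4 * q + 2)%N) (sv (4 * q + 3)%N) != 0.
  by apply/andP; rewrite -negb_or -mulf_eq0; apply: contraNneq K0 => Kq; rewrite /K (bigD1 q)//= Kq mul0r.
have sve k : (k < n * 4)%N -> ~~ odd k -> sv k.+1 = swap_parity (sv k).
  move=> kn ok; have qn : (k %/ 4 < n)%N by lia.
  have [/pair_neq0[E1 _] /pair_neq0[E2 _]] := Kq (Ordinal qn).
  have [k4|k4] : k = (4 * (k %/ 4))%N \/ k = (4 * (k %/ 4) + 2)%N by lia.
    have -> : k.+1 = (4 * (k %/ 4) + 1)%N by lia.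
    by rewrite [LHS]E1 /= -k4.
  have -> : k.+1 = (4 * (k %/ 4) + 3)%N by lia.
  by rewrite [LHS]E2 /= -k4.
pose sg (i : 'I_(n * 4)) := Ordinal (swap_parity_lt (ltn_ord i)).
have sgK : involutive sg by move=> i; apply: val_inj; exact: swap_parityK.
pose A : {set 'I_(n * 4)} := finset (fun i : 'I_(n * 4) => ~~ odd i).
have sgA i : (sg i \in A) = (i \notin A).
  by rewrite !inE /= /swap_parity; case: ifP; lia.
have sE : forall i, i \in A -> s (sg i) = sg (s i).
  move=> i; rewrite inE => oi; apply: val_inj; rewrite /= -!svE /= -sve ?ltn_ord//.
  by rewrite /swap_parity (negPf oi).
have sC i : s (sg i) = sg (s i).
  have [iA|iA] := boolP (i \in A); first exact: sE.
  have /sE : sg i \in A by rewrite sgA.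
  by rewrite sgK => ->; rewrite sgK.
have sK : (-1) ^+ s = K :> C.
  rewrite (sign_involution_comm _ sgK sgA sC).
  transitivity (\prod_(k < n * 4 | ~~ odd k) (-1) ^+ odd (sv k) : C).
    apply: eq_big => [i|i _]; first by rewrite inE.
    by rewrite svE inE negbK.
  rewrite (prod_even n (fun k => (-1) ^+ odd (sv k))); apply: eq_bigr => q _.
  by have [/pair_neq0[_ ->] /pair_neq0[_ ->]] := Kq q.
by rewrite tE -sK -signr_addb addbb mul1r.
Qed.

Section Frame.
Variables (T : Type) (n : nat) (G1 G2 : T -> T -> C) (w : nat -> T).
Hypothesis w1 : forall i j, (i < n * 4)%N -> (j < n * 4)%N -> G1 (w i) (w j) = pairing i j * ((i %% 4)%N < 2)%:R.
Hypothesis w2 : forall i j, (i < n * 4)%N -> (j < n * 4)%N -> G2 (w i) (w j) = pairing i j * (2 <= (i %% 4)%N)%:R.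

(** Every term is 0 or 1 and the identity contributes 1, so the sum is a positive integer. *)
Lemma frame_sum_neq0 :
  \sum_(s : 'S_(n * (2 + 2))) (-1) ^+ s * @block_prod R T G1 G2 n (fun i => w (s i)) != 0.
Proof.
(* [s] as a function on natural numbers, with the dummy value 0 outside the range, so that indices
   such as [4 * q + 1] need no bound proofs. *)
pose sv (s : 'S_(n * 4)) k : nat := if insub k is Some i then s i else 0%N.
have svE s (i : 'I_(n * 4)) : sv s i = s i by rewrite /sv valK.
have sv_lt (s : 'S_(n * 4)) k : (k < n * 4)%N -> (sv s k < n * 4)%N.
  by move=> kn; have := svE s (Ordinal kn) => /= ->.
pose t (s : 'S_(n * 4)) : C := (-1) ^+ s * @block_prod R T G1 G2 n (fun i => w (s i)).
have tE s : t s = (-1) ^+ s * \prod_(q < n)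
    (pairing (sv s (4 * q)%N) (sv s (4 * q + 1)%N) * ((sv s (4 * q)%N %% 4)%N < 2)%:R *
    (pairing (sv s (4 * q + 2)%N) (sv s (4 * q + 3)%N) * (2 <= (sv s (4 * q + 2) %% 4)%N)%:R)).
  rewrite /t; congr (_ * _).
  have -> : (fun i : 'I_(n * 4) => w (s i)) = (fun i => w (sv s (val i))).
    by apply: boolp.funext => i; rewrite svE.
  rewrite (block_prodE G1 G2 _ (fun k => w (sv s k))); apply: eq_bigr => q _.
  have qn := ltn_ord q.
  by rewrite w1 ?w2//; apply: sv_lt; lia.
have tb s : t s = (t s != 0)%:R.
  rewrite tE; exact: (signed_term_bool (fun k => (k %% 4)%N < 2)%N (fun k => 2 <= (k %% 4)%N)%N (svE s)).
rewrite -[X in X != 0]/(\sum_(s : 'S_(n * 4)) t s).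
have -> : \sum_(s : 'S_(n * 4)) t s = (\sum_(s : 'S_(n * 4)) (t s != 0%R))%:R.
  by rewrite natr_sum; apply: eq_bigr.
rewrite pnatr_eq0 sum_nat_eq0; apply/forallPn; exists 1%g; rewrite /= eqb0 negbK.
rewrite tE odd_perm1 mul1r; apply/prodf_neq0 => q _.
have qn := ltn_ord q.
have sv1 k : (k < n * 4)%N -> sv 1%g k = k.
  by move=> kn; have := svE 1%g (Ordinal kn); rewrite perm1.
have [E0 E1 E2 E3] : [/\ sv 1%g (4 * q)%N = (4 * q)%N, sv 1%g (4 * q + 1)%N = (4 * q + 1)%N,
  sv 1%g (4 * q + 2)%N = (4 * q + 2)%N & sv 1%g (4 * q + 3)%N = (4 * q + 3)%N] by split; apply: sv1; lia.
rewrite E0 E1 E2 E3 /pairing /swap_parity.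
have -> : odd (4 * q) = false by lia.
have -> : odd (4 * q + 2) = false by lia.
have -> : ((4 * q) %% 4 < 2)%N by lia.
have -> : (2 <= (4 * q + 2) %% 4)%N by lia.
have -> : (4 * q + 1)%N == (4 * q).+1 by lia.
have -> : (4 * q + 3)%N == (4 * q + 2).+1 by lia.
by rewrite expr0 !mulr1 oner_neq0.
Qed.

End Frame.

End StandardFrame.

(** * Forms of type (2,0) in complex coordinates *)

Section StdCoordinates.
Context {R : realType} (N : nat).
Local Notation C := (R[i]).

Definition ccoord (u : 'rV[R]_(N + N)) : 'rV[C]_N := \row_j (u 0 (lshift N j) +i* u 0 (rshift N j)).

Definition of_ccoord (z : 'rV[C]_N) : 'rV[R]_(N + N) :=
  row_mx (\row_j complex.Re (z 0 j)) (\row_j complex.Im (z 0 j)).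

Lemma of_ccoordK : cancel of_ccoord ccoord.
Proof. by move=> z; apply/rowP => j; rewrite /ccoord mxE row_mxEl row_mxEr !mxE; case: (z 0 j). Qed.

Lemma ccoordK : cancel ccoord of_ccoord.
Proof.
move=> u; apply/rowP => j; rewrite !mxE -(splitK j).
by case: (fintype.split j) => k; rewrite unsplitK /= !mxE.
Qed.

Lemma ccoordD u v : ccoord (u + v) = ccoord u + ccoord v.
Proof. by apply/rowP => j; rewrite !mxE. Qed.

Lemma ccoordZ (r : R) u : ccoord (r *: u) = r%:C *: ccoord u.
Proof. by apply/rowP => j; rewrite !mxE; apply: complexP; rewrite /= ?mul0r ?subr0 ?addr0. Qed.

Lemma ccoordJ u : ccoord (u *m stdJ R N) = 'i%C *: ccoord u.
Proof.
rewrite -{1}(hsubmxK u) /stdJ mul_row_block !mulmx0 mulmx1 mulmxN mulmx1 add0r addr0.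
by apply/rowP => j; rewrite /ccoord mxE row_mxEl row_mxEr !mxE; apply: complexP; rewrite /= ?mul0r ?mul1r ?sub0r ?add0r.
Qed.

Definition cmatrix (a : two_tensor R (N + N)) : 'M[C]_N :=
  \matrix_(i, j) a (of_ccoord (delta_mx 0 i)) (of_ccoord (delta_mx 0 j)).

(** Multiplication by c in C^N is Re c + (Im c) J on real vectors, so type (2,0) amounts to complex
    bilinearity, and the values on a complex basis determine the form. *)
Lemma cmatrixE a u v : alternating2 a -> hodge20 (stdJ R N) a ->
  a u v = mxform (cmatrix a) (ccoord u) (ccoord v).
Proof.
move=> alt h20.
have ofD x y : of_ccoord (x + y) = of_ccoord x + of_ccoord y.
  by apply: (can_inj ccoordK); rewrite ccoordD !of_ccoordK.
have ofZ (c : C) x : of_ccoord (c *: x) = complex.Re c *: of_ccoord x + complex.Im c *: (of_ccoord x *m stdJ R N).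
  apply: (can_inj ccoordK); rewrite ccoordD !ccoordZ ccoordJ !of_ccoordK scalerA -scalerDl.
  congr (_ *: _); case: c => p q; apply: complexP => /=; ring.
have cE (c : C) : c = (complex.Re c)%:C + (complex.Im c)%:C * 'i%C.
  by case: c => p q; apply: complexP => /=; ring.
have al (c : C) x y : a (of_ccoord (c *: x)) y = c * a (of_ccoord x) y.
  by rewrite ofZ altDl// !altZl// (h20 _ _).1 mulrA -mulrDl -cE.
have ar (c : C) x y : a y (of_ccoord (c *: x)) = c * a y (of_ccoord x).
  by rewrite ofZ altDr// !altZr// (h20 _ _).2 mulrA -mulrDl -cE.
have of0 : of_ccoord 0 = 0 by apply/rowP => j; rewrite !mxE; case: fintype.split => k; rewrite !mxE.
have asl I (s : seq I) (F : I -> 'rV[C]_N) y : a (of_ccoord (\sum_(k <- s) F k)) y = \sum_(k <- s) a (of_ccoord (F k)) y.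
  by elim/big_rec2: _ => [|k p q _ <-]; rewrite ?of0 ?alt0l// ofD altDl.
have asr I (s : seq I) (F : I -> 'rV[C]_N) y : a y (of_ccoord (\sum_(k <- s) F k)) = \sum_(k <- s) a y (of_ccoord (F k)).
  by elim/big_rec2: _ => [|k p q _ <-]; rewrite ?of0 ?alt0r// ofD altDr.
rewrite -{1}(ccoordK u) -{1}(ccoordK v); move: (ccoord u) (ccoord v) => x y.
rewrite {1}[x]row_sum_delta {1}[y]row_sum_delta asl.
rewrite /mxform bilin_mxE; apply: eq_bigr => i _; rewrite asr; apply: eq_bigr => j _.
by rewrite al ar mulrA mxE.
Qed.

Lemma cmatrix_unit a : alternating2 a -> hodge20 (stdJ R N) a -> Defs.nondegenerate a ->
  cmatrix a \in unitmx.
Proof.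
move=> alt h20 nd; apply: row_free_eq0 => z zM.
rewrite -[z]of_ccoordK (nd (of_ccoord z)) => [|v].
  by rewrite -[0](scale0r 0) ccoordZ scale0r.
by rewrite (cmatrixE _ _ alt h20) of_ccoordK /mxform zM mul0mx mxE.
Qed.

End StdCoordinates.

Section WedgeType20.
Context {R : realType}.
Local Notation C := (R[i]).

Lemma hodge20_coordinates N (a : two_tensor R (N + N)) (I S : 'M[R]_(N + N)) :
  alternating2 a -> hodge20 I a -> S \in unitmx -> I *m S = S *m stdJ R N ->
  exists M : 'M[C]_N, [/\ forall u v, a u v = mxform M (ccoord (u *m S)) (ccoord (v *m S)),
    forall z, mxform M z z = 0 & Defs.nondegenerate a -> M \in unitmx].
Proof.
move=> alt h20 uS IS; pose b : two_tensor R (N + N) := fun u v => a (u *m invmx S) (v *m invmx S).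
have altb : alternating2 b by exact: alternating2_map.
have ISV u : u *m stdJ R N *m invmx S = u *m invmx S *m I.
  by rewrite -[RHS](mulmxK uS) -[_ *m I *m S]mulmxA IS !mulmxA mulmxKV.
have h20b : hodge20 (stdJ R N) b by move=> u v; rewrite /b !ISV; exact: h20.
exists (cmatrix b); split.
- by move=> u v; rewrite -(cmatrixE _ _ altb h20b) /b !mulmxK.
- by move=> z; rewrite -(of_ccoordK z) -(cmatrixE _ _ altb h20b); case: altb.
- move=> nd; apply: cmatrix_unit => // u bu0.
  have : u *m invmx S = 0.
    by apply: nd => v; rewrite -[v](mulmxK uS); exact: bu0.
  by move=> uS0; rewrite -[u](mulmxKV uS) uS0 mul0mx.
Qed.

(** Block form of [pairing] with 4 x 4 blocks, matching the frames listed in groups of four, so that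
    the comparison becomes a finite case analysis. *)
Lemma pairingE i j : pairing i j = ((i %/ 4)%N == (j %/ 4)%N)%:R *
   nth 0 (nth [::] [:: [:: 0; 1; 0; 0]; [:: -1; 0; 0; 0]; [:: 0; 0; 0; 1]; [:: 0; 0; -1; 0]] (i %% 4)) (j %% 4) :> C.
Proof.
have oi : odd i = odd (i %% 4) by lia.
have := ltn_pmod i (isT : 0 < 4)%N; have := ltn_pmod j (isT : 0 < 4)%N.
rewrite /pairing oi.
case: eqP => H; case: eqP => H'; case Ei: (i %% 4)%N => [|[|[|[|]]]] //; case Ej: (j %% 4)%N => [|[|[|[|]]]] // _ _;
  rewrite /= ?mul1r ?mul0r ?expr0 ?expr1 //;
  exfalso; move: H H' Ei Ej; rewrite /swap_parity; case: ifP; lia.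
Qed.

Lemma real_points_span d (x y : 'rV[C]_d) : exists p q : 'rV[C]_d,
  x = 'i%C *: p + q /\ y = 'i%C *: map_mx (fun z => (z^*)%C) p + map_mx (fun z => (z^*)%C) q.
Proof.
have span (z w : C) : exists p : C * C,
    z = 'i%C * p.1 + p.2 /\ w = 'i%C * (p.1^*)%C + (p.2^*)%C.
  (* Conjugating the second equation gives conj w = - i p + q, hence p = (z - conj w) / (2 i) and q
     = (z + conj w) / 2. *)
  exists ((0 -i* 2^-1) * (z - (w^*)%C), (2^-1 +i* 0) * (z + (w^*)%C)).
  by case: z w => [a b] [c d']; split; apply: complexP => /=; lra.
have /choice[p pE] : forall j, exists p : C * C, x 0 j = 'i%C * p.1 + p.2 /\ y 0 j = 'i%C * (p.1^*)%C + (p.2^*)%C.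
  by move=> j; exact: span.
exists (\row_j (p j).1), (\row_j (p j).2).
split; apply/rowP => j; have [zE wE] := pE j; first by rewrite zE !mxE.
by rewrite wE !mxE.
Qed.

Lemma multilinear_pair_form (E : lmodType C) (G : E -> E -> C) :
  (forall c x y z, G (c *: x + y) z = c * G x z + G y z) ->
  (forall c x y z, G z (c *: x + y) = c * G z x + G z y) ->
  multilinear (pair_form G).
Proof.
move=> Gl Gr v i c x y; rewrite /pair_form /upd.
have [->|->] : i = ord0 \/ i = ord_max.
  by case: i => -[|[|//]] ?; [left|right]; apply: val_inj.
- by rewrite /= Gl.
- by rewrite /= Gr.
Qed.

Variables (n : nat) (a : two_tensor R (2 * n + 2 * n)) (I S : 'M[R]_(2 * n + 2 * n)).
Hypotheses (alt : alternating2 a) (h20 : hodge20 I a) (uS : S \in unitmx).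
Hypothesis (IS : I *m S = S *m stdJ R (2 * n)%N).

(** The form is pulled back from a complex bilinear form on C^{2n}, and an alternating form in 2n +
    2 arguments vanishes there. *)
Lemma wedge_pow_type20_eq0 v : wedge_pow (form_of a) n.+1 v = 0.
Proof.
have [M [aE M0 _]] := hodge20_coordinates alt h20 uS IS.
rewrite wedge_powE.
have -> : form_of a = (fun v => pair_form (mxform M) ((fun u => ccoord (u *m S)) \o v)).
  by apply: boolp.funext => w; rewrite /form_of aE.
rewrite gwedge_pow_map gwedge_powS.
have lB : multilinear (pair_form (mxform M)).
  apply: multilinear_pair_form => c x y z; first by rewrite mxformDl mxformZl.
  by rewrite mxformDr mxformZr.
apply: gwedge_dim_eq0 => //; first exact: multilinear_pow.
by lia.
Qed.

(** [E] plays the role of the complexified tangent space, split into its (1,0) and (0,1) parts, and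
    [Z] embeds the real vectors. If the power vanished on real vectors it would vanish on [E],
    against its value on a Darboux frame. *)
Lemma wedge_pow_type20_neq0 : Defs.nondegenerate a ->
  exists v, wedge_pow (wedge (form_of a) (form_of (fun u v => ((a u v)^*)%C))) n v != 0.
Proof.
move=> nd; have [M [aE M0 /(_ nd) uM]] := hodge20_coordinates alt h20 uS IS.
pose cj (z : 'rV[C]_(2 * n)) : 'rV[C]_(2 * n) := map_mx (fun x => (x^*)%C) z.
have cjK z : cj (cj z) = z by apply/rowP => j; rewrite !mxE conjcK.
have cjD x y : cj (x + y) = cj x + cj y by apply/rowP => j; rewrite !mxE rmorphD.
have cjZ c x : cj (c *: x) = (c^*)%C *: cj x by apply/rowP => j; rewrite !mxE rmorphM.
pose E := ('rV[C]_(2 * n) * 'rV[C]_(2 * n))%type.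
pose Z (u : 'rV[R]_(2 * n + 2 * n)) : E := (ccoord (u *m S), cj (ccoord (u *m S))).
pose G1 (p q : E) : C := mxform M p.1 q.1.
(* The inner and outer conjugations compensate, so [G2] is complex bilinear, yet on real vectors it
   is the conjugate of [a]. *)
pose G2 (p q : E) : C := ((mxform M (cj p.2) (cj q.2))^*)%C.
have l1 : multilinear (pair_form G1).
  apply: multilinear_pair_form => c x y z; rewrite /G1 /=.
    by rewrite mxformDl mxformZl.
  by rewrite mxformDr mxformZr.
have l2 : multilinear (pair_form G2).
  apply: multilinear_pair_form => c x y z; rewrite /G2 /= cjD cjZ.
    by rewrite mxformDl mxformZl rmorphD rmorphM /= conjcK.
  by rewrite mxformDr mxformZr rmorphD rmorphM /= conjcK.
have G1Z : form_of a = (fun v => pair_form G1 (Z \o v)).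
  by apply: boolp.funext => w; rewrite /form_of aE.
have G2Z : form_of (fun u v => ((a u v)^*)%C) = (fun v => pair_form G2 (Z \o v)).
  by apply: boolp.funext => w; rewrite /form_of aE /pair_form /G2 /= !cjK.
apply: contrapT => /boolp.forallNP H.
have vanish v : gwedge_pow (gwedge (pair_form G1) (pair_form G2)) n v = 0.
  apply: (@multilinear_vanish _ _ _ _ (fun p : E => exists u, p = Z u)) v.
  - exact/multilinear_pow/multilinear_gwedge.
  - move=> [x y]; pose inZ z : E := (z, cj z).
    have inZP z : exists u, inZ z = Z u.
      by exists (of_ccoord z *m invmx S); rewrite /Z mulmxKV// of_ccoordK.
    have [p [q [xE yE]]] := real_points_span x y.
    by exists (inZ p), (inZ q); split => //; rewrite {1}xE {1}yE.
  - move=> v /choice[u uE]; have /negP := H u; rewrite negbK => /eqP.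
    have -> : v = Z \o u by apply: boolp.funext => j; rewrite uE.
    rewrite wedge_powE.
    have -> : wedge (form_of a) (form_of (fun u v => ((a u v)^*)%C)) =
              (fun v => gwedge (pair_form G1) (pair_form G2) (Z \o v)) by rewrite G1Z G2Z.
    by rewrite gwedge_pow_map.
have [e [f ef]] : exists e f, symplectic_family M n e f.
  by apply: symplectic_family_exists => //; rewrite mul2n addnn.
(* Each group of four consists of e_q, f_q in the first factor, seen only by [G1], and their
   conjugates in the second, seen only by [G2]. *)
pose w k : E := nth 0 [:: (e (k %/ 4)%N, 0); (f (k %/ 4)%N, 0); (0, cj (e (k %/ 4)%N)); (0, cj (f (k %/ 4)%N))] (k %% 4).
have [c c0 cE] := gwedge_pow_block G1 G2 n.
have := vanish (fun i => w i); rewrite cE; apply/eqP; rewrite mulf_neq0//.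
have cj0 : cj 0 = 0 by apply/rowP => j; rewrite !mxE rmorph0.
have feB i j : (i < n)%N -> (j < n)%N -> mxform M (f i) (e j) = - (i == j)%:R.
  by move=> li lj; rewrite mxform_anti// eq_sym; have [_ _ ->] := ef j i lj li.
have modlt k : (k %% 4 < 4)%N by exact: ltn_pmod.
apply: frame_sum_neq0 => i j ilt jlt.
  have li : (i %/ 4 < n)%N by rewrite ltn_divLR.
  have lj : (j %/ 4 < n)%N by rewrite ltn_divLR.
  have [ee ff eff] := ef _ _ li lj; have fe := feB _ _ li lj.
  rewrite pairingE /G1 /w; move: (modlt i) (modlt j).
  case: (i %% 4)%N => [|[|[|[|//]]]] _; case: (j %% 4)%N => [|[|[|[|//]]]] _;
    rewrite /= ?mxform0l ?mxform0r ?ee ?ff ?eff ?fe ?mulr0 ?mul0r ?mulr1 ?mulrN1//.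
have li : (i %/ 4 < n)%N by rewrite ltn_divLR.
have lj : (j %/ 4 < n)%N by rewrite ltn_divLR.
have [ee ff eff] := ef _ _ li lj; have fe := feB _ _ li lj.
rewrite pairingE /G2 /w; move: (modlt i) (modlt j).
case: (i %% 4)%N => [|[|[|[|//]]]] _; case: (j %% 4)%N => [|[|[|[|//]]]] _;
  rewrite /= ?cjK ?cj0 ?mxform0l ?mxform0r ?ee ?ff ?eff ?fe ?mulr0 ?mul0r ?mulr1 ?mulrN1 ?rmorph0 ?rmorphN ?rmorph_nat ?mulrN1//.
Qed.

End WedgeType20.

(** * Smooth maps and their differentials in charts *)

Section Charts.
Context {R : realType}.

Section OneManifold.
Context {d : nat} {X : topologicalType}.
Implicit Types c : chart R d X.

Lemma cimg_cdom c z : chart_axiom c -> cimg c z -> cdom c (cinv c z).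
Proof. by case=> _ _ cK _ _ [x xc <-]; rewrite cK. Qed.

Lemma cinvK c z : chart_axiom c -> cimg c z -> cmap c (cinv c z) = z.
Proof. by case=> _ _ cK _ _ [x xc <-]; rewrite cK. Qed.

Lemma cmapK c x : chart_axiom c -> cdom c x -> cinv c (cmap c x) = x.
Proof. by case=> _ _ cK _ _; exact: cK. Qed.

Lemma cimg_cmap c x : cdom c x -> cimg c (cmap c x).
Proof. by exists x. Qed.

Lemma open_cinv_preimage c (A : set X) : chart_axiom c -> open A ->
  open [set z | cimg c z /\ A (cinv c z)].
Proof.
case=> _ oi _ _ ci oA; rewrite openE => z [zi Az].
apply: filterI; first exact: open_nbhs_nbhs.
by apply: (ci z zi); exact: open_nbhs_nbhs.
Qed.

Lemma overlapE c c' : chart_axiom c -> overlap c c' = [set z | cimg c z /\ cdom c' (cinv c z)].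
Proof.
move=> ac; apply/seteqP; split=> [_ [x [xc xc'] <-]|z [zi zc']].
  by split; [exists x|rewrite cmapK].
by exists (cinv c z); [split => //; exact: cimg_cdom|rewrite cinvK].
Qed.

End OneManifold.

Definition rep d d' (X X' : topologicalType) (f : X -> X') (c : chart R d X) (c' : chart R d' X') :
  'rV[R]_d -> 'rV[R]_d' := fun z => cmap c' (f (cinv c z)).

Definition repdom d d' (X X' : topologicalType) (f : X -> X') (c : chart R d X) (c' : chart R d' X') :
  set 'rV[R]_d := [set z | cimg c z /\ cdom c' (f (cinv c z))].

Definition repD d d' (X X' : topologicalType) (f : X -> X') (c : chart R d X) (c' : chart R d' X') x :
  'M[R]_(d, d') := 'J (rep f c c') (cmap c x).

Lemma open_repdom d d' (X X' : topologicalType) (f : X -> X') (c : chart R d X) (c' : chart R d' X') :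
  chart_axiom c -> chart_axiom c' -> continuous f -> open (repdom f c c').
Proof.
move=> ac [oc' _ _ _ _] cf; apply: (@open_cinv_preimage _ _ c (f @^-1` cdom c')) => //.
by apply: open_comp => // x _; exact: cf.
Qed.

Lemma repdom_cmap d d' (X X' : topologicalType) (f : X -> X') (c : chart R d X) (c' : chart R d' X') x :
  chart_axiom c -> cdom c x -> cdom c' (f x) -> repdom f c c' (cmap c x).
Proof. by move=> ac xc fxc'; split; [exact: cimg_cmap|rewrite cmapK]. Qed.

Lemma repE d d' (X X' : topologicalType) (f : X -> X') (c : chart R d X) (c' : chart R d' X') x :
  chart_axiom c -> cdom c x -> rep f c c' (cmap c x) = cmap c' (f x).
Proof. by move=> ac xc; rewrite /rep cmapK. Qed.

Lemma rep_comp d d' d'' (X X' X'' : topologicalType) (f : X -> X') (g : X' -> X'')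
    (c : chart R d X) (c' : chart R d' X') (c'' : chart R d'' X'') z :
  chart_axiom c' -> repdom f c c' z -> rep g c' c'' (rep f c c' z) = rep (g \o f) c c'' z.
Proof. by move=> ac' [zi fz]; rewrite {1}/rep /rep cmapK. Qed.

Lemma repdom_comp d d' d'' (X X' X'' : topologicalType) (f : X -> X') (g : X' -> X'')
    (c : chart R d X) (c' : chart R d' X') (c'' : chart R d'' X'') z :
  chart_axiom c' -> repdom f c c' z -> repdom (g \o f) c c'' z -> repdom g c' c'' (rep f c c' z).
Proof.
move=> ac' [zi fz] [_ gfz]; rewrite /repdom /rep /= cmapK//.
by split => //; exact: cimg_cmap.
Qed.

Lemma smooth_rep_comp d d' d'' (X X' X'' : topologicalType) (f : X -> X') (g : X' -> X'')
    (c : chart R d X) (c' : chart R d' X') (c'' : chart R d'' X'') :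
  chart_axiom c -> chart_axiom c' -> chart_axiom c'' -> continuous f -> continuous g ->
  smooth_on (repdom f c c') (rep f c c') -> smooth_on (repdom g c' c'') (rep g c' c'') ->
  smooth_on (repdom f c c' `&` repdom (g \o f) c c'') (rep (g \o f) c c'').
Proof.
move=> ac ac' ac'' cf cg sf sg k.
have of_ := open_repdom ac ac' cf; have og := open_repdom ac' ac'' cg.
have ogf : open (repdom (g \o f) c c'') by apply: open_repdom => // x; apply: continuous_comp; [exact: cf|exact: cg].
have oI := openI of_ ogf.
have sI z : (repdom f c c' `&` repdom (g \o f) c c'') z -> repdom g c' c'' (rep f c c' z).
  by case=> z1 z2; exact: repdom_comp.
have C1 : class_C k (repdom f c c' `&` repdom (g \o f) c c'') (rep f c c').
  by apply: class_C_sub (sf k) => z [].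
apply: class_C_ext oI _ (class_C_comp_mx oI og sI C1 (sg k)) => z [z1 _] /=.
exact: rep_comp.
Qed.

Lemma repD_comp d d' d'' (X X' X'' : topologicalType) (f : X -> X') (g : X' -> X'')
    (c : chart R d X) (c' : chart R d' X') (c'' : chart R d'' X'') x :
  chart_axiom c -> chart_axiom c' -> continuous f ->
  cdom c x -> cdom c' (f x) ->
  differentiable (rep f c c') (cmap c x) -> differentiable (rep g c' c'') (cmap c' (f x)) ->
  repD (g \o f) c c'' x = repD f c c' x *m repD g c' c'' (f x).
Proof.
move=> ac ac' cf xc fxc' df dg; rewrite -(repE f c' ac xc) in dg *.
apply/row_matrixP => i; rewrite !rowE mulmxA /repD -(repE f c' ac xc) -!diffEjacobian.
have dc : differentiable (rep g c' c'' \o rep f c c') (cmap c x) by exact: differentiable_comp.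
have E : \forall z \near cmap c x, (rep g c' c'' \o rep f c c') z = rep (g \o f) c c'' z.
  have : nbhs (cmap c x) (repdom f c c').
    by apply: open_nbhs_nbhs; split; [exact: open_repdom|exact: repdom_cmap].
  by apply: filterS => z zd; exact: rep_comp.
by rewrite (diff_near_eq _ E dc) diff_comp.
Qed.

(** Compatible charts that need not belong to the atlas: the charts adapted to a fibre are of this
    kind. *)
Definition smooth_chart d (M : smoothManifold R d) (c : chart R d M) :=
  chart_axiom c /\ forall c', atlas M c' ->
    smooth_on (repdom id c c') (rep id c c') /\ smooth_on (repdom id c' c) (rep id c' c).

Section Manifold.
Context {d : nat} {M : smoothManifold R d}.

Lemma atlas_smooth_chart (c : chart R d M) : atlas M c -> smooth_chart c.
Proof.
move=> cA; split; first exact: atlas_chart.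
move=> c' c'A; split.
  by have := atlas_smooth cA c'A; rewrite overlapE//; exact: atlas_chart.
by have := atlas_smooth c'A cA; rewrite overlapE//; exact: atlas_chart.
Qed.

Lemma smooth_chart_at (x : M) : smooth_chart (chart_at x).
Proof. exact/atlas_smooth_chart/chart_at_atlas. Qed.

End Manifold.

Lemma holomorphic_smooth_chart N (X : complexManifold R N) (c : chart R (N + N) X) :
  holomorphic_chart c -> smooth_chart c.
Proof.
move=> [ac H]; split=> // c' c'A; have [[s1 _] [s2 _]] := H c' c'A; split.
  by move: s1; rewrite overlapE.
by move: s2; rewrite overlapE//; exact: atlas_chart.
Qed.

(** [smooth_map] only speaks of atlas charts. Near each point the representative factors through the
    preferred charts there, with a smooth change of coordinates on either side. *)
Lemma smooth_rep d d' (M : smoothManifold R d) (M' : smoothManifold R d') (f : M -> M')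
    (c : chart R d M) (c' : chart R d' M') :
  smooth_map f -> smooth_chart c -> smooth_chart c' -> smooth_on (repdom f c c') (rep f c c').
Proof.
move=> [cf sf] [ac sc] [ac' sc'] k.
apply: class_C_local => z [zi zd].
pose x := cinv c z; pose c0 := chart_at x; pose c0' := chart_at (f x).
have A0 : atlas M c0 by exact: chart_at_atlas.
have A0' : atlas M' c0' by exact: chart_at_atlas.
have a0 : chart_axiom c0 := atlas_chart A0; have a0' : chart_axiom c0' := atlas_chart A0'.
have s0 : smooth_on (repdom f c0 c0') (rep f c0 c0').
  have := sf _ _ A0 A0'; rewrite (_ : _ @` _ = repdom f c0 c0')//.
  apply/seteqP; split=> [_ [y [y0 y0'] <-]|w [wi wd]]; first exact: repdom_cmap.
  by exists (cinv c0 w); [split => //; exact: cimg_cdom|rewrite cinvK].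
have cid (T : topologicalType) : continuous (id : T -> T) by move=> ?.
have s1 := smooth_rep_comp ac a0 a0' (cid _) cf (sc _ A0).1 s0.
set U := _ `&` _ in s1.
have s2 : smooth_on (U `&` repdom f c c') (rep f c c').
  have oU : open U by apply: openI; exact: open_repdom.
  have oI : open (U `&` repdom f c c') by apply: openI => //; exact: open_repdom.
  have sI w : (U `&` repdom f c c') w -> repdom id c0' c' (rep f c c0' w).
    by case=> [[_ w1] w2]; exact: (@repdom_comp _ _ _ _ _ _ f id).
  move=> j; have C1 : class_C j (U `&` repdom f c c') (rep f c c0').
    by apply: class_C_sub (s1 j) => w [].
  have o' : open (repdom (id : M' -> M') c0' c') by exact: open_repdom.
  apply: class_C_ext oI _ (class_C_comp_mx oI o' sI C1 ((sc' _ A0').2 j)) => w [[_ w1] _] /=.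
  exact: (@rep_comp _ _ _ _ _ _ f id).
exists (U `&` repdom f c c'); last exact: s2.
by split; [split; split => //; exact: chart_at_dom|split].
Qed.

Lemma smooth_map_id d (M : smoothManifold R d) : smooth_map (id : M -> M).
Proof.
split=> [x //|c c' cA c'A].
have := atlas_smooth cA c'A; rewrite overlapE; last exact: atlas_chart.
have -> : cmap c @` (cdom c `&` id @^-1` cdom c') = overlap c c' by [].
by rewrite overlapE//; exact: atlas_chart.
Qed.

Lemma rep_differentiable d d' (M : smoothManifold R d) (M' : smoothManifold R d') (f : M -> M')
    (c : chart R d M) (c' : chart R d' M') x :
  smooth_map f -> smooth_chart c -> smooth_chart c' -> cdom c x -> cdom c' (f x) ->
  differentiable (rep f c c') (cmap c x).
Proof.
move=> sf sc sc' xc fxc'; have := smooth_rep sf sc sc' => /(_ 1%N)[H _].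
by apply: H; apply: repdom_cmap => //; case: sc.
Qed.

Lemma repD_chain d d' d'' (M : smoothManifold R d) (M' : smoothManifold R d') (M'' : smoothManifold R d'')
    (f : M -> M') (g : M' -> M'') c c' c'' x :
  smooth_map f -> smooth_map g -> smooth_chart c -> smooth_chart c' -> smooth_chart c'' ->
  cdom c x -> cdom c' (f x) -> cdom c'' (g (f x)) ->
  repD (g \o f) c c'' x = repD f c c' x *m repD g c' c'' (f x).
Proof.
move=> sf sg sc sc' sc'' xc fxc' gfxc''.
apply: repD_comp => //; [by case: sc|by case: sc'|by case: sf|exact: rep_differentiable|exact: rep_differentiable].
Qed.

Definition transD d (M : smoothManifold R d) (c c' : chart R d M) x := repD (id : M -> M) c c' x.

Section ManifoldDiff.
Context {d : nat} {M : smoothManifold R d}.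
Implicit Types (c : chart R d M).

Lemma transD_id c x : smooth_chart c -> cdom c x -> transD c c x = 1%:M.
Proof.
move=> [ac _] xc; apply/row_matrixP => i; rewrite !rowE mulmx1 -diffEjacobian.
have E : \forall z \near cmap c x, id z = rep (id : M -> M) c c z.
  have : nbhs (cmap c x) (cimg c).
    by apply: open_nbhs_nbhs; split; [case: ac|exact: cimg_cmap].
  by apply: filterS => z zi; rewrite /rep cinvK.
by rewrite (diff_near_eq _ E) // diff_val.
Qed.

Lemma transD_trans c c' c'' x : smooth_chart c -> smooth_chart c' -> smooth_chart c'' ->
  cdom c x -> cdom c' x -> cdom c'' x -> transD c c'' x = transD c c' x *m transD c' c'' x.
Proof. by move=> *; exact: (@repD_chain _ _ _ _ _ _ id id _ _ _ _ (smooth_map_id _) (smooth_map_id _)). Qed.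

Lemma transDV c c' x : smooth_chart c -> smooth_chart c' -> cdom c x -> cdom c' x ->
  transD c c' x *m transD c' c x = 1%:M.
Proof. by move=> sc sc' xc xc'; rewrite -transD_trans// transD_id. Qed.

Lemma transD_unit c c' x : smooth_chart c -> smooth_chart c' -> cdom c x -> cdom c' x ->
  transD c c' x \in unitmx.
Proof. by move=> sc sc' xc xc'; have [H _] := mulmx1_unit (transDV sc sc' xc xc'); exact: H. Qed.

Lemma to_chartE c x u : to_chart c x u = u *m transD (chart_at x) c x.
Proof. by rewrite /to_chart diffEjacobian. Qed.

Lemma of_chartE c x u : of_chart c x u = u *m transD c (chart_at x) x.
Proof. by rewrite /of_chart diffEjacobian. Qed.

End ManifoldDiff.

Section MapDiff.
Context {d d' : nat} {M : smoothManifold R d} {M' : smoothManifold R d'}.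
Variable f : M -> M'.
Hypothesis sf : smooth_map f.

Lemma mdiffE x u : mdiff f x u = u *m repD f (chart_at x) (chart_at (f x)) x.
Proof. by rewrite /mdiff diffEjacobian. Qed.

Lemma repD_transl c1 c2 c' x : smooth_chart c1 -> smooth_chart c2 -> smooth_chart c' ->
  cdom c1 x -> cdom c2 x -> cdom c' (f x) -> repD f c1 c' x = transD c1 c2 x *m repD f c2 c' x.
Proof. by move=> *; exact: (@repD_chain _ _ _ _ _ _ id f _ _ _ _ (smooth_map_id _) sf). Qed.

Lemma repD_transr c c1 c2 x : smooth_chart c -> smooth_chart c1 -> smooth_chart c2 ->
  cdom c x -> cdom c1 (f x) -> cdom c2 (f x) -> repD f c c2 x = repD f c c1 x *m transD c1 c2 (f x).
Proof. by move=> *; exact: (@repD_chain _ _ _ _ _ _ f id _ _ _ _ sf (smooth_map_id _)). Qed.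

(** The tangent vectors go through the preferred charts at [x] and [f x]; by the chain rule these
    detours cancel and leave the Jacobian of the representative. *)
Lemma in_chart_pullback (Psi : tensor_field M') c c' u v z :
  smooth_chart c -> smooth_chart c' -> repdom f c c' z ->
  in_chart (pullback f Psi) c u v z =
  in_chart Psi c' (u *m 'J (rep f c c') z) (v *m 'J (rep f c c') z) (rep f c c' z).
Proof.
move=> sc sc' [zi zd]; have ac := sc.1; have ac' := sc'.1.
rewrite /in_chart /pullback; set x := cinv c z in zd *.
have xc : cdom c x by exact: cimg_cdom.
have zE : z = cmap c x by rewrite cinvK.
have -> : cinv c' (rep f c c' z) = f x by rewrite /rep cmapK.
rewrite zE !of_chartE !mdiffE -!mulmxA.
have -> : transD c (chart_at x) x *m repD f (chart_at x) (chart_at (f x)) x =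
          repD f c c' x *m transD c' (chart_at (f x)) (f x).
  rewrite -repD_transl//; try exact: smooth_chart_at; try exact: chart_at_dom.
  by rewrite -repD_transr//; try exact: smooth_chart_at; try exact: chart_at_dom.
by [].
Qed.

End MapDiff.

End Charts.

(** * Pullback and exterior derivative in coordinates *)

Section TensorCalculus.
Context {R : realType} {d e : nat}.

Section RealTensor.
Variables (f A B : 'rV[R]_d -> 'rV[R]_e) (h : 'rV[R]_e -> 'rV[R]_e -> 'rV[R]_e -> R^o).
Hypothesis hE : forall z u v, h z u v =
  \sum_(i < e) \sum_(j < e) u 0 i * v 0 j * h z (delta_mx 0 i) (delta_mx 0 j).

Lemma class_C_tensor k (U : set 'rV[R]_d) (U' : set 'rV[R]_e) : open U -> open U' ->
  (forall z, U z -> U' (f z)) -> class_C k U f -> class_C k U A -> class_C k U B ->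
  (forall u v, class_C k U' (fun z => h z u v)) ->
  class_C k U (fun z => h (f z) (A z) (B z) : R^o).
Proof.
move=> oU oU' sU Cf CA CB Ch; under eq_fun do rewrite hE.
apply: class_C_sum => // i _; apply: class_C_sum => // j _.
apply: class_C_mul => //; last exact: class_C_comp oU oU' sU Cf (Ch _ _).
have /(class_C_mxP _ _ oU) {}CA := CA; have /(class_C_mxP _ _ oU) {}CB := CB.
by apply: class_C_mul.
Qed.

Lemma derive_tensor z w : differentiable f z -> differentiable A z -> differentiable B z ->
  (forall u v, differentiable (fun y => h y u v) (f z)) ->
  'D_w (fun y => h (f y) (A y) (B y) : R^o) z =
  h (f z) ('D_w A z) (B z) + h (f z) (A z) ('D_w B z) +
  'D_('D_w f z) (fun y => h y (A z) (B z)) (f z).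
Proof.
move=> df dA dB dh.
pose t i j y := h y (delta_mx 0 i) (delta_mx 0 j) : R^o.
have tE i j : differentiable (t i j) (f z) by exact: dh.
pose g i j (y : 'rV[R]_d) := A y 0 i * B y 0 j * t i j (f y) : R^o.
have dAi i : differentiable (fun y => A y 0 i : R^o) z by have /differentiable_mxP := dA; exact.
have dBj j : differentiable (fun y => B y 0 j : R^o) z by have /differentiable_mxP := dB; exact.
have dtf i j : differentiable (t i j \o f) z by exact: differentiable_comp.
have dAB i j : differentiable (fun y => A y 0 i * B y 0 j : R^o) z by exact: differentiableM.
have dg i j : differentiable (g i j) z by exact: (differentiableM (dAB i j) (dtf i j)).
have -> : (fun y => h (f y) (A y) (B y) : R^o) = \sum_(i < e) \sum_(j < e) g i j.
  by apply: boolp.funext => y; rewrite hE fct_sumE; apply: eq_bigr => i _; rewrite fct_sumE.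
have hs (a b : 'rV[R]_e) : 'D_('D_w f z) (fun y => h y a b) (f z) =
    \sum_(i < e) \sum_(j < e) a 0 i * b 0 j * 'D_w (t i j \o f) z.
  have -> : (fun y => h y a b) = \sum_(i < e) \sum_(j < e) ((a 0 i * b 0 j) *: (t i j : 'rV[R]_e -> R^o)).
    by apply: boolp.funext => y; rewrite hE fct_sumE; apply: eq_bigr => i _; rewrite fct_sumE.
  rewrite derive_sum => [|i]; last by apply: derivable_sum => j; apply/derivableZ/diff_derivable.
  apply: eq_bigr => i _; rewrite derive_sum => [|j]; last exact/derivableZ/diff_derivable.
  apply: eq_bigr => j _; rewrite deriveZ; last exact: diff_derivable.
  congr (_ * _); rewrite (deriveE _ (dtf i j)) diff_comp// (deriveE _ df) (deriveE _ (tE i j)).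
  by [].
rewrite hs (hE _ ('D_w A z)) (hE _ (A z) ('D_w B z)) -!big_split /=.
rewrite derive_sum => [|i]; last by apply: derivable_sum => j; exact: diff_derivable.
apply: eq_bigr => i _; rewrite -!big_split /= derive_sum => [|j]; last exact: diff_derivable.
apply: eq_bigr => j _.
have kAB : derivable (fun y => A y 0 i * B y 0 j : R^o) z w by apply: diff_derivable; exact: dAB.
have ktf : derivable (t i j \o f : _ -> R^o) z w by apply: diff_derivable; exact: dtf.
have kA : derivable (fun y => A y 0 i : R^o) z w by apply: diff_derivable; exact: dAi.
have kB : derivable (fun y => B y 0 j : R^o) z w by apply: diff_derivable; exact: dBj.
apply: (eq_trans (deriveM kAB ktf)).
rewrite (derive_mx_coord w 0 i dA) (derive_mx_coord w 0 j dB).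
have := deriveM kA kB; move: ('D_w _ z) => D0 E; rewrite {}E.
rewrite /GRing.scale /= -/(t i j (f z)).
move: ('D_w _ z) ('D_w _ z) ('D_w _ z) (A z 0 i) (B z 0 j) (t i j (f z)) => a b c p q r; ring.
Qed.

End RealTensor.

Section ComplexTensor.
Variables (f : 'rV[R]_d -> 'rV[R]_e) (h : 'rV[R]_e -> two_tensor R e).
Variables (U : set 'rV[R]_d) (U' : set 'rV[R]_e).
Hypotheses (oU : open U) (oU' : open U') (sU : forall z, U z -> U' (f z)).
Hypotheses (smf : smooth_on U f) (alth : forall z, alternating2 (h z)).
Hypothesis smh : forall u v, csmooth_on U' (fun z => h z u v).

Let reE z u v : complex.Re (h z u v) =
  \sum_(i < e) \sum_(j < e) u 0 i * v 0 j * complex.Re (h z (delta_mx 0 i) (delta_mx 0 j)).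
Proof.
rewrite (alt_expand _ _ (alth z)) Re_sum; apply: eq_bigr => i _; rewrite Re_sum.
by apply: eq_bigr => j _; rewrite ReM /= mul0r subr0.
Qed.

Let imE z u v : complex.Im (h z u v) =
  \sum_(i < e) \sum_(j < e) u 0 i * v 0 j * complex.Im (h z (delta_mx 0 i) (delta_mx 0 j)).
Proof.
rewrite (alt_expand _ _ (alth z)) Im_sum; apply: eq_bigr => i _; rewrite Im_sum.
by apply: eq_bigr => j _; rewrite ImM /= mul0r addr0.
Qed.

Lemma csmooth_pullback u v :
  csmooth_on U (fun z => h (f z) (u *m 'J f z) (v *m 'J f z)).
Proof.
have CJ k (w : 'rV[R]_d) : class_C k U (fun z => w *m 'J f z).
  exact: class_C_mulmx oU (class_C_cst _ _ _) (class_C_jacobian oU (smf k.+1)).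
split=> k.
  have := @class_C_tensor f _ _ (fun z u v => complex.Re (h z u v)) reE k U U' oU oU' sU (smf k) (CJ k u) (CJ k v).
  by apply=> a b; exact: (smh a b).1.
have := @class_C_tensor f _ _ (fun z u v => complex.Im (h z u v)) imE k U U' oU oU' sU (smf k) (CJ k u) (CJ k v).
by apply=> a b; exact: (smh a b).2.
Qed.

(** Leibniz rule: the moving arguments [v *m 'J f] and [w *m 'J f] are the derivatives of [f] along
    v and w, so differentiating them produces second derivatives of [f]. *)
Lemma cderive_pullback u v w z : U z ->
  cderive (fun y => h (f y) (v *m 'J f y) (w *m 'J f y)) u z =
  h (f z) ('D_u ('D_v f) z) (w *m 'J f z) + h (f z) (v *m 'J f z) ('D_u ('D_w f) z) +
  cderive (fun y => h y (v *m 'J f z) (w *m 'J f z)) (u *m 'J f z) (f z).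
Proof.
move=> Uz.
have nU : nbhs z U by exact: open_nbhs_nbhs.
have df y : U y -> differentiable f y by exact: (smf 1%N).1.
have E (a : 'rV[R]_d) : \forall y \near z, 'D_a f y = a *m 'J f y.
  by apply: filterS nU => y Uy; rewrite deriveE ?diffEjacobian//; exact: df.
have dJ (a : 'rV[R]_d) : differentiable (fun y => a *m 'J f y) z.
  apply: differentiable_near_eq (E a) _.
  exact: ((smf 2%N).2 a).1.
have DJ (a : 'rV[R]_d) : 'D_u (fun y => a *m 'J f y) z = 'D_u ('D_a f) z.
  by apply/esym/near_eq_derive; exact: E.
have Dz : 'D_u f z = u *m 'J f z by exact: nbhs_singleton (E u).
rewrite /cderive.
have -> := @derive_tensor f _ _ (fun z u v => complex.Re (h z u v)) reE z u (df _ Uz) (dJ v) (dJ w) _; last first.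
  by move=> a b; exact: ((smh a b).1 1%N).1 _ (sU Uz).
have -> := @derive_tensor f _ _ (fun z u v => complex.Im (h z u v)) imE z u (df _ Uz) (dJ v) (dJ w) _; last first.
  by move=> a b; exact: ((smh a b).2 1%N).1 _ (sU Uz).
rewrite !DJ Dz; apply: complexP; by rewrite !ReImE.
Qed.

Lemma derive_comm_rV u v z : U z -> 'D_u ('D_v f) z = 'D_v ('D_u f) z.
Proof.
move=> Uz; apply/rowP => j.
have nU : nbhs z U by exact: open_nbhs_nbhs.
have D2 a : differentiable ('D_a f) z by exact: ((smf 2%N).2 a).1.
have E a : \forall y \near z, ('D_a f y) 0 j = 'D_a (fun y => f y 0 j : R^o) y.
  by apply: filterS nU => y Uy; rewrite (derive_mx_coord a 0 j ((smf 1%N).1 y Uy)).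
apply: (eq_trans (derive_mx_coord u 0 j (D2 v))).
apply: (eq_trans _ (esym (derive_mx_coord v 0 j (D2 u)))).
apply: (eq_trans (near_eq_derive u (E v))).
apply: (eq_trans _ (esym (near_eq_derive v (E u)))).
apply: derive_comm oU Uz _.
by have /(class_C_mxP _ _ oU) := smf 2%N; exact.
Qed.

(** In the intended use the equal pairs are mixed second derivatives of [f] taken in both orders,
    and the [c] terms form the exterior derivative on the target. *)
Lemma cyclic_cancel (a : two_tensor R e) x1 x2 y1 y2 t1 t2 u v w c1 c2 c3 : alternating2 a ->
  x1 = x2 -> y1 = y2 -> t1 = t2 -> c1 - c2 + c3 = 0 ->
  a x1 w + a v y1 + c1 - (a x2 w + a u t1 + c2) + (a y2 v + a u t2 + c3) = 0.
Proof.
move=> alt -> -> -> H; rewrite (alt_anti y2 v alt).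
by rewrite -[RHS]H; move: (a x2 w) (a y2 v) (a u t2) => p q r; ring.
Qed.

Lemma closed_pullback z u v w : U z ->
  (forall u v w, cderive (fun y => h y v w) u (f z) - cderive (fun y => h y u w) v (f z)
    + cderive (fun y => h y u v) w (f z) = 0) ->
  cderive (fun y => h (f y) (v *m 'J f y) (w *m 'J f y)) u z
  - cderive (fun y => h (f y) (u *m 'J f y) (w *m 'J f y)) v z
  + cderive (fun y => h (f y) (u *m 'J f y) (v *m 'J f y)) w z = 0.
Proof.
move=> Uz closed; rewrite !cderive_pullback//.
have := closed (u *m 'J f z) (v *m 'J f z) (w *m 'J f z).
exact: (cyclic_cancel _ _ _ (alth _) (derive_comm_rV u v Uz) (derive_comm_rV u w Uz) (derive_comm_rV v w Uz)).
Qed.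

End ComplexTensor.

End TensorCalculus.

(** * Complex matrices as real matrices commuting with J *)

Section Realification.
Context {R : realType}.
Local Notation C := (R[i]).

Definition realify N m (M : 'M[C]_(N, m)) : 'M[R]_(N + N, m + m) :=
  block_mx (map_mx (@complex.Re R) M) (map_mx (@complex.Im R) M)
           (- map_mx (@complex.Im R) M) (map_mx (@complex.Re R) M).

(** The upper blocks suffice: commutation with the complex structures determines the lower ones
    ([complexify_blocks]). *)
Definition complexify N m (P : 'M[R]_(N + N, m + m)) : 'M[C]_(N, m) :=
  \matrix_(i, j) (ulsubmx P i j +i* ursubmx P i j).

Lemma ccoord_row_mx N (x y : 'rV[R]_N) : ccoord (row_mx x y) = \row_j (x 0 j +i* y 0 j).
Proof. by apply/rowP => j; rewrite /ccoord [LHS]mxE row_mxEl row_mxEr [RHS]mxE. Qed.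

Lemma ccoord_realify N m u (M : 'M[C]_(N, m)) : ccoord (u *m realify M) = ccoord u *m M.
Proof.
rewrite -{1}(hsubmxK u) /realify mul_row_block ccoord_row_mx; apply/rowP => j.
rewrite !mxE; apply: complexP; rewrite /= ?Re_sum ?Im_sum -big_split /=; apply: eq_bigr => i _;
  rewrite !mxE; case: (M i j) => p q /=; ring.
Qed.

Lemma complexify_blocks N m (P : 'M[R]_(N + N, m + m)) : stdJ R N *m P = P *m stdJ R m ->
  P = realify (complexify P).
Proof.
rewrite -(submxK P) /stdJ !mulmx_block !mulmx0 !mul0mx !mulNmx !mul1mx !mulmx1 !mulmxN !mulmx1.
rewrite !add0r !addr0 => /eq_block_mx[-> -> _ _]; rewrite /realify.
set a := ulsubmx P; set b := ursubmx P.
have -> : map_mx (@complex.Re R) (complexify (block_mx a b (- b) a)) = a.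
  by apply/matrixP => i j; rewrite mxE [complexify _ i j]mxE /= block_mxKul.
have -> // : map_mx (@complex.Im R) (complexify (block_mx a b (- b) a)) = b.
by apply/matrixP => i j; rewrite mxE [complexify _ i j]mxE /= block_mxKur.
Qed.

Lemma ccoord_complexify N m u (P : 'M[R]_(N + N, m + m)) : stdJ R N *m P = P *m stdJ R m ->
  ccoord (u *m P) = ccoord u *m complexify P.
Proof. by move=> /complexify_blocks {1}->; exact: ccoord_realify. Qed.

Lemma ccoord_inj N : injective (@ccoord R N).
Proof. exact: can_inj (@ccoordK R N). Qed.

Lemma ccoord0 N : ccoord (0 : 'rV[R]_(N + N)) = 0.
Proof. by rewrite -[0 in LHS](scale0r 0) ccoordZ scale0r. Qed.

Lemma ccoord_eq0 N (u : 'rV[R]_(N + N)) : ccoord u = 0 -> u = 0.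
Proof. by rewrite -[RHS]ccoord0 => /ccoord_inj. Qed.

Lemma realify_comm N m (M : 'M[C]_(N, m)) : stdJ R N *m realify M = realify M *m stdJ R m.
Proof.
apply/row_matrixP => i; rewrite !rowE; apply: ccoord_inj.
by rewrite !mulmxA ccoordJ !ccoord_realify ccoordJ scalemxAl.
Qed.

(* Reversal of the coordinates: [slice] kills the last coordinates, Gaussian
   elimination produces the first ones. *)
Definition rev_mx N : 'M[C]_N := \matrix_(i, j) (j == rev_ord i)%:R.

Lemma mul_rev_mx N m (M : 'M[C]_(m, N)) i j : (M *m rev_mx N) i j = M i (rev_ord j).
Proof.
rewrite mxE (bigD1 (rev_ord j))//= big1 ?addr0 => [|k kj]; first by rewrite mxE rev_ordK eqxx mulr1.
by rewrite mxE -(inj_eq rev_ord_inj) rev_ordK eq_sym (negbTE kj) mulr0.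
Qed.

Lemma rev_mxK N m (M : 'M[C]_(m, N)) : M *m rev_mx N *m rev_mx N = M.
Proof. by apply/matrixP => i j; rewrite !mul_rev_mx rev_ordK. Qed.

Lemma mul_pid_mxE N m r (M : 'M[C]_(m, N)) i j : (M *m (pid_mx r : 'M[C]_N)) i j = M i j *+ (j < r).
Proof.
rewrite mxE (bigD1 j)//= big1 ?addr0 => [|k kj]; first by rewrite mxE eqxx /= mulr_natr.
by rewrite [pid_mx _ _ _]mxE val_eqE (negbTE kj) mulr0.
Qed.

Lemma sliceE N r (w : 'rV[R]_(N + N)) : (r <= N)%N ->
  slice N (N - r) w <-> ccoord w *m rev_mx N *m (pid_mx r : 'M[C]_N) = 0.
Proof.
move=> rN; split=> [H|H j jr].
  apply/rowP => j; rewrite mul_pid_mxE mul_rev_mx [RHS]mxE.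
  have [jr|//] := boolP (j < r)%N.
  have [|w1 w2] := H (rev_ord j); first by rewrite leq_sub2l.
  by rewrite mxE w1 w2.
have /rowP /(_ (rev_ord j)) := H; rewrite mul_pid_mxE mul_rev_mx rev_ordK !mxE.
have -> : (rev_ord j < r)%N by have := ltn_ord j; rewrite /=; lia.
by move=> -[].
Qed.

Lemma sliceJ N k (w : 'rV[R]_(N + N)) : slice N k w -> slice N k (w *m stdJ R N).
Proof.
move=> H j /H[w1 w2].
have : ccoord (w *m stdJ R N) 0 j = 0 by rewrite ccoordJ !mxE w1 w2 mulr0.
by rewrite mxE => -[].
Qed.

End Realification.

(** * The holomorphic constant rank theorem *)

Section ConstantRank.
Context {R : realType}.
Local Notation C := (R[i]).

Lemma diff_stdJ_jacobian N m (f : 'rV[R]_(N + N) -> 'rV[R]_(m + m)) z :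
  (forall u, 'd f z (u *m stdJ R N) = 'd f z u *m stdJ R m) <->
  stdJ R N *m 'J f z = 'J f z *m stdJ R m.
Proof.
split=> [H|E u]; last by rewrite !diffEjacobian -!mulmxA E.
by apply/row_matrixP => i; rewrite !rowE !mulmxA -!diffEjacobian H.
Qed.

Lemma holomorphic_jacobian N m U (f : 'rV[R]_(N + N) -> 'rV[R]_(m + m)) z :
  holomorphic_on U f -> U z -> stdJ R N *m 'J f z = 'J f z *m stdJ R m.
Proof. by move=> [_ H] Uz; apply/diff_stdJ_jacobian => u; exact: H. Qed.

Lemma comm_invmx N (P : 'M[R]_(N + N)) : P \in unitmx ->
  stdJ R N *m P = P *m stdJ R N -> stdJ R N *m invmx P = invmx P *m stdJ R N.
Proof.
by move=> uP E; rewrite -[LHS](mulKmx uP) [P *m _]mulmxA -E mulmxK.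
Qed.

(** The kernel of [A] is contained in that of [A *m B], and the rank hypothesis makes their
    dimensions equal. *)
Lemma kermx_mul_rank m n p (A : 'M[C]_(m, n)) (B : 'M[C]_(n, p)) (v : 'rV[C]_m) :
  (\rank A <= \rank (A *m B))%N -> v *m (A *m B) = 0 -> v *m A = 0.
Proof.
move=> rk /sub_kermxP vAB; apply/sub_kermxP; apply: submx_trans vAB _.
have s : (kermx A <= kermx (A *m B))%MS by apply/sub_kermxP; rewrite mulmxA mulmx_ker mul0mx.
by rewrite -(mxrank_leqif_sup s) !mxrank_ker eqn_leq leq_sub2l ?mxrankM_maxl// leq_sub2l.
Qed.

Section Straightening.
Variables (N m : nat) (U : set 'rV[R]_(N + N)) (F : 'rV[R]_(N + N) -> 'rV[R]_(m + m)) (z1 : 'rV[R]_(N + N)).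
Hypotheses (oU : open U) (Uz1 : U z1) (hF : holomorphic_on U F).

Let D z := complexify ('J F z).
Let r := \rank (D z1).
Hypothesis maxrank : forall z, U z -> (\rank (D z) <= r)%N.

Let rN : (r <= N)%N. Proof. exact: rank_leq_row. Qed.

Let L := col_ebase (D z1).
Let E := row_ebase (D z1).
(** From D z1 = L pid_r E: [Q] selects r independent components of [F], [S] completes them by N - r
    linear coordinates, and [rev_mx] moves the components of [F] to the end, where [slice] asks for
    zeros. The differential of [Phi] at [z1] is then the invertible [L *m rev_mx N]. *)
Let Q : 'M[C]_(m, N) := invmx E *m pid_mx r *m rev_mx N.
Let S : 'M[C]_N := L *m copid_mx r *m rev_mx N.
Let Phi (z : 'rV[R]_(N + N)) := F z *m realify Q + z *m realify S - (F z1 *m realify Q + z1 *m realify S).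
Let T z := D z *m Q + S.

Let uL : L \in unitmx. Proof. exact: col_ebase_unit. Qed.
Let uE : E \in unitmx. Proof. exact: row_ebase_unit. Qed.

Let T1 : T z1 = L *m rev_mx N.
Proof.
rewrite /T /Q /S -(mulmx_ebase (D z1)) -/r -/L -/E !mulmxA mulmxK// -[L *m _ *m pid_mx r]mulmxA.
rewrite mul_pid_mx !minnn (minn_idPr _) ?rank_leq_col// -mulmxDl -mulmxDr.
by rewrite /copid_mx addrC subrK mulmx1.
Qed.

Let Trev z : T z *m rev_mx N *m (pid_mx r : 'M[C]_N) = D z *m (invmx E *m (pid_mx r : 'M[C]_(m, N))).
Proof.
rewrite /T /Q /S !mulmxDl !mulmxA !rev_mxK -[_ *m copid_mx r *m _]mulmxA mul_copid_mx_pid//.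
rewrite mulmx0 addr0 -[_ *m pid_mx r *m pid_mx r]mulmxA mul_pid_mx.
by rewrite minnn (minn_idPr _) ?rank_leq_row.
Qed.

Let dF z : U z -> differentiable F z.
Proof. by move=> Uz; exact: (hF.1 1%N).1. Qed.

Let JPhi z : U z -> 'J Phi z = 'J F z *m realify Q + realify S.
Proof.
move=> /dF/differentiableP dz; apply/row_matrixP => i; rewrite !rowE -diffEjacobian.
have d1 := is_diff_comp dz (is_diff_mulmxr (realify Q) (F z)).
have d2 := is_diffB (is_diffD d1 (is_diff_mulmxr (realify S) z)) (is_diff_cst (F z1 *m realify Q + z1 *m realify S) z).
rewrite (@diff_val _ _ _ _ _ _ _ d2) !fctE subr0 mulmxDr mulmxA /= diffEjacobian.
by [].
Qed.

Let ccoord_JPhi z u : U z -> ccoord (u *m 'J Phi z) = ccoord u *m T z.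
Proof.
move=> Uz; rewrite JPhi// mulmxDr ccoordD mulmxA !ccoord_realify ccoord_complexify.
  by rewrite mulmxDr mulmxA.
exact: holomorphic_jacobian hF Uz.
Qed.

Let smooth_Phi : smooth_on U Phi.
Proof.
move=> k; have C1 := class_C_mulmx oU (hF.1 k) (@class_C_cst _ _ _ k U (realify Q)).
have C2 := class_C_add oU C1 (@class_C_mulmxr _ _ _ k U (realify S)).
exact: class_C_add oU C2 (@class_C_cst _ _ _ k U (- (F z1 *m realify Q + z1 *m realify S))).
Qed.

Let JPhi1_unit : 'J Phi z1 \in unitmx.
Proof.
apply: row_free_eq0 => u /(congr1 (@ccoord R N)); rewrite ccoord_JPhi// T1 ccoord0 => u0.
apply: ccoord_eq0; rewrite -[LHS](mulmxK uL) -[ccoord u *m L]rev_mxK -[ccoord u *m L *m _]mulmxA u0.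
by rewrite !mul0mx.
Qed.

Let Phi1 : Phi z1 = 0. Proof. by rewrite /Phi subrr. Qed.

Let Phi_comm z : U z -> stdJ R N *m 'J Phi z = 'J Phi z *m stdJ R N.
Proof.
move=> Uz; rewrite JPhi// mulmxDr mulmxDl realify_comm mulmxA (holomorphic_jacobian hF Uz).
by rewrite -!mulmxA realify_comm.
Qed.

(** Where [Phi] has invertible differential, its components coming from [F] have rank r. As [D z]
    has rank at most r, selecting these components loses nothing, and the kernels agree. *)
Let slice_ker z u : U z -> 'J Phi z \in unitmx ->
  slice N (N - r) (u *m 'J Phi z) <-> u *m 'J F z = 0.
Proof.
move=> Uz uz; have cF := ccoord_complexify u (holomorphic_jacobian hF Uz).
rewrite sliceE// ccoord_JPhi// -2!mulmxA [T z *m _]mulmxA Trev; split=> [u0|uF]; last first.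
  by rewrite mulmxA -cF uF ccoord0 mul0mx.
apply: ccoord_eq0; rewrite cF; apply: kermx_mul_rank u0.
apply: leq_trans (maxrank Uz) _; rewrite -Trev.
have uT : T z \in unitmx.
  apply: row_free_eq0 => v vT; rewrite -[v]of_ccoordK -[0](ccoord0 N); congr ccoord.
  rewrite -[LHS](mulmxK uz) (_ : _ *m 'J Phi z = 0) ?mul0mx//.
  by apply: ccoord_eq0; rewrite ccoord_JPhi// of_ccoordK.
have uV : (rev_mx N : 'M[C]_N) \in unitmx.
  by apply: row_free_eq0 => v v0; rewrite -[v]rev_mxK v0 mul0mx.
by rewrite eqmxMfull ?row_full_unit ?unitmx_mul ?uT// rank_pid_mx.
Qed.

(* On the segment from 0 to a point of the slice, [F \o g] is constant since the
   rank of ['J F] cannot exceed the rank of its first [r] coordinates. *)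
Lemma straighten : exists A Psi g,
  [/\ open A, A z1, A `<=` U & holomorphic_on A Psi] /\
  [/\ open (Psi @` A), holomorphic_on (Psi @` A) g & forall z, A z -> g (Psi z) = z] /\
  [/\ forall z, A z -> F z = F z1 <-> slice N (N - r) (Psi z) &
      forall u, u *m 'J F z1 = 0 -> slice N (N - r) (u *m 'J Psi z1)].
Proof.
have [A0 [g [[[oA0 A0z1] A0U oB0 gK0] [sg0 J0]]]] := inverse_function oU Uz1 smooth_Phi JPhi1_unit.
(* Restricting to the preimage of a ball centred at [Phi z1 = 0] makes the image convex, so the
   segment from 0 to a point of the image stays in it. *)
have [e /= e0 eP] : nbhs_ball (0 : 'rV[R]_(N + N)) (Phi @` A0).
  by apply/nbhs_ballP; apply: open_nbhs_nbhs; split=> //; exists z1.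
pose A := A0 `&` Phi @^-1` ball 0 e.
have BA w : ball 0 e w -> exists2 z, A z & Phi z = w.
  by move=> we; have [z A0z zw] := eP _ we; exists z => //; split=> //=; rewrite zw.
have PA : Phi @` A = ball 0 e.
  by apply/seteqP; split=> [_ [z [_ zA] <-]|w /BA[z zA <-]] //; exists z.
have AU : A `<=` U by move=> z [/A0U].
have oA : open A.
  rewrite openE => z [A0z ze]; apply: filterI; first exact: open_nbhs_nbhs.
  have /(_ z (A0U z A0z)) := smooth_Phi 0; apply.
  by apply: open_nbhs_nbhs; split=> //; exact: ball_open.
exists A, Phi, g; split; [split=> // | split; [split=> // | split=> //]].
- by have P1 : ball 0 e (Phi z1) by rewrite Phi1; exact: ballxx.
- split=> [k|z u Az]; first exact: class_C_sub (smooth_Phi k).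
  by have /diff_stdJ_jacobian := Phi_comm (AU _ Az); exact.
- by rewrite PA; exact: ball_open.
- split=> [k|_ u [z Az <-]]; first by apply: class_C_sub (sg0 k) => _ [z [A0z _] <-]; exists z.
  have [uz Jg] := J0 _ Az.1; have cz := Phi_comm (AU _ Az); have := comm_invmx uz cz.
  by rewrite -Jg => /diff_stdJ_jacobian; exact.
- by move=> z [/gK0].
- move=> z Az; split=> [Fz|sl].
    apply/sliceE => //; rewrite /Phi Fz opprD addrACA subrr add0r -mulmxBl ccoord_realify /S.
    by rewrite mulmxA rev_mxK -2!mulmxA mul_copid_mx_pid// !mulmx0.
  apply/rowP => j; pose w := Phi z.
  have inB t : 0 <= t <= 1 -> ball 0 e (0 + t *: w).
    by move=> tI; have := @ball_segment _ _ 0 0 w e t (ballxx _ e0) Az.2 tI; rewrite subr0.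
  have dg y : A y -> differentiable g (Phi y).
    by move=> Ay; apply: (sg0 1%N).1; exists y => //; exact: Ay.1.
  have dFg y : A y -> differentiable (F \o g) (Phi y).
    by move=> Ay; apply: differentiable_comp; [exact: dg|rewrite (gK0 _ Ay.1); exact/dF/AU].
  have [t|t tI] := @mean_value R _ (fun y => (F (g y)) 0 j : R^o) 0 w.
    by move=> /inB /BA[y Ay <-]; have /differentiable_mxP := dFg y Ay; exact.
  have [y Ay yE] := BA _ (inB t tI); rewrite -yE.
  have dj : differentiable (fun y => (F (g y)) 0 j : R^o) (Phi y).
    by have /differentiable_mxP := dFg y Ay; exact.
  rewrite -(deriveE _ dj) -(derive_mx_coord w 0 j (dFg y Ay)) deriveE; last exact: dFg.
  rewrite diff_comp; [|exact: dg|rewrite (gK0 _ Ay.1); exact/dF/AU].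
  rewrite /= (gK0 _ Ay.1) !diffEjacobian.
  have [uy Jg] := J0 _ Ay.1; rewrite Jg.
  have [+ _] := @slice_ker y (w *m invmx ('J Phi y)) (AU _ Ay) uy.
  rewrite mulmxKV// => -> //; rewrite mxE add0r (gK0 _ Az.1) (_ : g 0 = z1); last by rewrite -Phi1 gK0.
  by move/eqP; rewrite subr_eq0 => /eqP.
- by move=> u u0; apply/slice_ker.
Qed.

End Straightening.

End ConstantRank.

(** * Charts adapted to the fibres *)

Section HolomorphicCharts.
Context {R : realType}.

Lemma holomorphic_sub N m U U' (f : 'rV[R]_(N + N) -> 'rV[R]_(m + m)) :
  U' `<=` U -> holomorphic_on U f -> holomorphic_on U' f.
Proof.
move=> s [sf hf]; split=> [k|z u /s]; last exact: hf.
exact: class_C_sub (sf k).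
Qed.

Lemma holomorphic_comp N m p U U' (f : 'rV[R]_(N + N) -> 'rV[R]_(m + m))
    (g : 'rV[R]_(m + m) -> 'rV[R]_(p + p)) (h : 'rV[R]_(N + N) -> 'rV[R]_(p + p)) :
  open U -> open U' -> (forall z, U z -> U' (f z)) -> (forall z, U z -> g (f z) = h z) ->
  holomorphic_on U f -> holomorphic_on U' g -> holomorphic_on U h.
Proof.
move=> oU oU' sU E [sf hf] [sg hg]; split=> [k|z u Uz].
  have := class_C_comp_mx oU oU' sU (sf k) (sg k); exact: class_C_ext.
have df : differentiable f z by exact: (sf 1%N).1.
have dg : differentiable g (f z) by apply: (sg 1%N).1; exact: sU.
have Ez : \forall y \near z, (g \o f) y = h y.
  have : nbhs z U by exact: open_nbhs_nbhs.
  by apply: filterS => y; exact: E.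
have dgf : differentiable (g \o f) z by exact: differentiable_comp.
have D v : 'd h z v = 'd g (f z) ('d f z v).
  by apply: (eq_trans (diff_near_eq v Ez dgf)); rewrite diff_comp.
by rewrite !D hf// hg//; exact: sU.
Qed.

Section SubChart.
Variables (N : nat) (X : complexManifold R N) (c : chart R (N + N) X).
Variables (A : set 'rV[R]_(N + N)) (Psi g : 'rV[R]_(N + N) -> 'rV[R]_(N + N)).
Hypotheses (cX : atlas X c) (oA : open A) (AU : A `<=` cimg c) (hPsi : holomorphic_on A Psi).
Hypotheses (oPA : open (Psi @` A)) (hg : holomorphic_on (Psi @` A) g) (gK : forall z, A z -> g (Psi z) = z).

Definition recoord : chart R (N + N) X :=
  Chart (cdom c `&` cmap c @^-1` A) (Psi \o cmap c) (cinv c \o g).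

Let ac : chart_axiom c. Proof. exact: atlas_chart. Qed.

Lemma cimg_recoord : cimg recoord = Psi @` A.
Proof.
apply/seteqP; split=> [_ [x [xc xA] <-]|_ [z Az <-]]; first by exists (cmap c x).
exists (cinv c z) => /=; last by rewrite cinvK//; exact: AU.
by split; [apply: cimg_cdom => //; exact: AU|rewrite /= cinvK//; exact: AU].
Qed.

Lemma recoord_axiom : chart_axiom recoord.
Proof.
have [oc _ cK cc ci] := ac.
split.
- rewrite openE => x [xc xA]; apply: filterI; first exact: open_nbhs_nbhs.
  by apply: (cc x xc); exact: open_nbhs_nbhs.
- by rewrite cimg_recoord.
- by move=> x [xc xA] /=; rewrite gK// cK.
- move=> x [xc xA]; apply: (@continuous_comp _ _ _ (cmap c) Psi); first exact: cc.
  exact: (hPsi.1 0%N).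
- rewrite cimg_recoord => z Az; apply: (@continuous_comp _ _ _ g (cinv c)); first exact: (hg.1 0%N).
  by apply: ci; case: Az => y Ay <-; rewrite gK//; exact: AU.
Qed.

Lemma recoord_holomorphic : holomorphic_chart recoord.
Proof.
have a1 := recoord_axiom; split=> // c0 c0X; have ac0 := atlas_chart c0X.
have oov (c1 c2 : chart R (N + N) X) : chart_axiom c1 -> chart_axiom c2 -> open (overlap c1 c2).
  by move=> b1 [q2 _ _ _ _]; rewrite overlapE//; exact: open_cinv_preimage.
split.
  apply: (@holomorphic_comp _ _ _ _ (overlap c c0) g (transition c c0)) ; do ?[exact: oov | by []].
  - move=> z; rewrite !overlapE// cimg_recoord => -[[y Ay <-]] /=.
    by rewrite gK// => yc0; split=> //; exact: AU.
  - by apply: holomorphic_sub hg; rewrite overlapE// cimg_recoord => z [].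
  - exact: (atlas_holomorphic cX c0X).
apply: (@holomorphic_comp _ _ _ _ A (transition c0 c) Psi) ; do ?[exact: oov | by []].
- by move=> z; rewrite overlapE// => -[_ []].
- apply: holomorphic_sub (atlas_holomorphic c0X cX); rewrite !overlapE// => z [zi [zc _]].
  by split.
Qed.

Lemma transD_recoord x : cdom recoord x -> transD c recoord x = 'J Psi (cmap c x).
Proof.
move=> [xc xA].
have dP : differentiable Psi (cmap c x) by exact: (hPsi.1 1%N).1.
have E : \forall z \near cmap c x, Psi z = rep id c recoord z.
  have : nbhs (cmap c x) A by exact: open_nbhs_nbhs.
  by apply: filterS => z Az; rewrite /rep /= cinvK//; exact: AU.
apply/row_matrixP => i; rewrite [LHS]rowE [RHS]rowE.
apply: (eq_trans (esym (diffEjacobian _ _ _))); apply: (eq_trans _ (diffEjacobian _ _ _)).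
exact: diff_near_eq E dP.
Qed.

End SubChart.

Section Representative.
Variables (N m : nat) (X : complexManifold R N) (B : complexManifold R m) (pi : X -> B).
Hypothesis hpi : holomorphic_map (std_complex X) (std_complex B) pi.

Lemma transD_comm (M : nat) (Y : complexManifold R M) (c c' : chart R (M + M) Y) x :
  atlas Y c -> atlas Y c' -> cdom c x -> cdom c' x ->
  stdJ R M *m transD c c' x = transD c c' x *m stdJ R M.
Proof.
move=> cY c'Y xc xc'; have h := atlas_holomorphic cY c'Y.
by apply: (holomorphic_jacobian h); exists x.
Qed.

Lemma repD_comm c c' x : atlas X c -> atlas B c' -> cdom c x -> cdom c' (pi x) ->
  stdJ R N *m repD pi c c' x = repD pi c c' x *m stdJ R m.
Proof.
move=> cX c'B xc xc'; have [sf hf] := hpi.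
have sc := atlas_smooth_chart cX; have sc' := atlas_smooth_chart c'B.
rewrite (repD_transl sf sc (smooth_chart_at x) sc')//; last exact: chart_at_dom.
rewrite (repD_transr sf (smooth_chart_at x) (smooth_chart_at (pi x)) sc')//; try exact: chart_at_dom.
set P := repD pi _ _ x.
have PJ : stdJ R N *m P = P *m stdJ R m.
  by apply/row_matrixP => i; rewrite !rowE !mulmxA -!mdiffE; exact: hf.
rewrite mulmxA transD_comm//; try exact: chart_at_dom; try exact: chart_at_atlas.
rewrite -!mulmxA [stdJ R N *m _]mulmxA PJ -!mulmxA transD_comm//; try exact: chart_at_dom; try exact: chart_at_atlas.
Qed.

Lemma rep_holomorphic c c' : atlas X c -> atlas B c' -> holomorphic_on (repdom pi c c') (rep pi c c').
Proof.
move=> cX c'B; have ac := atlas_chart cX; split.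
  by apply: smooth_rep hpi.1 _ _; exact: atlas_smooth_chart.
move=> z u [zi zd]; have := repD_comm cX c'B (cimg_cdom ac zi) zd.
by rewrite /repD cinvK// => /diff_stdJ_jacobian; exact.
Qed.

(** [straighten] turns the level set of the representative into a slice. Injectivity of [cmap c'] on
    its domain identifies this level set with the fibre, and the kernel of the differential goes
    into the slice. *)
Lemma adapted_chart_max_rank c c' z U : atlas X c -> atlas B c' -> open U -> U z -> U `<=` repdom pi c c' ->
  (forall y, U y -> (\rank (complexify ('J (rep pi c c') y)) <= \rank (complexify ('J (rep pi c c') z)))%N) ->
  let k := (N - \rank (complexify ('J (rep pi c c') z)))%N in
  exists c1, adapted_chart (fiber pi (pi (cinv c z))) k (cinv c z) c1 /\
    forall u, u *m 'J (rep pi c c') z = 0 -> slice N k (to_chart c1 (cinv c z) (of_chart c (cinv c z) u)).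
Proof.
move=> cX c'B oU Uz Us rk k; have ac := atlas_chart cX; have ac' := atlas_chart c'B.
have hF := holomorphic_sub Us (rep_holomorphic cX c'B).
have [A [Psi [g [[oA Az AU hPsi] [[oPA hg gK] [fib ker]]]]]] := straighten oU Uz hF rk.
have AR : A `<=` repdom pi c c' by move=> y /AU /Us.
have Ai : A `<=` cimg c by move=> y /AR[].
set x := cinv c z.
have zi : cimg c z by exact: Ai.
have xc : cdom c x by exact: cimg_cdom.
have zE : cmap c x = z by rewrite cinvK.
have hc1 := recoord_holomorphic cX oA Ai hPsi oPA hg gK.
exists (recoord c A Psi g).
have x1 : cdom (recoord c A Psi g) x by split=> //=; rewrite zE.
split; first split=> //.
- exact: leq_subr.
- move=> y [yc yA]; rewrite -(fib _ yA) /fiber /= /rep cmapK// -/x.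
  split=> [->//|E]; have [_ zd] := AR _ Az; have [_ yd] := AR _ yA; rewrite cmapK// in yd.
  by rewrite -(cmapK ac' yd) E cmapK.
have sc := atlas_smooth_chart cX; have sc1 := holomorphic_smooth_chart hc1.
have JE : transD c (chart_at x) x *m transD (chart_at x) (recoord c A Psi g) x = 'J Psi z.
  rewrite -(transD_trans sc (smooth_chart_at x) sc1 xc (chart_at_dom x) x1).
  by rewrite (transD_recoord cX oA Ai hPsi x1) zE.
move=> u uF; rewrite of_chartE to_chartE -mulmxA JE; exact: ker.
Qed.

End Representative.

End HolomorphicCharts.

(** * Coisotropy of the kernel of d pi *)

Section Coisotropy.
Context {R : realType}.
Local Notation C := (R[i]).

Lemma rank_realify N m (M : 'M[C]_(N, m)) : \rank (realify M) = (\rank M + \rank M)%N.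
Proof.
have rM p q s (A : 'M[C]_(p, q)) (B : 'M[C]_(q, s)) : realify (A *m B) = realify A *m realify B.
  apply/row_matrixP => i; rewrite !rowE; apply: ccoord_inj.
  by rewrite [in RHS]mulmxA !ccoord_realify mulmxA.
have rU p (A : 'M[C]_p) : A \in unitmx -> realify A \in unitmx.
  move=> uA; apply: row_free_eq0 => u uA0; apply: ccoord_eq0; rewrite -[LHS](mulmxK uA).
  by rewrite -ccoord_realify uA0 ccoord0 mul0mx.
rewrite -{1}(mulmx_ebase M) !rM mxrankMfree ?row_free_unit ?rU ?row_ebase_unit//.
rewrite eqmxMfull ?row_full_unit ?rU ?col_ebase_unit//.
have -> : realify (pid_mx (\rank M) : 'M[C]_(N, m)) = block_mx (pid_mx (\rank M)) 0 0 (pid_mx (\rank M)).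
  rewrite /realify.
  have -> : map_mx (@complex.Im R) (pid_mx (\rank M) : 'M[C]_(N, m)) = 0.
    by apply/matrixP => i j; rewrite !mxE; case: (_ && _).
  have -> : map_mx (@complex.Re R) (pid_mx (\rank M) : 'M[C]_(N, m)) = pid_mx (\rank M).
    by apply/matrixP => i j; rewrite !mxE; case: (_ && _).
  by rewrite oppr0.
by rewrite rank_diag_block_mx !rank_pid_mx ?rank_leq_row ?rank_leq_col.
Qed.

(** The kernel [K] of [P] is isotropic of half the dimension, so it equals its orthogonal [kermx V].
    The columns of [invmx W *m P] are orthogonal to [K], hence lie in [K] and are killed by [P]. *)
Lemma lagrangian_kernel (F : fieldType) N m (W : 'M[F]_N) (P : 'M[F]_(N, m)) :
  W \in unitmx -> (\rank P + \rank P)%N = N ->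
  (forall u v : 'rV_N, u *m P = 0 -> v *m P = 0 -> u *m W *m v^T = 0) ->
  P^T *m invmx W *m P = 0.
Proof.
move=> uW rP iso; have [K KE] : exists K, K = kermx P by eexists.
pose V := (K *m W)^T.
have KP : K *m P = 0 by rewrite KE mulmx_ker.
have KWK : K *m W *m K^T = 0.
  apply/matrixP => i j; rewrite [RHS]mxE.
  have K0 (w : 'rV_N) : w *m K *m P = 0 by rewrite -mulmxA KP mulmx0.
  have /matrixP /(_ 0 0) := iso _ _ (K0 (delta_mx 0 i)) (K0 (delta_mx 0 j)).
  rewrite trmx_mul trmx_delta mulmxA -colE -[_ *m K *m W]mulmxA -rowE -row_mul.
  by rewrite [col _ _ _ _]mxE [row _ _ _ _]mxE => ->; rewrite mxE.
have KV : K *m V = 0 by rewrite /V -[X in X *m _]trmxK -trmx_mul KWK trmx0.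
have sK : (K <= kermx V)%MS by exact/sub_kermxP.
have rV : \rank V = \rank K by rewrite mxrank_tr mxrankMfree// row_free_unit.
have rK : \rank K = \rank P.
  have E p : (p + p)%N = N -> (N - p)%N = p by move=> <-; exact: addnK.
  by rewrite KE mxrank_ker E.
have sV : (kermx V <= K)%MS.
  by rewrite -(mxrank_leqif_sup sK) mxrank_ker rV rK -[X in (X - _)%N]rP addnK.
have YV : (invmx W *m P)^T *m V = 0.
  by rewrite -trmx_mul mulmxA mulmxK// KP trmx0.
have : (invmx W *m P)^T *m P = 0.
  by apply/sub_kermxP; rewrite -KE; apply: submx_trans sV; exact/sub_kermxP.
by move/(congr1 trmx); rewrite trmx_mul trmxK trmx0 mulmxA.
Qed.

Section InChart.
Context {d : nat} {M : smoothManifold R d}.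
Implicit Types (Psi : tensor_field M) (c : chart R d M).

Definition chart_tensor Psi c z : two_tensor R d := fun u v => in_chart Psi c u v z.

Lemma chart_tensorE Psi c z u v : chart_tensor Psi c z u v =
  Psi (cinv c z) (u *m transD c (chart_at (cinv c z)) (cinv c z)) (v *m transD c (chart_at (cinv c z)) (cinv c z)).
Proof. by rewrite /chart_tensor /in_chart !of_chartE. Qed.

Lemma alternating_chart Psi c z : (forall x, alternating2 (Psi x)) -> alternating2 (chart_tensor Psi c z).
Proof.
move=> alt; have := alternating2_map (transD c (chart_at (cinv c z)) (cinv c z)) (alt (cinv c z)).
by congr alternating2; apply: boolp.funext => u; apply: boolp.funext => v; rewrite chart_tensorE.
Qed.

Lemma nondegenerate_chart Psi c z : atlas M c -> cimg c z ->
  Defs.nondegenerate (Psi (cinv c z)) -> Defs.nondegenerate (chart_tensor Psi c z).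
Proof.
move=> cM zi nd u u0; set x := cinv c z in nd.
have ac := atlas_chart cM; have xc : cdom c x by exact: cimg_cdom.
have uT := transD_unit (atlas_smooth_chart cM) (smooth_chart_at x) xc (chart_at_dom x).
rewrite -[LHS](mulmxK uT) [X in X *m _]nd ?mul0mx// => v.
by have := u0 (v *m invmx (transD c (chart_at x) x)); rewrite chart_tensorE mulmxKV.
Qed.

Lemma class_C_re_mx Psi c k : two_form Psi -> atlas M c ->
  class_C k (cimg c) (fun z => re_mx (chart_tensor Psi c z)).
Proof.
move=> [_ sm] cM; have [_ oi _ _ _] := atlas_chart cM; apply/class_C_mxP => // i j.
have := (sm c (delta_mx 0 i) (delta_mx 0 j) cM).1 k.
by apply: class_C_ext => // z _; rewrite mxE.
Qed.

Lemma class_C_im_mx Psi c k : two_form Psi -> atlas M c ->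
  class_C k (cimg c) (fun z => im_mx (chart_tensor Psi c z)).
Proof.
move=> [_ sm] cM; have [_ oi _ _ _] := atlas_chart cM; apply/class_C_mxP => // i j.
have := (sm c (delta_mx 0 i) (delta_mx 0 j) cM).2 k.
by apply: class_C_ext => // z _; rewrite mxE.
Qed.

End InChart.

Lemma hodge20_chart N (X : complexManifold R N) (Psi : tensor_field X) c z : atlas X c -> cimg c z ->
  hodge20 (stdJ R N) (Psi (cinv c z)) -> hodge20 (stdJ R N) (chart_tensor Psi c z).
Proof.
move=> cX zi h20 u v; have xc : cdom c (cinv c z) by apply: cimg_cdom => //; exact: atlas_chart.
have TJ := transD_comm cX (chart_at_atlas (cinv c z)) xc (chart_at_dom (cinv c z)).
rewrite !chart_tensorE -![_ *m stdJ R N *m _]mulmxA TJ !mulmxA; exact: h20.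
Qed.

Lemma max_rank_point d (V : set 'rV[R]_d) (f : 'rV[R]_d -> nat) b z0 : V z0 ->
  (forall z, V z -> (f z <= b)%N) -> exists2 z, V z & forall y, V y -> (f y <= f z)%N.
Proof.
move=> Vz0 fb; pose P k := `[< exists2 z, V z & f z = k >].
have exP : exists k, P k by exists (f z0); apply/asboolP; exists z0.
have bP k : P k -> (k <= b)%N by move=> /asboolP[z Vz <-]; exact: fb.
have [k /asboolP[z Vz <-] mx] := ex_maxnP exP bP.
by exists z => // y Vy; apply: mx; apply/asboolP; exists y.
Qed.

Lemma open_nonzero d (U : set 'rV[R]_d) (f : 'rV[R]_d -> R^o) : open U -> class_C 0 U f ->
  open [set z | U z /\ f z != 0].
Proof.
move=> oU Cf; rewrite openE => z [Uz fz0]; apply: filterI; first exact: open_nbhs_nbhs.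
have /cvgrPdist_lt /(_ `|f z|) := Cf z Uz; rewrite normr_gt0 => /(_ fz0).
by apply: filterS => y; apply: contraTneq => ->; rewrite subr0 ltxx.
Qed.

Section LagrangianFibration.
Variables (n m : nat) (X : complexManifold R (2 * n)%N) (Omega : tensor_field X)
  (B : complexManifold R m) (pi : X -> B).
Hypotheses (HOmega : holomorphically_symplectic Omega) (Hpi : lagrangian_fibration Omega pi).

(* A point of maximal rank in an open set is a smooth point of its fibre, which
   is Lagrangian there; such points are dense, and the equation is closed. *)
Lemma fibration_coisotropic x : let P := repD pi (chart_at x) (chart_at (pi x)) x in
  P^T *m invmx (re_mx (Omega x)) *m P = 0.
Proof.
move=> P; have [[altO smO] _ h20O _ ndO] := HOmega; have [hpi _ _ lag] := Hpi.
have [c cX xc] : exists2 c : chart R _ X, atlas X c & c = chart_at x.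
  by exists (chart_at x) => //; exact: chart_at_atlas.
have [c' c'B xc'] : exists2 c : chart R _ B, atlas B c & c = chart_at (pi x).
  by exists (chart_at (pi x)) => //; exact: chart_at_atlas.
have ac := atlas_chart cX; have ac' := atlas_chart c'B.
pose W z := re_mx (chart_tensor Omega c z); pose F := rep pi c c'; pose U := repdom pi c c'.
have oU : open U by apply: open_repdom => //; case: hpi => -[].
(* The coisotropy equation in one fixed pair of charts, so that it varies continuously around
   [x]. *)
pose K z := ('J F z)^T *m invmx (W z) *m 'J F z.
have Wu z : cimg c z -> W z \in unitmx.
  move=> zi; apply: (@re_mx_unit _ _ _ (stdJ R (2 * n)%N)); first exact: alternating_chart.
    by apply: hodge20_chart => //; exact: h20O.
  exact: nondegenerate_chart.
suff K0 z : U z -> K z = 0.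
  have xd : cdom c x by rewrite xc; exact: chart_at_dom.
  have := K0 (cmap c x); rewrite /K /W /F /U.
  have -> : re_mx (chart_tensor Omega c (cmap c x)) = re_mx (Omega x).
    apply/matrixP => i j; rewrite !mxE chart_tensorE cmapK// -!xc.
    by rewrite transD_id ?mulmx1//; exact: atlas_smooth_chart.
  rewrite /P -xc -xc'; apply; apply: repdom_cmap => //; rewrite xc'; exact: chart_at_dom.
move=> Uz; apply/matrixP => i j; rewrite [RHS]mxE; apply/eqP; apply: contraT => Kz.
(* The open set where a given entry of the equation fails. A point of maximal rank chosen inside [V]
   itself gives the contradiction, in place of a density argument. *)
pose V := [set y | U y /\ (K y i j : R^o) != 0].
have CJ : class_C 0 U (fun y => 'J F y) by apply: class_C_jacobian => //; exact: (rep_holomorphic hpi cX c'B).1 1%N.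
have CT : class_C 0 U (fun y => ('J F y)^T).
  apply/(class_C_mxP _ _ oU) => a b; have /(class_C_mxP _ _ oU) /(_ b a) := CJ.
  by apply: (class_C_ext oU) => y _; rewrite [RHS]mxE.
have CW : class_C 0 U (fun y => invmx (W y)).
  have UI : U `<=` cimg c by move=> y [].
  apply: (class_C_invmx oU) => [y /UI /Wu //|].
  exact: class_C_sub UI (class_C_re_mx 0 (conj altO smO) cX).
have CK : class_C 0 U K := class_C_mulmx oU (class_C_mulmx oU CT CW) CJ.
have oV : open V.
  by apply: (open_nonzero oU); have /(class_C_mxP _ _ oU) := CK; exact.
have [|z1 Vz1 mx] := @max_rank_point _ V (fun y => \rank (complexify ('J F y))) (2 * n)%N z (conj Uz Kz).
  by move=> y _; exact: rank_leq_row.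
have VU : V `<=` repdom pi c c' by move=> y [].
have [c1 [ad ker]] := adapted_chart_max_rank hpi cX c'B oV Vz1 VU mx.
set x1 := cinv c z1 in ad ker; set k := (_ - _)%N in ad ker.
have [[_ dimn] iso] := lag (pi x1).
(* The fibre has dimension 2n - rank at this point, so the complex rank is n and the real rank is
   2n, half of the real dimension 4n, as [lagrangian_kernel] requires. *)
have kn : k = n by apply: (dimn x1); split=> //; exists c1.
have rk := rank_leq_row (complexify ('J F z1)).
have [zi zd] := VU _ Vz1.
have comm : stdJ R (2 * n)%N *m 'J F z1 = 'J F z1 *m stdJ R m.
  exact: holomorphic_jacobian (rep_holomorphic hpi cX c'B) (VU _ Vz1).
case: Vz1 => _ /eqP[]; rewrite /K lagrangian_kernel ?mxE//; first exact: Wu.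
  rewrite (complexify_blocks comm) rank_realify; move: kn rk; rewrite /k -/F.
  by move: (\rank _) => r; lia.
move=> u v u0 v0; rewrite [LHS]mx11_scalar.
have altz : alternating2 (chart_tensor Omega c z1) by exact: alternating_chart.
rewrite (re_mxE u v altz) (_ : chart_tensor _ _ _ _ _ = 0) ?raddf0//.
by apply: iso; (split; [by []|exists k, c1; split=> //; exact: ker]).
Qed.

End LagrangianFibration.

End Coisotropy.

(** * Combinations and pullbacks of forms on manifolds *)

Section ComplexCombination.
Context {R : realType} {V : normedModType R}.
Implicit Types (U : set V) (f h : V -> R[i]).

Lemma csmooth_ext U f h : open U -> (forall x, U x -> f x = h x) -> csmooth_on U f -> csmooth_on U h.
Proof.
move=> oU E [sr si]; split=> k; [apply: class_C_ext oU _ (sr k)|apply: class_C_ext oU _ (si k)];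
  by move=> x Ux; rewrite E.
Qed.

Lemma csmooth_local U f : (forall x, U x -> exists2 U', U' x & csmooth_on U' f) -> csmooth_on U f.
Proof.
by move=> H; split=> k; apply: class_C_local => x /H[U' U'x [sr si]]; exists U'.
Qed.

Let Re_comb (t : R[i]) f h : (fun x => complex.Re (f x + t * h x) : R^o) =
  (fun x => complex.Re (f x) : R^o) + (complex.Re t *: (fun x => complex.Re (h x) : R^o)
    + (- complex.Im t) *: (fun x => complex.Im (h x) : R^o)).
Proof. by apply: boolp.funext => x; rewrite ReD ReM -mulNr. Qed.

Let Im_comb (t : R[i]) f h : (fun x => complex.Im (f x + t * h x) : R^o) =
  (fun x => complex.Im (f x) : R^o) + (complex.Re t *: (fun x => complex.Im (h x) : R^o)
    + complex.Im t *: (fun x => complex.Re (h x) : R^o)).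
Proof. by apply: boolp.funext => x; rewrite ImD ImM. Qed.

Lemma csmooth_comb U (t : R[i]) f h : open U -> csmooth_on U f -> csmooth_on U h ->
  csmooth_on U (fun x => f x + t * h x).
Proof.
move=> oU [fr fi] [hr hi]; split=> k.
  rewrite Re_comb; apply: (class_C_add oU (fr k)); apply: (class_C_add oU).
    exact: class_C_scale oU (hr k).
  exact: class_C_scale oU (hi k).
rewrite Im_comb; apply: (class_C_add oU (fi k)); apply: (class_C_add oU).
  exact: class_C_scale oU (hi k).
exact: class_C_scale oU (hr k).
Qed.

Lemma cderive_comb U (t : R[i]) f h v x : U x -> csmooth_on U f -> csmooth_on U h ->
  cderive (fun y => f y + t * h y) v x = cderive f v x + t * cderive h v x.
Proof.
move=> Ux [fr fi] [hr hi].
have D (g : V -> R^o) : smooth_on U g -> derivable g x v.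
  by move=> sg; apply: diff_derivable; exact: (sg 1%N).1.
have [dfr dfi dhr dhi] := And4 (D _ fr) (D _ fi) (D _ hr) (D _ hi).
have D3 (p q r : V -> R^o) (a b : R) : derivable p x v -> derivable q x v -> derivable r x v ->
    'D_v (p + (a *: q + b *: r)) x = 'D_v p x + (a * 'D_v q x + b * 'D_v r x).
  move=> dp dq dr; have daq := @derivableZ _ _ _ _ a _ _ dq; have dbr := @derivableZ _ _ _ _ b _ _ dr.
  rewrite (deriveD dp (derivableD daq dbr)) (deriveD daq dbr).
  by rewrite (deriveZ a dq) (deriveZ b dr).
rewrite /cderive Re_comb Im_comb (D3 _ _ _ _ _ dfr dhr dhi) (D3 _ _ _ _ _ dfi dhi dhr).
by apply: complexP; rewrite !ReImE /= ?mulNr.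
Qed.

Lemma cderive_near_eq f h v x : (\near x, f x = h x) -> cderive f v x = cderive h v x.
Proof.
move=> E; congr (_ +i* _); apply: near_eq_derive; move: E; apply: filterS => y -> //.
Qed.

End ComplexCombination.

Section PullbackForms.
Context {R : realType} {d e : nat} {M : smoothManifold R d} {M' : smoothManifold R e}.
Variables (f : M -> M') (Psi : tensor_field M').
Hypotheses (sf : smooth_map f) (tf : two_form Psi).

Let alt x : alternating2 (Psi x) := tf.1 x.

Lemma pullbackE x u v : pullback f Psi x u v =
  Psi (f x) (u *m repD f (chart_at x) (chart_at (f x)) x) (v *m repD f (chart_at x) (chart_at (f x)) x).
Proof. by rewrite /pullback !mdiffE. Qed.

Let in_chart_pullback_tensor c c' u v z : atlas M c -> atlas M' c' -> repdom f c c' z ->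
  in_chart (pullback f Psi) c u v z =
  chart_tensor Psi c' (rep f c c' z) (u *m 'J (rep f c c') z) (v *m 'J (rep f c c') z).
Proof. by move=> cM c'M zd; apply: in_chart_pullback => //; exact: atlas_smooth_chart. Qed.

Let open_dom c c' : atlas M c -> atlas M' c' -> open (repdom f c c').
Proof. by move=> cM c'M; apply: open_repdom sf.1; exact: atlas_chart. Qed.

Lemma two_form_pullback : two_form (pullback f Psi).
Proof.
split=> [x|c u v cM].
  have := alternating2_map (repD f (chart_at x) (chart_at (f x)) x) (alt (f x)).
  by congr alternating2; apply: boolp.funext => u; apply: boolp.funext => v; rewrite pullbackE.
apply: csmooth_local => z zi; pose c' := chart_at (f (cinv c z)).
have c'M : atlas M' c' by exact: chart_at_atlas.
have [_ oi _ _ _] := atlas_chart c'M.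
exists (repdom f c c'); first by split=> //; exact: chart_at_dom.
have sr : smooth_on (repdom f c c') (rep f c c') by apply: smooth_rep => //; exact: atlas_smooth_chart.
have si y : repdom f c c' y -> cimg c' (rep f c c' y) by move=> [_ yd]; exact: cimg_cmap.
have sm a b : csmooth_on (cimg c') (fun y => chart_tensor Psi c' y a b) by exact: tf.2.
have alt' y := alternating_chart c' y alt.
apply: csmooth_ext (open_dom cM c'M) _ (csmooth_pullback (open_dom cM c'M) oi si sr alt' sm u v).
by move=> y yd /=; rewrite (in_chart_pullback_tensor u v cM c'M yd).
Qed.

Lemma closed_form_pullback : closed_form Psi -> closed_form (pullback f Psi).
Proof.
move=> cl c z u v w cM zi; pose c' := chart_at (f (cinv c z)).
have c'M : atlas M' c' by exact: chart_at_atlas.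
have [_ oi _ _ _] := atlas_chart c'M.
have zd : repdom f c c' z by split=> //; exact: chart_at_dom.
have sr : smooth_on (repdom f c c') (rep f c c') by apply: smooth_rep => //; exact: atlas_smooth_chart.
have si y : repdom f c c' y -> cimg c' (rep f c c' y) by move=> [_ yd]; exact: cimg_cmap.
have E a b : \forall y \near z, in_chart (pullback f Psi) c a b y =
    chart_tensor Psi c' (rep f c c' y) (a *m 'J (rep f c c') y) (b *m 'J (rep f c c') y).
  have : nbhs z (repdom f c c') by apply: open_nbhs_nbhs; split=> //; exact: open_dom.
  by apply: filterS => y yd; exact: in_chart_pullback_tensor.
rewrite (cderive_near_eq u (E v w)) (cderive_near_eq v (E u w)) (cderive_near_eq w (E u v)).
have sm a b : csmooth_on (cimg c') (fun y => chart_tensor Psi c' y a b) by exact: tf.2.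
have alt' y := alternating_chart c' y alt.
have := closed_pullback (open_dom cM c'M) si sr alt' sm u v w zd.
apply=> a b p; apply: cl => //; exact: si.
Qed.

End PullbackForms.

(** * Tangent spaces of the fibres *)

Section TangentSpaces.
Context {R : realType}.

Lemma hodge20_unique d (a : two_tensor R d) (I : 'M[R]_d) :
  alternating2 a -> hodge20 I a -> Defs.nondegenerate a -> I = - im_mx a *m invmx (re_mx a).
Proof.
by move=> alt h20 nd; rewrite -(hodge20_mxE alt h20) mulmxK//; exact: re_mx_unit alt h20 nd.
Qed.

Lemma derive_constant_line (V W : normedModType R) (f : V -> W) (z w : V) :
  (\forall h \near (0 : R), f (z + h *: w) = f z) -> 'D_w f z = 0.
Proof.
move=> E; apply/cvg_lim => //.
have E0 : \forall h \near (0 : R)^', h^-1 *: (f (h *: w + z) - f z) = 0.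
  apply: nbhs_dnbhs; move: E; apply: filterS => h; rewrite [h *: w + z]addrC => ->.
  by rewrite subrr scaler0.
apply: (@cvg_trans _ ((fun=> 0 : W) @ (0 : R)^')); last exact: cvg_cst.
by apply: near_eq_cvg; move: E0; apply: filterS => h /= ->.
Qed.

Lemma slice_line N k (z w : 'rV[R]_(N + N)) h : slice N k z -> slice N k w -> slice N k (z + h *: w).
Proof.
by move=> sz sw j kj; have [z1 z2] := sz j kj; have [w1 w2] := sw j kj; rewrite !mxE z1 z2 w1 w2 mulr0 addr0.
Qed.

Section TangentKernel.
Variables (N m : nat) (X : complexManifold R N) (B : complexManifold R m) (pi : X -> B).
Hypothesis hpi : holomorphic_map (std_complex X) (std_complex B) pi.

(** In an adapted chart the fibre is a slice, so a line in a tangent direction stays in the fibre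
    for small parameters, and [pi] is constant along it. *)
Lemma tangent_kernel b x u : tangent (fiber pi b) x u ->
  u *m repD pi (chart_at x) (chart_at (pi x)) x = 0.
Proof.
move=> [Fx [k [c1 [[hc1 xc1 kN fib] sl]]]]; have [sf _] := hpi.
have sc1 := holomorphic_smooth_chart hc1; have ac1 := sc1.1.
pose c' := chart_at (pi x); pose z := cmap c1 x.
have xc' : cdom c' (pi x) by exact: chart_at_dom.
have dG : differentiable (rep pi c1 c') z by exact: (rep_differentiable sf sc1 (smooth_chart_at (pi x))).
rewrite (repD_transl sf (smooth_chart_at x) sc1 (smooth_chart_at (pi x)) (chart_at_dom x) xc1 xc').
rewrite mulmxA -to_chartE; move: (to_chart c1 x u) sl => w sl.
apply: (eq_trans (esym (diffEjacobian _ _ _))); apply: (eq_trans (esym (deriveE _ dG))).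
apply: derive_constant_line.
have [_ oi _ _ _] := ac1.
have cl : {for (0 : R), continuous (fun h : R => z + h *: w)}.
  by apply: cvgD; [exact: cvg_cst|apply: cvgZr_tmp; exact: cvg_id].
have H : \forall h \near (0 : R), cimg c1 (z + h *: w).
  by apply: cl; rewrite scale0r addr0; apply: open_nbhs_nbhs; split=> //; exact: cimg_cmap.
apply: filterS H => h zi; have yc := cimg_cdom ac1 zi.
have /(fib _ xc1) zs := Fx.
have : fiber pi b (cinv c1 (z + h *: w)).
  by apply/(fib _ yc); rewrite cinvK//; exact: slice_line.
by rewrite /fiber /rep /= => ->; rewrite /z cmapK// Fx.
Qed.

Lemma tangent_stdJ b x u : tangent (fiber pi b) x u -> tangent (fiber pi b) x (u *m stdJ R N).
Proof.
move=> [Fx [k [c1 [ad sl]]]]; split=> //; exists k, c1; split=> //.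
have [hc1 xc1 _ _] := ad.
suff : to_chart c1 x (u *m stdJ R N) = to_chart c1 x u *m stdJ R N by move=> ->; exact: sliceJ.
rewrite !to_chartE -!mulmxA; congr (_ *m _).
have [_ /(_ _ (chart_at_atlas x)) [_ h]] := hc1.
by apply: (holomorphic_jacobian h); exists x; rewrite //; split=> //; exact: chart_at_dom.
Qed.

End TangentKernel.

End TangentSpaces.

(** * The twisted form and its complex structure *)

Section TwistedForm.
Context {R : realType}.
Variables (n m : nat) (X : complexManifold R (2 * n)%N) (Omega : tensor_field X)
  (B : complexManifold R m) (pi : X -> B) (eta : tensor_field B) (t : R[i]).
Hypotheses (HOmega : holomorphically_symplectic Omega) (Hpi : lagrangian_fibration Omega pi).
Hypotheses (eta_form : two_form eta) (eta_closed : closed_form eta).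
Hypothesis eta_type : forall b, hodge20_11 (std_complex B b) (eta b).

Let N := (2 * n)%N.
Let Psi : tensor_field X := twisted Omega pi eta t.
Let P x := repD pi (chart_at x) (chart_at (pi x)) x.
Let hpi : holomorphic_map (std_complex X) (std_complex B) pi. Proof. by case: Hpi. Qed.

(** The formula forced by type (2,0) is taken as the definition, so that smoothness can be read off
    from the form. Uniqueness identifies it with the structure given by [twisted_structure]. *)
Definition twisted_endo : endo_field X := fun x => - im_mx (Psi x) *m invmx (re_mx (Psi x)).

Let PsiE x : Psi x = fun u v => Omega x u v + t * eta (pi x) (u *m P x) (v *m P x).
Proof. by apply: boolp.funext => u; apply: boolp.funext => v; rewrite /Psi /twisted pullbackE. Qed.

Lemma twisted_pointwise x : [/\ alternating2 (Psi x), Defs.nondegenerate (Psi x),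
  twisted_endo x *m twisted_endo x = - 1%:M /\ hodge20 (twisted_endo x) (Psi x),
  exists2 S, S \in unitmx & twisted_endo x *m S = S *m stdJ R N &
  twisted_endo x *m P x = P x *m stdJ R m /\
  forall u : 'rV_(N + N), u *m P x = 0 -> u *m twisted_endo x = u *m stdJ R N].
Proof.
have [[altO _] _ h20O _ ndO] := HOmega.
have PJ : stdJ R N *m P x = P x *m stdJ R m.
  exact: (repD_comm hpi (chart_at_atlas x) (chart_at_atlas (pi x)) (chart_at_dom x) (chart_at_dom (pi x))).
have [] := @twisted_structure R N m (Omega x) (eta (pi x)) (P x) t (altO x) (h20O x) (ndO x)
  (eta_form.1 (pi x)) (eta_type (pi x)) PJ (fibration_coisotropic HOmega Hpi x).
rewrite -PsiE => alt nd [I [S [[II h20] [uS IS] IP Iker]]].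
have IE : twisted_endo x = I by rewrite (hodge20_unique alt h20 nd).
by rewrite IE; split=> //; exists S.
Qed.

Let altPsi x : alternating2 (Psi x). Proof. by have [] := twisted_pointwise x. Qed.
Let ndPsi x : Defs.nondegenerate (Psi x). Proof. by have [] := twisted_pointwise x. Qed.
Let h20Psi x : hodge20 (twisted_endo x) (Psi x). Proof. by have [_ _ []] := twisted_pointwise x. Qed.

Lemma two_form_twisted : two_form Psi.
Proof.
split=> // c u v cX; have [_ oi _ _ _] := atlas_chart cX; have [[_ smO] _ _ _ _] := HOmega.
by apply: (csmooth_comb t oi (smO _ _ _ cX)); exact: (two_form_pullback hpi.1 eta_form).2.
Qed.

Lemma closed_form_twisted : closed_form Psi.
Proof.
move=> c z u v w cX zi; have [[_ smO] clO _ _ _] := HOmega.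
have D a b p : cderive (in_chart Psi c a b) p z =
    cderive (in_chart Omega c a b) p z + t * cderive (in_chart (pullback pi eta) c a b) p z.
  by apply: (cderive_comb t p zi (smO _ _ _ cX)); exact: (two_form_pullback hpi.1 eta_form).2.
have E1 := clO c z u v w cX zi; have E2 := closed_form_pullback hpi.1 eta_form eta_closed u v w cX zi.
have comb (a a' b b' p p' : R[i]) : a - b + p = 0 -> a' - b' + p' = 0 ->
    a + t * a' - (b + t * b') + (p + t * p') = 0.
  move=> e1 e2; rewrite -[RHS](addr0 0) -{1}e1 -[in X in _ = _ + X](mulr0 t) -e2; ring.
by rewrite !D; exact: comb.
Qed.

(** Conjugating by the change of coordinates gives an endomorphism for which the form in the chart
    is of type (2,0); by uniqueness it obeys the same formula there. *)
Lemma twisted_endo_chart c z u : atlas X c -> cimg c z ->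
  to_chart c (cinv c z) (of_chart c (cinv c z) u *m twisted_endo (cinv c z)) =
  u *m (- im_mx (chart_tensor Psi c z) *m invmx (re_mx (chart_tensor Psi c z))) /\
  re_mx (chart_tensor Psi c z) \in unitmx.
Proof.
move=> cX zi; set x := cinv c z.
have sc := atlas_smooth_chart cX; have xc : cdom c x by apply: cimg_cdom => //; exact: atlas_chart.
have TV := transDV sc (smooth_chart_at x) xc (chart_at_dom x).
have VT := transDV (smooth_chart_at x) sc (chart_at_dom x) xc.
have altc : alternating2 (chart_tensor Psi c z) by exact: alternating_chart.
have ndc : Defs.nondegenerate (chart_tensor Psi c z) by exact: nondegenerate_chart.
have h20c : hodge20 (transD c (chart_at x) x *m twisted_endo x *m transD (chart_at x) c x) (chart_tensor Psi c z).
  have cancel (T V I : 'M[R]_(N + N)) (w : 'rV[R]_(N + N)) : V *m T = 1%:M -> w *m (T *m I *m V) *m T = w *m T *m I.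
    by move=> E; rewrite -!mulmxA E mulmx1.
  move=> a b; rewrite !(chart_tensorE Psi c z) (cancel _ _ _ a VT) (cancel _ _ _ b VT); exact: h20Psi.
split; last exact: re_mx_unit altc h20c ndc.
rewrite -(hodge20_unique altc h20c ndc) to_chartE of_chartE.
by move: (transD _ _ _) (transD _ _ _) (twisted_endo x) => T V I; rewrite !mulmxA.
Qed.

Lemma almost_complex_twisted : almost_complex twisted_endo.
Proof.
split=> [x|c u cX k]; first by have [_ _ []] := twisted_pointwise x.
have [_ oi _ _ _] := atlas_chart cX.
have Cre := class_C_re_mx k two_form_twisted cX; have Cim := class_C_im_mx k two_form_twisted cX.
have Cinv : class_C k (cimg c) (fun z => invmx (re_mx (chart_tensor Psi c z))).
  by apply: (class_C_invmx oi _ Cre) => z zi; have [] := twisted_endo_chart u cX zi.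
have C := class_C_mulmx oi (class_C_mulmx oi (class_C_cst k (cimg c) (- u)) Cim) Cinv.
apply: class_C_ext oi _ C => z zi; have [-> _] := twisted_endo_chart u cX zi.
by rewrite !mulNmx mulmxN mulmxA.
Qed.

Lemma c_symplectic_twisted : c_symplectic n Psi.
Proof.
split.
- by rewrite /N; lia.
- exact: two_form_twisted.
- exact: closed_form_twisted.
- move=> x v; have [alt nd [_ h20] [S uS IS] _] := twisted_pointwise x.
  exact: wedge_pow_type20_eq0 alt h20 uS IS v.
- move=> x; have [alt nd [_ h20] [S uS IS] _] := twisted_pointwise x.
  exact: wedge_pow_type20_neq0 alt h20 uS IS nd.
Qed.

Lemma unique_twisted_endo : unique (induced_complex_structure Psi) twisted_endo.
Proof.
split; first by split; [exact: almost_complex_twisted|split].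
move=> I [_ H]; apply: boolp.funext => x; have [h20 nd] := H x.
by rewrite (hodge20_unique (altPsi x) h20 nd).
Qed.

(** Tangent vectors of the fibre are killed by d pi, so the added term vanishes on them; the
    dimension is a property of the fibre in [X] alone. *)
Lemma lagrangian_twisted b : lagrangian Psi (fiber pi b).
Proof.
have [_ _ _ /(_ b)[dim iso]] := Hpi; split=> // x u v tu tv.
rewrite PsiE (iso x u v tu tv) add0r (tangent_kernel hpi tu) alt0l ?mulr0//; exact: eta_form.1.
Qed.

Lemma holomorphic_twisted : holomorphic_map twisted_endo (std_complex B) pi.
Proof.
split=> [|x u]; first exact: hpi.1.
by have [_ _ _ _ [IP _]] := twisted_pointwise x; rewrite !mdiffE -[LHS]mulmxA [X in u *m X]IP mulmxA.
Qed.

Lemma tangent_twisted b x u : tangent (fiber pi b) x u ->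
  [/\ tangent (fiber pi b) x (u *m std_complex X x),
      tangent (fiber pi b) x (u *m twisted_endo x) &
      u *m twisted_endo x = u *m std_complex X x].
Proof.
move=> tu; have [_ _ _ _ [_ ker]] := twisted_pointwise x.
have E : u *m twisted_endo x = u *m std_complex X x by apply: ker; exact: (tangent_kernel hpi tu).
by rewrite E; split=> //; exact: tangent_stdJ.
Qed.

End TwistedForm.


Theorem theorem3p3 (R : realType) (n m : nat)
    (X : complexManifold R (2 * n)%N) (Omega : tensor_field X)
    (B : complexManifold R m) (pi : X -> B) (eta : tensor_field B)
    (HOmega : holomorphically_symplectic Omega)
    (Hpi : lagrangian_fibration Omega pi)
    (eta_form : two_form eta) (eta_closed : closed_form eta)
    (eta_type : forall b, hodge20_11 (std_complex B b) (eta b))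
    (t : R[i]) :
  c_symplectic n (twisted Omega pi eta t) /\
  exists I : endo_field X,
    [/\ unique (induced_complex_structure (twisted Omega pi eta t)) I,
        holomorphic_map I (std_complex B) pi,
        (forall b, lagrangian (twisted Omega pi eta t) (fiber pi b)) &
        (forall b x u, tangent (fiber pi b) x u ->
           [/\ tangent (fiber pi b) x (u *m std_complex X x),
               tangent (fiber pi b) x (u *m I x) &
               u *m I x = u *m std_complex X x])].

Proof.
split; first exact: c_symplectic_twisted.
exists (twisted_endo Omega pi eta t); split.
- exact: unique_twisted_endo.
- exact: holomorphic_twisted.
- exact: lagrangian_twisted.
- by move=> b x u; exact: tangent_twisted.
Qed.
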